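(* Let $n\ge 0$ be an integer and $w\in\mathbb{C}$ with $\Re w>0$. Then $$\mathbf{S}_n(w)=-\log\hat\Gamma_n(w)-\zeta'(-n)+(-1)^{n+1}n!\,b_n(w)\,H_n,$$ where $\hat\Gamma_n$ is the Bendersky Gamma function, $\zeta$ the Riemann zeta function, and $H_n$ the $n$-th harmonic number ($H_0=0$).
   Context: For an integer $n\ge 0$ and $\Re w>0$, the partial sum $\sum_{k=0}^{s-1}(k+w)^n\log(k+w)$ (principal logarithm) has, as the integer $s\to+\infty$, a unique asymptotic expansion in the family of functions $s^m\log s$ ($m\ge 0$) and $s^m$ ($m\in\mathbb{Z}$); $\mathbf{S}_n(w)$ is its constant term (coefficient of $s^0$). The modified Bernoulli polynomials $b_k(w)$ are defined by $\frac{e^{-wt}}{1-e^{-t}}=\frac1t+\sum_{k\ge0}b_k(w)t^k$. The Bendersky Gamma functions $\hat\Gamma_n$, $n\ge0$, are holomorphic and zero-free on $\Re w>0$, satisfy $\hat\Gamma_n(w+1)=w^{w^n}\hat\Gamma_n(w)$ and $\hat\Gamma_n(1)=1$ ($\hat\Gamma_0$ is Euler's Gamma function), and $\log\hat\Gamma_n$ is the holomorphic logarithm on $\Re w>0$ vanishing at $w=1$. They are determined by the known formula $\log\hat\Gamma_n(w)=\zeta_H'(-n,w)-\zeta'(-n)$, where $\zeta_H(s,w)=\sum_{k\ge0}(k+w)^{-s}$ (continued meromorphically in $s$) is the Hurwitz zeta function and $\zeta_H'=\partial\zeta_H/\partial s$. *)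

(* Defs.v *)
From Stdlib Require Import Reals ZArith ClassicalEpsilon.
From Coquelicot Require Import Coquelicot.
Open Scope R_scope.

(** Elementary complex functions *)

Definition Cexp (z : C) : C := (exp (Re z) * cos (Im z), exp (Re z) * sin (Im z)).

(* Principal argument, with values in (-PI, PI]; only meaningful for z <> 0. *)
Definition Carg (z : C) : R :=
  if Rle_dec 0 (Im z) then acos (Re z / Cmod z) else - acos (Re z / Cmod z).

Definition Clog (z : C) : C := (ln (Cmod z), Carg z).

(* Complex power with the principal logarithm. *)
Definition Cpower (z a : C) : C := Cexp (a * Clog z)%C.

Definition holomorphic_on (U : C -> Prop) (f : C -> C) : Prop :=
  forall z : C, U z -> ex_derive f z.

Definition right_half_plane (z : C) : Prop := 0 < Re z.

(** Asymptotic expansions along the integers *)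

(* Coefficients: p m for s^m log s (m >= 0) and q m for s^m (m in Z).  Only
   finitely many growing terms occur (degrees at most M), and for every N the
   remainder after the terms down to s^(-N) is o(s^(-N)). *)
Definition expansion_upto (p : nat -> C) (q : Z -> C) (M N s : nat) : C :=
  (sum_n (fun m => p m * RtoC (INR s ^ m * ln (INR s))) M
   + sum_n (fun j => let m := (Z.of_nat j - Z.of_nat N)%Z in
                     q m * RtoC (powerRZ (INR s) m)) (M + N))%C.

Definition is_asymptotic_expansion (f : nat -> C) (p : nat -> C) (q : Z -> C) : Prop :=
  exists M : nat,
    (forall m : nat, (M < m)%nat -> p m = RtoC 0) /\
    (forall m : Z, (Z.of_nat M < m)%Z -> q m = RtoC 0) /\
    (forall N : nat,
       is_lim_seq
         (fun s => INR s ^ N * Cmod (f s - expansion_upto p q M N s)%C) 0).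

Definition constant_term (f : nat -> C) : C :=
  epsilon (inhabits (RtoC 0))
    (fun c => exists (p : nat -> C) (q : Z -> C),
       is_asymptotic_expansion f p q /\ c = q 0%Z).

(* [sum_n u N] has N+1 terms, so for s >= 1 this is the sum over 0 <= k <= s-1;
   the value at s = 0 is irrelevant. *)
Definition log_partial_sum (n : nat) (w : C) (s : nat) : C :=
  sum_n (fun k => (RtoC (INR k) + w) ^ n * Clog (RtoC (INR k) + w))%C (pred s).

Definition S_const (n : nat) (w : C) : C := constant_term (log_partial_sum n w).

(** Modified Bernoulli polynomials *)

Definition is_modified_bernoulli (w : C) (b : nat -> C) : Prop :=
  exists r : R, 0 < r /\
    forall t : C, 0 < Cmod t < r ->
      is_pseries b t (Cexp (- (w * t)) / (1 - Cexp (- t)) - 1 / t)%C.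

Definition modified_bernoulli (k : nat) (w : C) : C :=
  epsilon (inhabits (fun _ => RtoC 0)) (is_modified_bernoulli w) k.

(** Hurwitz and Riemann zeta functions *)

(* Z is the meromorphic continuation to C, with its only possible pole at 1, of
   the sum over k of u s k, which converges for Re s > 1.  This determines Z
   away from 1; the value of Z at 1 is left unspecified. *)
Definition is_zeta_continuation (u : C -> nat -> C) (Z : C -> C) : Prop :=
  holomorphic_on (fun s => s <> RtoC 1) Z /\
  (exists (m : nat) (l : C),
     filterlim (fun s : C => (s - 1) ^ m * Z s)%C (locally' (RtoC 1)) (locally l)) /\
  (forall s : C, 1 < Re s -> is_series (u s) (Z s)).

Definition zeta_continuation (u : C -> nat -> C) : C -> C :=
  epsilon (inhabits (fun _ => RtoC 0)) (is_zeta_continuation u).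

Definition hurwitz_zeta (s w : C) : C :=
  zeta_continuation (fun s k => Cpower (RtoC (INR k) + w)%C (- s)%C) s.

Definition riemann_zeta (s : C) : C :=
  zeta_continuation (fun s k => Cpower (RtoC (INR (S k))) (- s)%C) s.

(* Derivatives with respect to s. *)
Definition hurwitz_zeta' (s w : C) : C := C_derive (fun s => hurwitz_zeta s w) s.

Definition riemann_zeta' (s : C) : C := C_derive riemann_zeta s.

(** Bendersky Gamma functions *)

(* The equations G (w + 1) = w ^ (w ^ n) * G w and G 1 = 1 do not determine G
   among zero-free holomorphic functions (they allow periodic factors), so G is
   fixed by log G w = zeta_H'(-n, w) - zeta'(-n), from which they follow. *)
Definition bendersky_gamma (n : nat) (w : C) : C :=
  Cexp (hurwitz_zeta' (- RtoC (INR n)) w - riemann_zeta' (- RtoC (INR n)))%C.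

Definition is_log_bendersky_gamma (n : nat) (L : C -> C) : Prop :=
  holomorphic_on right_half_plane L /\
  (forall w : C, right_half_plane w -> Cexp (L w) = bendersky_gamma n w) /\
  L (RtoC 1) = RtoC 0.

Definition log_bendersky_gamma (n : nat) (w : C) : C :=
  epsilon (inhabits (fun _ => RtoC 0)) (is_log_bendersky_gamma n) w.

(* The empty sum 0 for n = 0. *)
Definition harmonic (n : nat) : R := sum_n_m (fun k => / INR k) 1 n.

(* Main.v *)
Require Import Defs.
From Stdlib Require Import Reals Factorial ZArith Arith Lra Lia Psatz ClassicalEpsilon.
From Coquelicot Require Import Coquelicot.
Open Scope R_scope.

(** For [L] large, the Euler-Maclaurin corrected sums
      [E_N(s) = sum_(k < N) (k + w)^(-s) + N^(1-s) / (s - 1)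
                + sum_(k < L) b_k(w) s (s+1) ... (s+k-1) N^(-s-k)]
    satisfy [E_(N+1)(s) - E_N(s) = O(N^(-s-L))], by the recurrence defining the [b_k(w)].
    Hence they converge, locally uniformly in [s] and [w], to the continuation of
    [zeta_H(s, w)], and so do their derivatives in [s].  At [s = - n] the derivative of [E_N] is
    minus the partial sum of [(k + w)^n log (k + w)] plus an explicit combination of
    [N^m log N] and [N^m]; this is the asymptotic expansion, and the constant coefficient of
    the explicit part, [b_n(w)] times the derivative of [s (s+1) ... (s+n-1)] at [- n], is
    [(-1)^(n+1) n! H_n b_n(w)].

    Holomorphic functions are only assumed complex differentiable, so the uniqueness of the
    continuation and the passage to the limit rest on Goursat's theorem, through the
    Cauchy estimate. *)

(** Zeta, the polynomials $b_k$, $\log\hat\Gamma_n$ and the constant term are all picked by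
    [epsilon], so each needs an explicit witness and a uniqueness proof before it can be computed
    with. Multiplying by [s - 1] makes $E_N$ entire in [s]; the pole is divided out again only away
    from 1, and for the derivative at [- n] on a disc of radius 1/2.

    Convergence of the derivatives is not enough: an expansion requires a remainder $o(N^{-P})$ for
    every $P$. A larger [L] makes the increments as small as desired, the Cauchy estimate transfers
    this to the derivatives in [s], and summing the increments from $N$ on bounds the distance to
    the limit.

    Logarithms may accompany only nonnegative powers of $N$. This is due to the integer point:
    $s(s+1)\cdots(s+k-1)$ vanishes at $-n$ for $k>n$, while its derivative there survives and
    produces the negative powers. Since $\log\hat\Gamma_n$ must be holomorphic in $w$, the limit
    argument is run a second time in that variable. *)

(** * Moduli, real and imaginary parts *)

Lemma im_le_Cmod (z : C) : Rabs (Im z) <= Cmod z.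
Proof. eapply Rle_trans; [apply Rmax_r|apply Rmax_Cmod]. Qed.

Lemma Cmod_le_re_im (z : C) : Cmod z <= Rabs (Re z) + Rabs (Im z).
Proof.
replace z with (RtoC (Re z) + RtoC (Im z) * Ci)%C at 1.
- eapply Rle_trans; [apply Cmod_triangle|].
  rewrite Cmod_mult, !Cmod_R, Cmod_Ci. lra.
- destruct z as [x y]. unfold RtoC, Ci, Cplus, Cmult; simpl. f_equal; ring.
Qed.

Lemma Cmod_triangle_rev (x y : C) : Cmod x - Cmod y <= Cmod (x - y).
Proof.
assert (H := Cmod_triangle (x - y) y).
replace (x - y + y)%C with x in H by ring. lra.
Qed.

Lemma Cmod_sub_sym (x y : C) : Cmod (x - y) = Cmod (y - x).
Proof. rewrite <- Cmod_opp. f_equal. ring. Qed.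

Lemma Cmod_sub_triangle (x y : C) : Cmod (x - y) <= Cmod x + Cmod y.
Proof. unfold Cminus. rewrite <- (Cmod_opp y). apply Cmod_triangle. Qed.

Lemma re_minus (a b : C) : Re (a - b) = Re a - Re b.
Proof. unfold Cminus. rewrite re_plus, re_opp. ring. Qed.

Lemma im_minus (a b : C) : Im (a - b) = Im a - Im b.
Proof. unfold Cminus. rewrite im_plus, im_opp. ring. Qed.

Lemma C_ext (a b : C) : Re a = Re b -> Im a = Im b -> a = b.
Proof. destruct a, b; simpl; intros -> ->; reflexivity. Qed.

Lemma Cmod_small_eq_0 (z : C) : (forall e, 0 < e -> Cmod z <= e) -> z = RtoC 0.
Proof.
intros H. apply Cmod_eq_0. apply Rle_antisym; [|apply Cmod_ge_0].
apply le_epsilon. intros e He. rewrite Rplus_0_l. now apply H.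
Qed.

(** * Complex differentiability *)

(** Complex differentiability with explicit increments, so that [Cmod] estimates apply directly; the
    filter-based notion is recovered below. *)
Definition cderiv (f : C -> C) (z l : C) : Prop :=
  forall e, 0 < e -> exists d, 0 < d /\ forall h, Cmod h < d ->
    Cmod (f (z + h) - f z - l * h)%C <= e * Cmod h.

(** Neighbourhoods in [C_UniformSpace] come from the product structure on pairs of reals;
    [locally_C] exchanges them for discs of [Cmod]. *)
Lemma C_locally_iff (z : C) (P : C -> Prop) :
  locally (T := C_UniformSpace) z P <->
  exists d, 0 < d /\ forall h, Cmod h < d -> P (z + h)%C.
Proof.
rewrite locally_C. split.
- intros [d Hd]. exists d. split; [apply cond_pos|].
  intros h Hh. apply Hd.
  change (Cmod ((z + h) - z)%C < d). now replace (z + h - z)%C with h by ring.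
- intros [d [Hd H]]. exists (mkposreal d Hd). intros y Hy.
  change (Cmod (y - z)%C < d) in Hy.
  replace y with (z + (y - z))%C by ring. now apply H.
Qed.

Lemma cderiv_is_derive (f : C -> C) (z l : C) :
  cderiv f z l <-> is_derive (V := C_NormedModule) f z l.
Proof.
split.
- intros H. split; [apply is_linear_scal_l|].
  intros x Hx. assert (E := @is_filter_lim_locally_unique C_AbsRing (AbsRing_NormedModule C_AbsRing) z x Hx). subst x.
  intros eps. destruct (H eps (cond_pos eps)) as [d [Hd H']].
  apply (proj1 (locally_C z _)).
  apply (proj2 (C_locally_iff z _)). exists d. split; [exact Hd|].
  intros h Hh.
  change (Cmod ((f (z + h) - f z) - ((z + h) - z) * l)%C <= eps * Cmod ((z + h) - z)%C).
  replace (z + h - z)%C with h by ring. rewrite (Cmult_comm h l). now apply H'.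
- intros [_ H] e He. specialize (H z (fun P HP => HP) (mkposreal e He)).
  apply (proj2 (locally_C z _)) in H.
  apply (proj1 (C_locally_iff z _)) in H. destruct H as [d [Hd H]].
  exists d. split; [exact Hd|]. intros h Hh. specialize (H h Hh).
  change (Cmod ((f (z + h) - f z) - ((z + h) - z) * l)%C <= e * Cmod ((z + h) - z)%C) in H.
  replace (z + h - z)%C with h in H by ring. now rewrite (Cmult_comm h l) in H.
Qed.

(** The product and chain rules are stated for the field as a normed module over itself, a structure
    different from [C_NormedModule]; hence this second bridge. *)
Lemma cderiv_is_derive_ring (f : C -> C) (z l : C) :
  cderiv f z l <-> is_derive (K := C_AbsRing) (V := AbsRing_NormedModule C_AbsRing) f z l.
Proof.
split.
- intros H. split; [apply is_linear_scal_l|].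
  intros x Hx.
  assert (E := @is_filter_lim_locally_unique C_AbsRing (AbsRing_NormedModule C_AbsRing) z x Hx).
  subst x.
  intros eps. destruct (H eps (cond_pos eps)) as [d [Hd H']].
  apply (proj1 (locally_C z _)).
  apply (proj2 (C_locally_iff z _)). exists d. split; [exact Hd|].
  intros h Hh.
  change (Cmod ((f (z + h) - f z) - ((z + h) - z) * l)%C <= eps * Cmod ((z + h) - z)%C).
  replace (z + h - z)%C with h by ring. rewrite (Cmult_comm h l). now apply H'.
- intros [_ H] e He. specialize (H z (fun P HP => HP) (mkposreal e He)).
  apply (proj2 (locally_C z _)) in H.
  apply (proj1 (C_locally_iff z _)) in H. destruct H as [d [Hd H]].
  exists d. split; [exact Hd|]. intros h Hh. specialize (H h Hh).
  change (Cmod ((f (z + h) - f z) - ((z + h) - z) * l)%C <= e * Cmod ((z + h) - z)%C) in H.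
  replace (z + h - z)%C with h in H by ring. now rewrite (Cmult_comm h l) in H.
Qed.

Lemma ex_derive_cderiv (f : C -> C) (z : C) :
  ex_derive (V := C_NormedModule) f z <-> exists l, cderiv f z l.
Proof.
split; intros [l H]; exists l; [apply (proj2 (cderiv_is_derive f z l))|
  apply (proj1 (cderiv_is_derive f z l))]; exact H.
Qed.

Lemma cderiv_ext_loc (f g : C -> C) (z l : C) :
  (exists d, 0 < d /\ forall h, Cmod h < d -> f (z + h)%C = g (z + h)%C) ->
  cderiv f z l -> cderiv g z l.
Proof.
intros [d [Hd E]] H e He. destruct (H e He) as [d' [Hd' H']].
exists (Rmin d d'). split; [now apply Rmin_pos|]. intros h Hh.
assert (E0 := E (RtoC 0)). rewrite Cmod_0, Cplus_0_r in E0.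
rewrite <- (E0 Hd), <- E by (eapply Rlt_le_trans; [exact Hh|apply Rmin_l]).
apply H'. eapply Rlt_le_trans; [exact Hh|apply Rmin_r].
Qed.

Lemma cderiv_ext (f g : C -> C) (z l : C) :
  (forall t, f t = g t) -> cderiv f z l -> cderiv g z l.
Proof.
intros E. apply cderiv_ext_loc. exists 1. split; [lra|]. intros; apply E.
Qed.

Lemma cderiv_eq (f : C -> C) (z l l' : C) : l = l' -> cderiv f z l -> cderiv f z l'.
Proof. now intros ->. Qed.

Lemma cderiv_const (c z : C) : cderiv (fun _ => c) z (RtoC 0).
Proof.
intros e He. exists 1. split; [lra|]. intros h _.
replace (c - c - RtoC 0 * h)%C with (RtoC 0) by ring. rewrite Cmod_0.
apply Rmult_le_pos; [lra|apply Cmod_ge_0].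
Qed.

Lemma cderiv_id (z : C) : cderiv (fun t => t) z (RtoC 1).
Proof.
intros e He. exists 1. split; [lra|]. intros h _.
replace (z + h - z - RtoC 1 * h)%C with (RtoC 0) by ring. rewrite Cmod_0.
apply Rmult_le_pos; [lra|apply Cmod_ge_0].
Qed.

Lemma cderiv_plus (f g : C -> C) (z l m : C) :
  cderiv f z l -> cderiv g z m -> cderiv (fun t => f t + g t)%C z (l + m)%C.
Proof.
rewrite !cderiv_is_derive.
exact (is_derive_plus (K := C_AbsRing) (V := C_NormedModule) f g z l m).
Qed.

Lemma cderiv_mult (f g : C -> C) (z l m : C) :
  cderiv f z l -> cderiv g z m ->
  cderiv (fun t => f t * g t)%C z (l * g z + f z * m)%C.
Proof.
rewrite !cderiv_is_derive_ring. intros Hf Hg.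
exact (is_derive_mult (K := C_AbsRing) f g z l m Hf Hg Cmult_comm).
Qed.

Lemma cderiv_comp (f g : C -> C) (z l m : C) :
  cderiv f (g z) l -> cderiv g z m -> cderiv (fun t => f (g t)) z (l * m)%C.
Proof.
rewrite !cderiv_is_derive_ring. intros Hf Hg. rewrite Cmult_comm.
exact (is_derive_comp (K := C_AbsRing) (V := AbsRing_NormedModule C_AbsRing) f g z l m Hf Hg).
Qed.

Lemma cderiv_scal (c : C) (f : C -> C) (z l : C) :
  cderiv f z l -> cderiv (fun t => c * f t)%C z (c * l)%C.
Proof.
intros H. eapply cderiv_eq; [|apply (cderiv_mult (fun _ => c) f z _ _ (cderiv_const c z) H)].
simpl. ring.
Qed.

Lemma cderiv_opp (f : C -> C) (z l : C) : cderiv f z l -> cderiv (fun t => - f t)%C z (- l)%C.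
Proof.
intros H. apply (cderiv_ext (fun t => - RtoC 1 * f t)%C).
- intros t. ring.
- eapply cderiv_eq; [|apply cderiv_scal, H]. ring.
Qed.

Lemma cderiv_minus (f g : C -> C) (z l m : C) :
  cderiv f z l -> cderiv g z m -> cderiv (fun t => f t - g t)%C z (l - m)%C.
Proof. intros Hf Hg. apply (cderiv_plus f (fun t => - g t)%C); [exact Hf|now apply cderiv_opp]. Qed.

Lemma cderiv_cont (f : C -> C) (z l : C) : cderiv f z l ->
  forall e, 0 < e -> exists d, 0 < d /\ forall h, Cmod h < d -> Cmod (f (z + h) - f z)%C < e.
Proof.
intros H e He. destruct (H 1 Rlt_0_1) as [d [Hd H']].
assert (Hl := Cmod_ge_0 l).
exists (Rmin d (e / (2 + Cmod l))). split.
- apply Rmin_pos; [exact Hd|]. apply Rdiv_lt_0_compat; lra.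
- intros h Hh.
  assert (H1 := H' h (Rlt_le_trans _ _ _ Hh (Rmin_l _ _))).
  assert (H2 := Rlt_le_trans _ _ _ Hh (Rmin_r _ _)).
  apply Rmult_lt_compat_r with (r := 2 + Cmod l) in H2; [|lra].
  unfold Rdiv in H2. rewrite Rmult_assoc, Rinv_l, Rmult_1_r in H2 by lra.
  assert (H3 := Cmod_triangle (f (z + h) - f z - l * h)%C (l * h)%C).
  replace (f (z + h) - f z - l * h + l * h)%C with (f (z + h) - f z)%C in H3 by ring.
  rewrite Cmod_mult in H3. assert (Hh0 := Cmod_ge_0 h). nra.
Qed.

Lemma cderiv_unique (f : C -> C) (z l m : C) : cderiv f z l -> cderiv f z m -> l = m.
Proof.
intros Hl Hm. apply cderiv_is_derive in Hl. apply cderiv_is_derive in Hm.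
apply is_C_derive_unique in Hl. apply is_C_derive_unique in Hm. congruence.
Qed.

(** Serves to differentiate [Clog] as a right inverse of [Cexp]. Continuity of [g] puts its
    increment in the range where [f] is nearly linear. *)
Lemma cderiv_inverse (f g : C -> C) (z l : C) :
  (exists d, 0 < d /\ forall h, Cmod h < d -> f (g (z + h)%C) = (z + h)%C) ->
  (forall e, 0 < e -> exists d, 0 < d /\ forall h, Cmod h < d -> Cmod (g (z + h) - g z)%C < e) ->
  cderiv f (g z) l -> l <> RtoC 0 -> cderiv g z (/ l)%C.
Proof.
intros [d0 [Hd0 E]] Hc Hf Hl e He.
assert (Hl' : 0 < Cmod l) by now apply Cmod_gt_0.
(* With [k] the increment of [g], the bound [|h - l k| <= e1 |k|] is used twice: [e1 <= |l| / 2]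
   yields [|l| |k| <= 2 |h|], and the second bound on [e1] then turns the error into [e |h|] after
   division by [l]. *)
set (e1 := Rmin (Cmod l / 2) (e * (Cmod l * Cmod l) / 2)).
assert (He1 : 0 < e1).
{ apply Rmin_pos; [lra|]. apply Rdiv_lt_0_compat; [|lra].
  repeat apply Rmult_lt_0_compat; lra. }
destruct (Hf e1 He1) as [d1 [Hd1 H1]].
destruct (Hc d1 Hd1) as [d2 [Hd2 H2]].
exists (Rmin d0 d2). split; [now apply Rmin_pos|]. intros h Hh.
assert (Hh0 := Rlt_le_trans _ _ _ Hh (Rmin_l _ _)).
assert (Hh2 := Rlt_le_trans _ _ _ Hh (Rmin_r _ _)).
set (k := (g (z + h) - g z)%C).
assert (K := H1 k (H2 h Hh2)).
replace (g z + k)%C with (g (z + h)%C) in K by (unfold k; ring).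
assert (E0 := E (RtoC 0)). rewrite Cmod_0, Cplus_0_r in E0.
rewrite (E h Hh0), (E0 Hd0) in K.
replace (z + h - z - l * k)%C with (h - l * k)%C in K by ring.
assert (Hk := Cmod_ge_0 k). assert (Hhp := Cmod_ge_0 h).
assert (T := Cmod_triangle_rev (l * k) h). rewrite Cmod_sub_sym, Cmod_mult in T.
assert (A1 : e1 <= Cmod l / 2) by apply Rmin_l.
assert (A2 : e1 <= e * (Cmod l * Cmod l) / 2) by apply Rmin_r.
assert (B : Cmod l * Cmod k <= 2 * Cmod h) by nra.
replace (k - / l * h)%C with (- (/ l * (h - l * k)))%C by (field; exact Hl).
rewrite Cmod_opp, Cmod_mult, Cmod_inv by exact Hl.
apply Rmult_le_reg_l with (Cmod l); [exact Hl'|].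
rewrite <- Rmult_assoc, Rinv_r, Rmult_1_l by lra.
eapply Rle_trans; [exact K|].
apply Rle_trans with (e * (Cmod l * Cmod l) / 2 * Cmod k); [nra|].
replace (e * (Cmod l * Cmod l) / 2 * Cmod k) with (e * Cmod l / 2 * (Cmod l * Cmod k)) by field.
apply Rle_trans with (e * Cmod l / 2 * (2 * Cmod h)); [|right; field].
apply Rmult_le_compat_l; [|exact B]. apply Rmult_le_pos; [|lra]. nra.
Qed.

Lemma cderiv_inv (z : C) : z <> RtoC 0 -> cderiv (fun t => / t)%C z (- / (z * z))%C.
Proof.
intros Hz e He.
assert (Hz' : 0 < Cmod z) by now apply Cmod_gt_0.
set (m := Cmod z) in *.
exists (Rmin (m / 2) (e * (m * m * m) / 2)). split.
{ apply Rmin_pos; [lra|]. apply Rdiv_lt_0_compat; [|lra]. repeat apply Rmult_lt_0_compat; lra. }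
intros h Hh.
assert (Hh1 := Rlt_le_trans _ _ _ Hh (Rmin_l _ _)).
assert (Hh2 := Rlt_le_trans _ _ _ Hh (Rmin_r _ _)).
assert (T := Cmod_triangle_rev z (- h)). rewrite Cmod_opp in T.
replace (z - - h)%C with (z + h)%C in T by ring. fold m in T.
assert (Hn : (z + h)%C <> RtoC 0) by (apply Cmod_gt_0; lra).
replace (/ (z + h) - / z - - / (z * z) * h)%C with (h * h / (z * z * (z + h)))%C
  by (field; tauto).
assert (Hzz : (z * z * (z + h))%C <> RtoC 0) by (repeat apply Cmult_neq_0; assumption).
rewrite Cmod_div, !Cmod_mult by exact Hzz. fold m.
set (a := Cmod (z + h)) in *. assert (Hp := Cmod_ge_0 h). set (b := Cmod h) in *.
apply Rmult_le_reg_r with (m * m * a); [repeat apply Rmult_lt_0_compat; lra|].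
unfold Rdiv. rewrite Rmult_assoc, Rinv_l, Rmult_1_r
  by (apply Rgt_not_eq; repeat apply Rmult_lt_0_compat; lra).
apply Rle_trans with (b * (e * (m * m * m) / 2)); [nra|].
replace (e * b * (m * m * a)) with (b * (e * (m * m) * a)) by ring.
apply Rmult_le_compat_l; [exact Hp|].
replace (e * (m * m * m) / 2) with (e * (m * m) * (m / 2)) by field.
apply Rmult_le_compat_l; [|lra]. apply Rlt_le. repeat apply Rmult_lt_0_compat; lra.
Qed.

Lemma cderiv_pow (n : nat) (z : C) :
  cderiv (fun t => t ^ n)%C z (RtoC (INR n) * z ^ (pred n))%C.
Proof.
induction n as [|n IH].
- eapply cderiv_eq; [|exact (cderiv_const (RtoC 1) z)]. simpl. ring.
- apply (cderiv_ext (fun t => t * t ^ n)%C); [intros t; reflexivity|].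
  eapply cderiv_eq; [|apply (cderiv_mult (fun t => t) (fun t => t ^ n)%C _ _ _ (cderiv_id z) IH)].
  rewrite S_INR, RtoC_plus. destruct n; simpl; [|]; ring.
Qed.

(** * Finite complex sums over [k < n] *)

Fixpoint csum (f : nat -> C) (n : nat) : C :=
  match n with O => RtoC 0 | S m => (csum f m + f m)%C end.

Lemma csum_ext (f g : nat -> C) (n : nat) :
  (forall k, (k < n)%nat -> f k = g k) -> csum f n = csum g n.
Proof.
induction n as [|n IH]; intros H; simpl; [reflexivity|].
rewrite IH, H by (intros; try apply H; lia). reflexivity.
Qed.

Lemma csum_plus (f g : nat -> C) (n : nat) :
  csum (fun k => f k + g k)%C n = (csum f n + csum g n)%C.
Proof. induction n as [|n IH]; simpl; [ring|rewrite IH; ring]. Qed.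

Lemma csum_minus (f g : nat -> C) (n : nat) :
  csum (fun k => f k - g k)%C n = (csum f n - csum g n)%C.
Proof. induction n as [|n IH]; simpl; [ring|rewrite IH; ring]. Qed.

Lemma csum_scal (c : C) (f : nat -> C) (n : nat) :
  csum (fun k => c * f k)%C n = (c * csum f n)%C.
Proof. induction n as [|n IH]; simpl; [ring|rewrite IH; ring]. Qed.

Lemma csum_zero (f : nat -> C) (n : nat) :
  (forall k, (k < n)%nat -> f k = RtoC 0) -> csum f n = RtoC 0.
Proof.
induction n as [|n IH]; intros H; simpl; [reflexivity|].
rewrite IH, H by (intros; try apply H; lia). ring.
Qed.

Lemma csum_shift (f : nat -> C) (n : nat) :
  csum f (S n) = (f O + csum (fun k => f (S k)) n)%C.
Proof.
induction n as [|n IH]; [simpl; ring|].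
change (csum f (S (S n))) with (csum f (S n) + f (S n))%C. rewrite IH. simpl. ring.
Qed.

Lemma csum_Cmod_le (f : nat -> C) (B : R) (n : nat) :
  (forall k, (k < n)%nat -> Cmod (f k) <= B) -> Cmod (csum f n) <= INR n * B.
Proof.
induction n as [|n IH]; intros H.
- simpl. rewrite Cmod_0. lra.
- rewrite S_INR. simpl. eapply Rle_trans; [apply Cmod_triangle|].
  assert (H1 := H n (Nat.lt_succ_diag_r n)).
  assert (H2 : Cmod (csum f n) <= INR n * B) by (apply IH; intros; apply H; lia). lra.
Qed.

Lemma csum_sum_n (f : nat -> C) (n : nat) : sum_n f n = csum f (S n).
Proof.
induction n as [|n IH].
- rewrite sum_O. simpl. ring.
- rewrite sum_Sn, IH. reflexivity.
Qed.

(** Both sides run over the triangle [k + j < n], by rows and by diagonals. It regroups truncated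
    Cauchy products by total degree. *)
Lemma csum_triangle (a : nat -> nat -> C) (n : nat) :
  csum (fun k => csum (a k) (n - k)) n =
  csum (fun m => csum (fun k => a k (m - k)%nat) (S m)) n.
Proof.
induction n as [|n IH]; [reflexivity|].
change (csum (fun m => csum (fun k => a k (m - k)%nat) (S m)) (S n))
  with (csum (fun m => csum (fun k => a k (m - k)%nat) (S m)) n
        + csum (fun k => a k (n - k)%nat) (S n))%C.
rewrite <- IH.
rewrite (csum_ext _ (fun k => csum (a k) (n - k) + a k (n - k)%nat)%C).
- rewrite csum_plus. simpl. rewrite Nat.sub_diag. simpl. ring.
- intros k Hk. replace (S n - k)%nat with (S (n - k)) by lia. reflexivity.
Qed.

Lemma cderiv_csum (f : nat -> C -> C) (l : nat -> C) (z : C) (n : nat) :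
  (forall k, (k < n)%nat -> cderiv (f k) z (l k)) ->
  cderiv (fun t => csum (fun k => f k t) n) z (csum l n).
Proof.
induction n as [|n IH]; intros H; simpl.
- apply cderiv_const.
- apply (cderiv_plus (fun t => csum (fun k => f k t) n) (f n)).
  + apply IH. intros; apply H; lia.
  + apply H; lia.
Qed.

(** * The mean value inequality along segments *)

Lemma cderiv_segment_is_derive (f : C -> C) (c z h l : C) (t : R) :
  cderiv f (z + RtoC t * h)%C l ->
  is_derive (fun t => Re (c * f (z + RtoC t * h)%C)%C) t (Re (c * (l * h))%C).
Proof.
intros H. apply is_derive_Reals. intros e He.
(* Adding 1 to each modulus keeps the denominators positive when [c] or [h] is 0. *)
set (K := (Cmod c + 1) * (Cmod h + 1)).
assert (Hc := Cmod_ge_0 c). assert (Hh := Cmod_ge_0 h).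
assert (HK : 0 < K) by (unfold K; nra).
destruct (H (e / (2 * K))) as [d [Hd H']].
{ apply Rdiv_lt_0_compat; lra. }
assert (Hd2 : 0 < d / (Cmod h + 1)) by (apply Rdiv_lt_0_compat; lra).
exists (mkposreal _ Hd2). intros k Hk0 Hk. simpl in Hk.
assert (Hkp : 0 < Rabs k) by now apply Rabs_pos_lt.
assert (Hkh : Cmod (RtoC k * h) < d).
{ rewrite Cmod_mult, Cmod_R.
  apply Rle_lt_trans with (Rabs k * (Cmod h + 1)); [nra|].
  apply Rmult_lt_compat_r with (r := Cmod h + 1) in Hk; [|lra].
  unfold Rdiv in Hk. now rewrite Rmult_assoc, Rinv_l, Rmult_1_r in Hk by lra. }
specialize (H' _ Hkh).
replace (z + RtoC t * h + RtoC k * h)%C with (z + RtoC (t + k) * h)%C in H'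
  by (rewrite RtoC_plus; ring).
set (A := f (z + RtoC (t + k) * h)%C) in *. set (B := f (z + RtoC t * h)%C) in *.
replace ((Re (c * A)%C - Re (c * B)%C) / k - Re (c * (l * h))%C)
  with (Re (c * (A - B - l * (RtoC k * h)))%C / k).
2:{ replace (c * (A - B - l * (RtoC k * h)))%C with (c * A - c * B - RtoC k * (c * (l * h)))%C by ring.
    rewrite !re_minus, re_scal_l. field. exact Hk0. }
unfold Rdiv. rewrite Rabs_mult, Rabs_inv.
apply Rmult_lt_reg_r with (Rabs k); [exact Hkp|].
rewrite Rmult_assoc, Rinv_l, Rmult_1_r by lra.
eapply Rle_lt_trans; [apply re_le_Cmod|]. rewrite Cmod_mult.
apply Rle_lt_trans with (Cmod c * (e / (2 * K) * (Rabs k * Cmod h))).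
{ apply Rmult_le_compat_l; [exact Hc|]. now rewrite Cmod_mult, Cmod_R in H'. }
replace (Cmod c * (e / (2 * K) * (Rabs k * Cmod h)))
  with ((e * Rabs k) * ((Cmod c * Cmod h) / (2 * K))) by (field; lra).
rewrite <- (Rmult_1_r (e * Rabs k)) at 2.
apply Rmult_lt_compat_l; [nra|].
apply Rmult_lt_reg_r with (2 * K); [lra|].
unfold Rdiv. rewrite Rmult_assoc, Rinv_l, Rmult_1_r by lra. unfold K. nra.
Qed.

(* The mean value inequality, obtained from the real mean value theorem for
   [t |-> Re (conj (f (z+h) - f z) * f (z + t h))]. *)
Lemma cderiv_mean_value (f f' : C -> C) (z h : C) (D : R) :
  (forall t, 0 <= t <= 1 ->
     cderiv f (z + RtoC t * h)%C (f' (z + RtoC t * h)%C) /\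
     Cmod (f' (z + RtoC t * h)%C) <= D) ->
  Cmod (f (z + h) - f z)%C <= D * Cmod h.
Proof.
intros H. set (d := (f (z + h) - f z)%C).
destruct (MVT_gen (fun t => Re (Cconj d * f (z + RtoC t * h)%C)%C) 0 1
  (fun t => Re (Cconj d * (f' (z + RtoC t * h)%C * h))%C)) as [c [Hc E]].
- intros t Ht. rewrite Rmin_left, Rmax_right in Ht by lra.
  apply cderiv_segment_is_derive. apply H. lra.
- intros t Ht. rewrite Rmin_left, Rmax_right in Ht by lra.
  apply derivable_continuous_pt.
  eexists. apply is_derive_Reals. apply cderiv_segment_is_derive. apply H. lra.
- rewrite Rmin_left, Rmax_right in Hc by lra.
  destruct (H c Hc) as [_ HD].
  rewrite Cmult_1_l, Cmult_0_l, Cplus_0_r, <- re_minus, Rminus_0_r, Rmult_1_r in E.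
  replace (Cconj d * f (z + h) - Cconj d * f z)%C with (d * Cconj d)%C in E
    by (unfold d; ring).
  rewrite <- Cmod2_conj, re_RtoC in E.
  assert (E2 : Cmod d ^ 2 <= Cmod d * (D * Cmod h)).
  { rewrite E. eapply Rle_trans; [apply Rle_abs|].
    eapply Rle_trans; [apply re_le_Cmod|].
    rewrite !Cmod_mult, Cmod_conj.
    apply Rmult_le_compat_l; [apply Cmod_ge_0|].
    apply Rmult_le_compat_r; [apply Cmod_ge_0|exact HD]. }
  assert (Hd := Cmod_ge_0 d).
  destruct (Req_dec (Cmod d) 0) as [E0|Hn].
  + rewrite E0. apply Rmult_le_pos; [|apply Cmod_ge_0].
    eapply Rle_trans; [apply Cmod_ge_0|exact HD].
  + apply Rmult_le_reg_l with (Cmod d); [lra|]. simpl in E2. lra.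
Qed.

(** * Exponential, logarithm and powers *)

Lemma Cexp_plus (a b : C) : Cexp (a + b)%C = (Cexp a * Cexp b)%C.
Proof.
unfold Cexp. rewrite re_plus, im_plus, exp_plus, cos_plus, sin_plus.
unfold Cmult; simpl. f_equal; ring.
Qed.

Lemma Cexp_0 : Cexp (RtoC 0) = RtoC 1.
Proof. unfold Cexp; simpl. rewrite exp_0, cos_0, sin_0. unfold RtoC. f_equal; ring. Qed.

Lemma Cmod_Cexp (z : C) : Cmod (Cexp z) = exp (Re z).
Proof.
unfold Cexp, Cmod; simpl.
replace (_ + _) with (exp (Re z) * exp (Re z)).
- apply sqrt_square. left; apply exp_pos.
- assert (H := sin2_cos2 (Im z)). unfold Rsqr in H.
  transitivity (exp (Re z) * exp (Re z) * (sin (Im z) * sin (Im z) + cos (Im z) * cos (Im z)));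
    [rewrite H|]; ring.
Qed.

Lemma Cexp_neq_0 (z : C) : Cexp z <> RtoC 0.
Proof. apply Cmod_gt_0. rewrite Cmod_Cexp. apply exp_pos. Qed.

Lemma Cexp_opp (z : C) : Cexp (- z)%C = (/ Cexp z)%C.
Proof.
assert (H : (Cexp (- z) * Cexp z)%C = RtoC 1).
{ rewrite <- Cexp_plus. replace (- z + z)%C with (RtoC 0) by ring. apply Cexp_0. }
rewrite <- (Cmult_1_l (/ Cexp z)), <- H. field. apply Cexp_neq_0.
Qed.

Lemma Cexp_R (x : R) : Cexp (RtoC x) = RtoC (exp x).
Proof. unfold Cexp; simpl. rewrite cos_0, sin_0. unfold RtoC. f_equal; ring. Qed.

Lemma Cmod_Cexp_le (z : C) : Cmod (Cexp z) <= exp (Cmod z).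
Proof.
rewrite Cmod_Cexp. assert (H := re_le_Cmod z). assert (H' := Rle_abs (Re z)).
destruct (Req_dec (Re z) (Cmod z)) as [->|Hn]; [lra|]. left. apply exp_increasing. lra.
Qed.

Lemma deriv_at_0 (f : R -> R) (l : R) : derivable_pt_lim f 0 l ->
  forall e, 0 < e -> exists d, 0 < d /\ forall x, Rabs x < d ->
    Rabs (f x - f 0 - l * x) <= e * Rabs x.
Proof.
intros H e He. destruct (H e He) as [d Hd]. exists d. split; [apply cond_pos|].
intros x Hx. destruct (Req_dec x 0) as [->|Hn].
- replace (f 0 - f 0 - l * 0) with 0 by ring. rewrite Rabs_R0. lra.
- specialize (Hd x Hn Hx). rewrite Rplus_0_l in Hd.
  replace (f x - f 0 - l * x) with (((f x - f 0) / x - l) * x) by (field; exact Hn).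
  rewrite Rabs_mult. apply Rmult_le_compat_r; [apply Rabs_pos|lra].
Qed.

Lemma cderiv_Cexp_0 : cderiv Cexp (RtoC 0) (RtoC 1).
Proof.
(* The two components contribute [3 e |h|] and [5 e |h|], which [e0 / 20] absorbs. The cap 1 gives
   [|exp x - 1| <= 2 |x|], and [|exp x| <= 3] as [|x| < e]. *)
intros e0 He0. set (e := Rmin (e0 / 20) 1).
assert (He : 0 < e) by (apply Rmin_pos; lra).
assert (He1 : e <= 1) by apply Rmin_r.
assert (He2 : e <= e0 / 20) by apply Rmin_l.
destruct (deriv_at_0 exp 1) with (e := e) as [d1 [Hd1 H1]]; [|exact He|].
{ rewrite <- exp_0. apply derivable_pt_lim_exp. }
destruct (deriv_at_0 cos 0) with (e := e) as [d2 [Hd2 H2]]; [|exact He|].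
{ replace 0 with (- sin 0) at 2 by (rewrite sin_0; ring). apply derivable_pt_lim_cos. }
destruct (deriv_at_0 sin 1) with (e := e) as [d3 [Hd3 H3]]; [|exact He|].
{ rewrite <- cos_0. apply derivable_pt_lim_sin. }
set (m := Rmin d1 (Rmin d2 d3)).
assert (Hm : 0 < m) by (repeat apply Rmin_pos; assumption).
assert (M1 : m <= d1) by apply Rmin_l.
assert (M2 : m <= d2) by (eapply Rle_trans; [apply Rmin_r|apply Rmin_l]).
assert (M3 : m <= d3) by (eapply Rle_trans; [apply Rmin_r|apply Rmin_r]).
exists (Rmin e m). split; [now apply Rmin_pos|].
intros h Hh. rewrite Cplus_0_l, Cexp_0.
assert (Hhe := Rlt_le_trans _ _ _ Hh (Rmin_l _ _)).
assert (Hhm := Rlt_le_trans _ _ _ Hh (Rmin_r _ _)).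
assert (Hx := re_le_Cmod h). assert (Hy := im_le_Cmod h).
set (x := Re h) in *. set (y := Im h) in *.
specialize (H1 x ltac:(lra)). specialize (H2 y ltac:(lra)). specialize (H3 y ltac:(lra)).
rewrite exp_0 in H1. rewrite cos_0 in H2. rewrite sin_0 in H3.
rewrite Rmult_1_l in H1. rewrite Rmult_0_l, Rminus_0_r in H2.
rewrite Rmult_1_l, Rminus_0_r in H3.
assert (Hc : Rabs (cos y) <= 1) by (apply Rabs_le, COS_bound).
set (n := Cmod h) in *.
assert (Hxp := Rabs_pos x). assert (Hyp := Rabs_pos y).
assert (Ex : Rabs (exp x - 1) <= 2 * Rabs x).
{ replace (exp x - 1) with ((exp x - 1 - x) + x) by ring.
  eapply Rle_trans; [apply Rabs_triang|]. nra. }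
assert (Ex2 : Rabs (exp x) <= 3).
{ replace (exp x) with ((exp x - 1) + 1) by ring.
  eapply Rle_trans; [apply Rabs_triang|]. rewrite Rabs_R1. lra. }
assert (A : Rabs (exp x * cos y - 1 - x) <= 3 * e * n).
{ replace (exp x * cos y - 1 - x) with ((exp x - 1 - x) * cos y + (1 + x) * (cos y - 1)) by ring.
  eapply Rle_trans; [apply Rabs_triang|]. rewrite !Rabs_mult.
  assert (X1 : Rabs (1 + x) <= 2).
  { eapply Rle_trans; [apply Rabs_triang|]. rewrite Rabs_R1. lra. }
  assert (X2 := Rabs_pos (exp x - 1 - x)). assert (X3 := Rabs_pos (cos y - 1)).
  assert (X4 := Rabs_pos (1 + x)).
  assert (Y1 : Rabs (exp x - 1 - x) * Rabs (cos y) <= e * n * 1).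
  { apply Rmult_le_compat; try assumption; [apply Rabs_pos|nra]. }
  assert (Y2 : Rabs (1 + x) * Rabs (cos y - 1) <= 2 * (e * n)).
  { apply Rmult_le_compat; try assumption. nra. }
  lra. }
assert (B : Rabs (exp x * sin y - y) <= 5 * e * n).
{ replace (exp x * sin y - y) with (exp x * (sin y - y) + (exp x - 1) * y) by ring.
  eapply Rle_trans; [apply Rabs_triang|]. rewrite !Rabs_mult.
  assert (Y1 : Rabs (exp x) * Rabs (sin y - y) <= 3 * (e * n)).
  { apply Rmult_le_compat; try assumption; try apply Rabs_pos. nra. }
  assert (Y2 : Rabs (exp x - 1) * Rabs y <= (2 * e) * n).
  { apply Rmult_le_compat; try assumption; try apply Rabs_pos. lra. }
  lra. }
eapply Rle_trans; [apply Cmod_le_re_im|].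
rewrite !re_minus, !im_minus, Cmult_1_l, re_RtoC, im_RtoC.
unfold Cexp; simpl (Re _); simpl (Im _).
change (Re h) with x; change (Im h) with y.
assert (Hn : 0 <= n) by apply Cmod_ge_0.
fold x y.
replace (exp x * sin y - 0 - y) with (exp x * sin y - y) by ring.
eapply Rle_trans; [apply Rplus_le_compat; [exact A|exact B]|]. nra.
Qed.

Lemma cderiv_Cexp (z : C) : cderiv Cexp z (Cexp z).
Proof.
apply (cderiv_ext (fun t => Cexp z * Cexp (t - z))%C).
- intros t. rewrite <- Cexp_plus. f_equal. ring.
- eapply cderiv_eq; [|apply cderiv_scal, (cderiv_comp Cexp (fun t => t - z)%C z (RtoC 1))].
  3: apply cderiv_minus; [apply cderiv_id|apply cderiv_const].
  + ring.
  + replace (z - z)%C with (RtoC 0) by ring. apply cderiv_Cexp_0.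
Qed.

Lemma Re_div_Cmod_bound (z : C) : -1 <= Re z / Cmod z <= 1.
Proof.
apply Rabs_le_between. destruct (Req_dec (Cmod z) 0) as [E|Hn].
- assert (H := re_le_Cmod z). rewrite E in H. assert (Re z = 0).
  { destruct (Req_dec (Re z) 0) as [|N]; [assumption|]. apply Rabs_pos_lt in N. lra. }
  rewrite H0. unfold Rdiv. rewrite Rmult_0_l, Rabs_R0. lra.
- assert (Hz := Cmod_ge_0 z). unfold Rdiv. rewrite Rabs_mult, Rabs_inv, (Rabs_pos_eq (Cmod z)) by exact Hz.
  apply Rmult_le_reg_r with (Cmod z); [lra|].
  rewrite Rmult_assoc, Rinv_l by exact Hn. rewrite Rmult_1_l, Rmult_1_r. apply re_le_Cmod.
Qed.

Lemma cos_Carg (z : C) : cos (Carg z) = Re z / Cmod z.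
Proof.
unfold Carg. destruct (Rle_dec 0 (Im z)); [|rewrite cos_neg];
  apply cos_acos, Re_div_Cmod_bound.
Qed.

Lemma sin_Carg (z : C) : z <> RtoC 0 -> sin (Carg z) = Im z / Cmod z.
Proof.
intros Hz. assert (H0 : 0 < Cmod z) by now apply Cmod_gt_0.
assert (E : sqrt (1 - Rsqr (Re z / Cmod z)) = Rabs (Im z) / Cmod z).
{ rewrite <- (sqrt_Rsqr (Rabs (Im z) / Cmod z)).
  - f_equal. rewrite !Rsqr_div', <- Rsqr_abs.
    assert (H := Cmod2_alt z). unfold Rsqr. simpl in H. rewrite !Rmult_1_r in H.
    apply Rmult_eq_reg_r with (Cmod z * Cmod z); [|nra]. field_simplify; [|lra|lra]. lra.
  - apply Rmult_le_pos; [apply Rabs_pos|]. left. now apply Rinv_0_lt_compat. }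
unfold Carg. destruct (Rle_dec 0 (Im z)) as [Hi|Hi]; [|rewrite sin_neg];
  rewrite sin_acos by apply Re_div_Cmod_bound; rewrite E.
- now rewrite Rabs_pos_eq.
- rewrite Rabs_left by lra. field. lra.
Qed.

Lemma Cexp_Clog (z : C) : z <> RtoC 0 -> Cexp (Clog z) = z.
Proof.
intros Hz. assert (H0 : 0 < Cmod z) by now apply Cmod_gt_0.
unfold Cexp, Clog; simpl (Re _); simpl (Im _).
rewrite exp_ln, cos_Carg, sin_Carg by assumption.
apply C_ext; simpl; field; lra.
Qed.

Lemma Re_pos_neq_0 (z : C) : 0 < Re z -> z <> RtoC 0.
Proof. intros H ->. simpl in H. lra. Qed.

(** The definition by cases on the sign of [Im z] does not display continuity across the positive
    real axis; this single formula on the half-plane does. *)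
Lemma Carg_asin (z : C) : 0 < Re z -> Carg z = asin (Im z / Cmod z).
Proof.
intros H. assert (Hz := Re_pos_neq_0 z H). rewrite <- sin_Carg by exact Hz.
assert (H0 : 0 < Cmod z) by now apply Cmod_gt_0.
symmetry. apply asin_sin. unfold Carg.
assert (P : 0 < Re z / Cmod z) by now apply Rdiv_lt_0_compat.
assert (B := atan_bound (sqrt (1 - Rsqr (Re z / Cmod z)) / (Re z / Cmod z))).
rewrite <- acos_atan in B by exact P.
destruct (Rle_dec 0 (Im z)); lra.
Qed.

Lemma continuous_Cmod (z : C) : continuous (T := C_UniformSpace) (U := R_UniformSpace) Cmod z.
Proof.
intros P [e He]. apply C_locally_iff. exists e. split; [apply cond_pos|].
intros h Hh. apply He. apply Rabs_lt_between.
change (minus (Cmod (z + h)) (Cmod z)) with (Cmod (z + h) - Cmod z).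
assert (A := Cmod_triangle z h). assert (B := Cmod_triangle_rev z (- h)).
rewrite Cmod_opp in B. replace (z - - h)%C with (z + h)%C in B by ring. lra.
Qed.

Lemma continuous_C_Re_Im (f : C -> C) (z : C) :
  continuous (T := C_UniformSpace) (U := R_UniformSpace) (fun t => Re (f t)) z ->
  continuous (T := C_UniformSpace) (U := R_UniformSpace) (fun t => Im (f t)) z ->
  forall e, 0 < e -> exists d, 0 < d /\ forall h, Cmod h < d -> Cmod (f (z + h) - f z)%C < e.
Proof.
intros Hr Hi e He.
assert (He2 : 0 < e / 2) by lra.
assert (A := Hr _ (locally_ball (Re (f z)) (mkposreal _ He2))).
assert (B := Hi _ (locally_ball (Im (f z)) (mkposreal _ He2))).
apply (proj1 (C_locally_iff z _)) in A. apply (proj1 (C_locally_iff z _)) in B.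
destruct A as [d1 [Hd1 A]], B as [d2 [Hd2 B]].
exists (Rmin d1 d2). split; [now apply Rmin_pos|]. intros h Hh.
specialize (A h (Rlt_le_trans _ _ _ Hh (Rmin_l _ _))).
specialize (B h (Rlt_le_trans _ _ _ Hh (Rmin_r _ _))).
change (Rabs (Re (f (z + h)%C) - Re (f z)) < e / 2) in A.
change (Rabs (Im (f (z + h)%C) - Im (f z)) < e / 2) in B.
eapply Rle_lt_trans; [apply Cmod_le_re_im|]. rewrite re_minus, im_minus. lra.
Qed.

Lemma Clog_continuous (z : C) : 0 < Re z ->
  forall e, 0 < e -> exists d, 0 < d /\ forall h, Cmod h < d -> Cmod (Clog (z + h) - Clog z)%C < e.
Proof.
intros H. assert (Hz := Re_pos_neq_0 z H).
assert (H0 : 0 < Cmod z) by now apply Cmod_gt_0.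
apply continuous_C_Re_Im; unfold Clog; simpl.
- apply (continuous_comp (U := C_UniformSpace) Cmod ln); [apply continuous_Cmod|].
  apply continuity_pt_filterlim, derivable_continuous_pt.
  exists (/ Cmod z). now apply derivable_pt_lim_ln.
- apply continuous_ext_loc with (g := fun t : C => asin (Im t * / Cmod t)).
  + apply (proj2 (C_locally_iff z _)). exists (Re z). split; [exact H|].
    intros h Hh. symmetry. apply Carg_asin. rewrite re_plus.
    assert (A := re_le_Cmod h). apply Rabs_le_between in A. lra.
  + apply (continuous_comp (U := C_UniformSpace) (fun t : C => Im t * / Cmod t) asin).
    * apply (continuous_mult (U := C_UniformSpace) (K := R_AbsRing)).
      -- apply (continuous_snd (U := R_UniformSpace) (V := R_UniformSpace)).
      -- apply (continuous_comp (U := C_UniformSpace) Cmod Rinv); [apply continuous_Cmod|].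
         apply continuous_Rinv. lra.
    (* As [Re z > 0], [|Im z| < |z|] is strict, so the argument is interior to the interval where
       [asin] is differentiable. *)
    * apply continuity_pt_filterlim, derivable_continuous_pt, derivable_pt_asin.
      apply Rabs_lt_between. rewrite Rabs_mult, Rabs_inv, (Rabs_pos_eq (Cmod z)) by lra.
      apply Rmult_lt_reg_r with (Cmod z); [lra|].
      rewrite Rmult_assoc, Rinv_l, Rmult_1_r, Rmult_1_l by lra.
      assert (E := Cmod2_alt z). rewrite <- (Rabs_pos_eq (Cmod z)) by lra.
      apply Rsqr_lt_abs_0. unfold Rsqr. simpl in E. nra.
Qed.

Lemma cderiv_Clog (z : C) : 0 < Re z -> cderiv Clog z (/ z)%C.
Proof.
intros H. assert (Hz := Re_pos_neq_0 z H).
apply (cderiv_inverse Cexp Clog z z).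
- exists (Re z). split; [exact H|]. intros h Hh. apply Cexp_Clog, Re_pos_neq_0.
  rewrite re_plus. assert (A := re_le_Cmod h). apply Rabs_le_between in A. lra.
- now apply Clog_continuous.
- eapply cderiv_eq; [|apply cderiv_Cexp]. now apply Cexp_Clog.
- exact Hz.
Qed.

Lemma Clog_R (x : R) : 0 < x -> Clog (RtoC x) = RtoC (ln x).
Proof.
intros H. unfold Clog. rewrite Cmod_R, Rabs_pos_eq by lra.
rewrite Carg_asin by exact H. simpl. unfold Rdiv. now rewrite Rmult_0_l, asin_0.
Qed.

(** A positive real factor leaves the principal argument unchanged, so no multiple of [2 i PI]
    appears. This is what allows [N] to be factored out of [N + w] and [N + 1]. *)
Lemma Clog_scal (x : R) (z : C) : 0 < x -> z <> RtoC 0 ->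
  Clog (RtoC x * z)%C = (RtoC (ln x) + Clog z)%C.
Proof.
intros H Hz. assert (H0 : 0 < Cmod z) by now apply Cmod_gt_0.
unfold Clog. rewrite Cmod_mult, Cmod_R, Rabs_pos_eq, ln_mult by lra.
apply C_ext; simpl; [reflexivity|]. rewrite Rplus_0_l. unfold Carg.
rewrite Cmod_mult, Cmod_R, (Rabs_pos_eq x), re_scal_l, im_scal_l by lra.
replace (x * Re z / (x * Cmod z)) with (Re z / Cmod z) by (field; lra).
destruct (Rle_dec 0 (x * Im z)), (Rle_dec 0 (Im z)); try reflexivity; exfalso; nra.
Qed.

Lemma Cmod_Clog_le (z : C) : Cmod (Clog z) <= Rabs (ln (Cmod z)) + PI.
Proof.
eapply Rle_trans; [apply Cmod_le_re_im|]. apply Rplus_le_compat_l. simpl. unfold Carg.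
assert (B := acos_bound (Re z / Cmod z)).
destruct (Rle_dec 0 (Im z)); rewrite ?Rabs_Ropp, Rabs_pos_eq; lra.
Qed.

Lemma Cpower_plus (z a b : C) : Cpower z (a + b)%C = (Cpower z a * Cpower z b)%C.
Proof. unfold Cpower. rewrite <- Cexp_plus. f_equal. ring. Qed.

Lemma Cpower_0 (z : C) : Cpower z (RtoC 0) = RtoC 1.
Proof. unfold Cpower. rewrite Cmult_0_l. apply Cexp_0. Qed.

Lemma Cpower_nat (z : C) (n : nat) : z <> RtoC 0 -> Cpower z (RtoC (INR n)) = (z ^ n)%C.
Proof.
intros Hz. induction n as [|n IH].
- apply Cpower_0.
- rewrite S_INR, RtoC_plus, Cpower_plus, IH. unfold Cpower.
  rewrite Cmult_1_l, Cexp_Clog by exact Hz. simpl. ring.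
Qed.

Lemma Cpower_scal (x : R) (z a : C) : 0 < x -> z <> RtoC 0 ->
  Cpower (RtoC x * z)%C a = (Cpower (RtoC x) a * Cpower z a)%C.
Proof.
intros Hx Hz. unfold Cpower. rewrite Clog_scal, Clog_R, <- Cexp_plus by assumption.
f_equal. ring.
Qed.

Lemma Cmod_Cpower_R (x : R) (a : C) : 0 < x -> Cmod (Cpower (RtoC x) a) = exp (Re a * ln x).
Proof.
intros H. unfold Cpower. rewrite Clog_R, Cmod_Cexp by exact H. f_equal. apply re_scal_r.
Qed.

Lemma cderiv_Cpower_exponent (z a : C) :
  cderiv (fun t => Cpower z (- t)%C) a (- Clog z * Cpower z (- a))%C.
Proof.
unfold Cpower. eapply cderiv_eq; [|apply (cderiv_comp Cexp (fun t => - t * Clog z)%C)].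
2: apply cderiv_Cexp.
2:{ apply (cderiv_mult (fun t => - t)%C (fun _ => Clog z)); [apply cderiv_opp, cderiv_id|apply cderiv_const]. }
simpl. ring.
Qed.

Lemma cderiv_Cpower_base (z a : C) : 0 < Re z ->
  cderiv (fun t => Cpower t a) z (a * Cpower z (a - RtoC 1))%C.
Proof.
intros H. assert (Hz := Re_pos_neq_0 z H).
unfold Cpower. eapply cderiv_eq; [|apply (cderiv_comp Cexp (fun t => a * Clog t)%C)].
2: apply cderiv_Cexp.
2: apply cderiv_scal, cderiv_Clog, H.
replace ((a - RtoC 1) * Clog z)%C with (a * Clog z + - Clog z)%C by ring.
rewrite Cexp_plus, Cexp_opp, Cexp_Clog by exact Hz. ring.
Qed.

(** * The Cauchy-Goursat theorem on rectangles *)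

Definition CInt (f : R -> C) (a b : R) : C :=
  (RInt (fun t => Re (f t)) a b, RInt (fun t => Im (f t)) a b).

Definition ccont (f : R -> C) (a b : R) : Prop :=
  forall t, a <= t <= b -> continuous (fun t => Re (f t)) t /\ continuous (fun t => Im (f t)) t.

Lemma ccont_ex_RInt (f : R -> C) (a b : R) : a <= b -> ccont f a b ->
  ex_RInt (fun t => Re (f t)) a b /\ ex_RInt (fun t => Im (f t)) a b.
Proof.
intros Hab H.
split; apply (ex_RInt_continuous (V := R_CompleteNormedModule));
  rewrite Rmin_left, Rmax_right by exact Hab; intros t Ht; now apply H.
Qed.

Lemma CInt_Chasles (f : R -> C) (a b c : R) : a <= b -> b <= c -> ccont f a c ->
  CInt f a c = (CInt f a b + CInt f b c)%C.
Proof.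
intros Hab Hbc H.
destruct (ccont_ex_RInt f a b) as [A1 A2]; [exact Hab|intros t Ht; apply H; lra|].
destruct (ccont_ex_RInt f b c) as [B1 B2]; [exact Hbc|intros t Ht; apply H; lra|].
apply C_ext; simpl; symmetry; now apply (RInt_Chasles (V := R_CompleteNormedModule)).
Qed.

Lemma CInt_minus (f g : R -> C) (a b : R) : a <= b -> ccont f a b -> ccont g a b ->
  CInt (fun t => f t - g t)%C a b = (CInt f a b - CInt g a b)%C.
Proof.
intros Hab Hf Hg. apply ccont_ex_RInt in Hf; [|exact Hab]. apply ccont_ex_RInt in Hg; [|exact Hab].
apply C_ext; simpl.
- now apply (RInt_minus (V := R_CompleteNormedModule) (fun t => Re (f t)) (fun t => Re (g t))).
- now apply (RInt_minus (V := R_CompleteNormedModule) (fun t => Im (f t)) (fun t => Im (g t))).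
Qed.

Lemma ccont_minus (f g : R -> C) (a b : R) : ccont f a b -> ccont g a b ->
  ccont (fun t => f t - g t)%C a b.
Proof.
intros Hf Hg t Ht. destruct (Hf t Ht), (Hg t Ht). split.
- now apply (continuous_minus (V := R_NormedModule) (fun t => Re (f t)) (fun t => Re (g t))).
- now apply (continuous_minus (V := R_NormedModule) (fun t => Im (f t)) (fun t => Im (g t))).
Qed.

Lemma RInt_near_const (f : R -> R) (a b c e : R) : a <= b -> ex_RInt f a b ->
  (forall t, a <= t <= b -> Rabs (f t - c) <= e) -> Rabs (RInt f a b - (b - a) * c) <= e * (b - a).
Proof.
intros Hab Hf H.
assert (I := is_RInt_minus (V := R_NormedModule) _ _ _ _ _ _
  (RInt_correct (V := R_CompleteNormedModule) f a b Hf)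
  (is_RInt_const (V := R_NormedModule) a b c)).
rewrite (Rmult_comm e).
refine (norm_RInt_le (V := R_NormedModule) _ (fun _ => e) a b _ _ Hab _ I
  (is_RInt_const (V := R_NormedModule) a b e)).
exact H.
Qed.

(** Real and imaginary parts are estimated separately, whence the factor 2. *)
Lemma CInt_near_const (f : R -> C) (a b : R) (c : C) (e : R) : a <= b -> ccont f a b ->
  (forall t, a <= t <= b -> Cmod (f t - c) <= e) ->
  Cmod (CInt f a b - RtoC (b - a) * c) <= 2 * e * (b - a).
Proof.
intros Hab Hf H. apply ccont_ex_RInt in Hf; [|exact Hab]. destruct Hf as [Hr Hi].
eapply Rle_trans; [apply Cmod_le_re_im|].
rewrite re_minus, im_minus, re_scal_l, im_scal_l. simpl.
replace (2 * e * (b - a)) with (e * (b - a) + e * (b - a)) by ring.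
apply Rplus_le_compat; (apply RInt_near_const; [exact Hab|assumption|]); intros t Ht.
- rewrite <- re_minus. eapply Rle_trans; [apply re_le_Cmod|now apply H].
- rewrite <- im_minus. eapply Rle_trans; [apply im_le_Cmod|now apply H].
Qed.

Lemma cderiv_ccont (f : C -> C) (p : R -> C) (a b : R) :
  (forall t s, Cmod (p s - p t) = Rabs (s - t)) ->
  (forall t, a <= t <= b -> exists l, cderiv f (p t) l) -> ccont (fun t => f (p t)) a b.
Proof.
intros Hp H t Ht. destruct (H t Ht) as [l Hl].
assert (K : forall e, 0 < e -> exists d, 0 < d /\ forall s, Rabs (s - t) < d ->
   Cmod (f (p s) - f (p t)) < e).
{ intros e He. destruct (cderiv_cont f (p t) l Hl e He) as [d [Hd H']].
  exists d. split; [exact Hd|]. intros s Hs. specialize (H' (p s - p t)%C).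
  replace (p t + (p s - p t))%C with (p s) in H' by ring. apply H'. now rewrite Hp. }
split; intros P [e He]; destruct (K e (cond_pos e)) as [d [Hd Hs]];
  exists (mkposreal d Hd); intros s Hst; apply He; specialize (Hs s Hst).
- change (Rabs (Re (f (p s)) - Re (f (p t))) < e). rewrite <- re_minus.
  eapply Rle_lt_trans; [apply re_le_Cmod|exact Hs].
- change (Rabs (Im (f (p s)) - Im (f (p t))) < e). rewrite <- im_minus.
  eapply Rle_lt_trans; [apply im_le_Cmod|exact Hs].
Qed.

Lemma Cmod_horizontal (y s t : R) : Cmod ((s, y) - (t, y))%C = Rabs (s - t).
Proof.
replace ((s, y) - (t, y))%C with (RtoC (s - t)); [apply Cmod_R|].
apply C_ext; simpl; ring.
Qed.

Lemma Cmod_vertical (x s t : R) : Cmod ((x, s) - (x, t))%C = Rabs (s - t).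
Proof.
replace ((x, s) - (x, t))%C with (RtoC (s - t) * Ci)%C.
- rewrite Cmod_mult, Cmod_R, Cmod_Ci. ring.
- apply C_ext; simpl; ring.
Qed.

(** The integral of [g dz] counterclockwise around the rectangle, with [dz = i dy] on the vertical
    sides. *)
Definition rect_int (g : C -> C) (x1 x2 y1 y2 : R) : C :=
  (CInt (fun x => g (x, y1)) x1 x2 - CInt (fun x => g (x, y2)) x1 x2
   + Ci * (CInt (fun y => g (x2, y)) y1 y2 - CInt (fun y => g (x1, y)) y1 y2))%C.

Definition holo_rect (g : C -> C) (x1 x2 y1 y2 : R) : Prop :=
  forall x y, x1 <= x <= x2 -> y1 <= y <= y2 -> exists l, cderiv g (x, y) l.

Lemma holo_rect_horizontal (g : C -> C) (x1 x2 y1 y2 a b y : R) :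
  holo_rect g x1 x2 y1 y2 -> x1 <= a -> b <= x2 -> y1 <= y <= y2 ->
  ccont (fun x => g (x, y)) a b.
Proof.
intros H Ha Hb Hy. apply (cderiv_ccont g (fun x => (x, y))).
- intros; apply Cmod_horizontal.
- intros t Ht. apply H; lra.
Qed.

Lemma holo_rect_vertical (g : C -> C) (x1 x2 y1 y2 a b x : R) :
  holo_rect g x1 x2 y1 y2 -> y1 <= a -> b <= y2 -> x1 <= x <= x2 ->
  ccont (fun y => g (x, y)) a b.
Proof.
intros H Ha Hb Hx. apply (cderiv_ccont g (fun y => (x, y))).
- intros; apply Cmod_vertical.
- intros t Ht. apply H; lra.
Qed.

Lemma rect_int_split (g : C -> C) (x1 xm x2 y1 ym y2 : R) :
  x1 <= xm <= x2 -> y1 <= ym <= y2 -> holo_rect g x1 x2 y1 y2 ->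
  rect_int g x1 x2 y1 y2 =
  (rect_int g x1 xm y1 ym + rect_int g xm x2 y1 ym
   + rect_int g x1 xm ym y2 + rect_int g xm x2 ym y2)%C.
Proof.
intros Hx Hy H. unfold rect_int.
rewrite (CInt_Chasles (fun x => g (x, y1)) x1 xm x2), (CInt_Chasles (fun x => g (x, y2)) x1 xm x2),
  (CInt_Chasles (fun y => g (x1, y)) y1 ym y2), (CInt_Chasles (fun y => g (x2, y)) y1 ym y2);
  try lra.
- ring.
- eapply holo_rect_vertical; try eassumption; lra.
- eapply holo_rect_vertical; try eassumption; lra.
- eapply holo_rect_horizontal; try eassumption; lra.
- eapply holo_rect_horizontal; try eassumption; lra.
Qed.

(** Opposite sides are paired before estimating. The affine part [g p + l (z - p)] then contributes
    [- i l hx hy] from the horizontal sides and [i l hx hy] from the vertical ones, and only the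
    remainder is left: an error [2 e] in each difference, doubled by [CInt_near_const]. *)
Lemma rect_int_small (g : C -> C) (x y hx hy : R) (p l : C) (e : R) :
  0 <= hx -> 0 <= hy -> holo_rect g x (x + hx) y (y + hy) ->
  (forall z, x <= Re z <= x + hx -> y <= Im z <= y + hy ->
     Cmod (g z - g p - l * (z - p)) <= e) ->
  Cmod (rect_int g x (x + hx) y (y + hy)) <= 4 * e * (hx + hy).
Proof.
intros Hx Hy H E. unfold rect_int.
rewrite <- (CInt_minus (fun t => g (t, y))), <- (CInt_minus (fun t => g (x + hx, t)));
  try lra; try (eapply holo_rect_vertical; try eassumption; lra);
  try (eapply holo_rect_horizontal; try eassumption; lra).
assert (A : Cmod (CInt (fun t => g (t, y) - g (t, (y + hy)%R))%C x (x + hx)%R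
   - RtoC (x + hx - x)%R * (- (l * RtoC hy * Ci))) <= 2 * (2 * e) * (x + hx - x)).
{ apply CInt_near_const; [lra| |].
  - apply ccont_minus; eapply holo_rect_horizontal; try eassumption; lra.
  - intros t Ht.
    assert (E1 := E (t, y) Ht ltac:(simpl; lra)).
    assert (E2 := E (t, y + hy) Ht ltac:(simpl; lra)).
    replace (g (t, y) - g (t, (y + hy)%R) - - (l * RtoC hy * Ci))%C with
      ((g (t, y) - g p - l * ((t, y) - p)) - (g (t, (y + hy)%R) - g p - l * ((t, (y + hy)%R) - p)))%C.
    + eapply Rle_trans; [apply Cmod_sub_triangle|]. lra.
    + replace (RtoC hy * Ci)%C with ((t, (y + hy)%R) - (t, y))%C by (apply C_ext; simpl; ring).
      rewrite <- Cmult_assoc.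
      replace (RtoC hy * Ci)%C with ((t, (y + hy)%R) - (t, y))%C by (apply C_ext; simpl; ring). ring. }
assert (B : Cmod (CInt (fun t => g ((x + hx)%R, t) - g (x, t))%C y (y + hy)%R
   - RtoC (y + hy - y)%R * (l * RtoC hx)) <= 2 * (2 * e) * (y + hy - y)).
{ apply CInt_near_const; [lra| |].
  - apply ccont_minus; eapply holo_rect_vertical; try eassumption; lra.
  - intros t Ht.
    assert (E1 := E (x, t) ltac:(simpl; lra) Ht).
    assert (E2 := E (x + hx, t) ltac:(simpl; lra) Ht).
    replace (g ((x + hx)%R, t) - g (x, t) - l * RtoC hx)%C with
      ((g ((x + hx)%R, t) - g p - l * (((x + hx)%R, t) - p)) - (g (x, t) - g p - l * ((x, t) - p)))%C.
    + eapply Rle_trans; [apply Cmod_sub_triangle|]. lra.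
    + replace (RtoC hx) with (((x + hx)%R, t) - (x, t))%C by (apply C_ext; simpl; ring). ring. }
replace (x + hx - x) with hx in A by ring. replace (y + hy - y) with hy in B by ring.
set (I1 := CInt _ _ _) in A |- *. set (I2 := CInt _ _ _) in B |- *.
replace (I1 + Ci * I2)%C with
  ((I1 - RtoC hx * - (l * RtoC hy * Ci)) + Ci * (I2 - RtoC hy * (l * RtoC hx)))%C by ring.
eapply Rle_trans; [apply Cmod_triangle|]. rewrite Cmod_mult, Cmod_Ci. lra.
Qed.

Lemma nested_intervals (u : nat -> R) (L : R) :
  (forall n, u n <= u (S n)) -> (forall n, u (S n) + L / 2 ^ (S n) <= u n + L / 2 ^ n) -> 0 <= L ->
  exists x, forall n, u n <= x <= u n + L / 2 ^ n.
Proof.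
intros Hi Hd HL.
assert (P : forall n, 0 <= L / 2 ^ n).
{ intros n. apply Rmult_le_pos; [exact HL|]. left. apply Rinv_0_lt_compat, pow_lt. lra. }
assert (M : forall n m, (n <= m)%nat -> u n <= u m /\ u m + L / 2 ^ m <= u n + L / 2 ^ n).
{ intros n m Hnm. induction Hnm as [|m Hm [IH1 IH2]]; [lra|].
  specialize (Hi m). specialize (Hd m). lra. }
destruct (completeness (fun x => exists n, x = u n)) as [x [Hub Hlub]].
- exists (u O + L / 2 ^ 0). intros y [n ->]. destruct (M O n (Nat.le_0_l n)). specialize (P n). lra.
- exists (u O). now exists O.
- exists x. intros n. split.
  + apply Hub. now exists n.
  + apply Hlub. intros y [m ->]. destruct (Nat.le_ge_cases n m) as [Hm|Hm].
    * destruct (M n m Hm). specialize (P m). lra.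
    * destruct (M m n Hm). specialize (P n). lra.
Qed.

(* Bisection: a rectangle is encoded by its lower left corner and its generation [n],
   its sides being [Lx / 2 ^ n] and [Ly / 2 ^ n]. *)
Theorem Goursat_rect (g : C -> C) (x0 y0 Lx Ly : R) : 0 <= Lx -> 0 <= Ly ->
  holo_rect g x0 (x0 + Lx) y0 (y0 + Ly) ->
  rect_int g x0 (x0 + Lx) y0 (y0 + Ly) = RtoC 0.
Proof.
intros HLx HLy H.
set (sx := fun n => Lx / 2 ^ n). set (sy := fun n => Ly / 2 ^ n).
assert (Sx : forall n, 0 <= sx n /\ sx n = 2 * sx (S n)).
{ intros n. unfold sx. split.
  - apply Rmult_le_pos; [exact HLx|]. left. apply Rinv_0_lt_compat, pow_lt. lra.
  - simpl. field. apply pow_nonzero. lra. }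
assert (Sy : forall n, 0 <= sy n /\ sy n = 2 * sy (S n)).
{ intros n. unfold sy. split.
  - apply Rmult_le_pos; [exact HLy|]. left. apply Rinv_0_lt_compat, pow_lt. lra.
  - simpl. field. apply pow_nonzero. lra. }
set (J := Cmod (rect_int g x0 (x0 + Lx) y0 (y0 + Ly))).
set (inside := fun n (c : R * R) => x0 <= fst c /\ fst c + sx n <= x0 + Lx /\
                  y0 <= snd c /\ snd c + sy n <= y0 + Ly).
set (Q := fun n (c : R * R) => Cmod (rect_int g (fst c) (fst c + sx n) (snd c) (snd c + sy n))).
(* A rectangle of generation [n] is [bad] if it carries at least the share [J / 4 ^ n] of the whole
   integral; one of its four quarters must then be bad again. *)
set (bad := fun n c => inside n c /\ J <= 4 ^ n * Q n c).
set (child := fun n (c c' : R * R) =>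
   fst c <= fst c' /\ fst c' + sx (S n) <= fst c + sx n /\
   snd c <= snd c' /\ snd c' + sy (S n) <= snd c + sy n).
assert (Hsub : forall n c, inside n c ->
  holo_rect g (fst c) (fst c + sx n) (snd c) (snd c + sy n)).
{ intros n c Hc x y Hx Hy. unfold inside in Hc. apply H; lra. }
(* The premise [bad n c] stands under the existential so that choice yields a total function [next];
   for a rectangle that is not bad, the corner itself is a default value. *)
assert (step : forall n c, exists c', bad n c -> bad (S n) c' /\ child n c c').
{ intros n [x y].
  destruct (classic (bad n (x, y))) as [[Hc HJ]|Hb]; [|exists (x, y); tauto].
  assert (Hin := Hc). unfold inside in Hin. simpl in Hin.
  destruct (Sx n) as [_ Ex], (Sy n) as [_ Ey], (Sx (S n)) as [Px _], (Sy (S n)) as [Py _].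
  assert (E := rect_int_split g x (x + sx (S n)) (x + sx n) y (y + sy (S n)) (y + sy n)
    ltac:(lra) ltac:(lra) (Hsub n (x, y) Hc)).
  assert (T : Q n (x, y) <= Q (S n) (x, y) + Q (S n) (x + sx (S n), y)
      + Q (S n) (x, y + sy (S n)) + Q (S n) (x + sx (S n), y + sy (S n))).
  { unfold Q. simpl fst. simpl snd. rewrite E.
    replace (x + sx (S n) + sx (S n)) with (x + sx n) by lra.
    replace (y + sy (S n) + sy (S n)) with (y + sy n) by lra.
    eapply Rle_trans; [apply Cmod_triangle|]. apply Rplus_le_compat_r.
    eapply Rle_trans; [apply Cmod_triangle|]. apply Rplus_le_compat_r.
    apply Cmod_triangle. }
  assert (Hp : 0 < 4 ^ n) by (apply pow_lt; lra).
  assert (C4 : forall c', J <= 4 ^ (S n) * Q (S n) c' \/ 4 * (4 ^ n * Q (S n) c') < J).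
  { intros c'. simpl. destruct (Rle_lt_dec J (4 * 4 ^ n * Q (S n) c')); [now left|right; lra]. }
  destruct (C4 (x, y)) as [G1|G1].
  { exists (x, y). intros _. split; [split; [unfold inside; simpl; lra|exact G1]|unfold child; simpl; lra]. }
  destruct (C4 (x + sx (S n), y)) as [G2|G2].
  { exists (x + sx (S n), y). intros _. split; [split; [unfold inside; simpl; lra|exact G2]|unfold child; simpl; lra]. }
  destruct (C4 (x, y + sy (S n))) as [G3|G3].
  { exists (x, y + sy (S n)). intros _. split; [split; [unfold inside; simpl; lra|exact G3]|unfold child; simpl; lra]. }
  destruct (C4 (x + sx (S n), y + sy (S n))) as [G4|G4].
  { exists (x + sx (S n), y + sy (S n)). intros _. split; [split; [unfold inside; simpl; lra|exact G4]|unfold child; simpl; lra]. }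
  exfalso. apply Rmult_le_compat_l with (r := 4 ^ n) in T; [|lra]. lra. }
set (next := fun n c => proj1_sig (constructive_indefinite_description _ (step n c))).
assert (Hnext : forall n c, bad n c -> bad (S n) (next n c) /\ child n c (next n c)).
{ intros n c. unfold next. destruct constructive_indefinite_description as [c' Hc']. exact Hc'. }
set (cs := fix cs n := match n with O => (x0, y0) | S m => next m (cs m) end).
assert (Hbad : forall n, bad n (cs n)).
{ induction n as [|n IH].
  - unfold bad, inside, Q, sx, sy. simpl. unfold Rdiv. rewrite Rinv_1, !Rmult_1_r, Rmult_1_l.
    split; [lra|]. unfold J. lra.
  - apply Hnext, IH. }
assert (Hch : forall n, child n (cs n) (cs (S n))) by (intros n; apply Hnext, Hbad).
destruct (nested_intervals (fun n => fst (cs n)) Lx) as [X HX];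
  [intros n; apply (Hch n)|intros n; apply (Hch n)|exact HLx|].
destruct (nested_intervals (fun n => snd (cs n)) Ly) as [Y HY];
  [intros n; apply (Hch n)|intros n; apply (Hch n)|exact HLy|].
assert (HX0 := HX O). assert (HY0 := HY O). simpl in HX0, HY0.
unfold Rdiv in HX0, HY0. rewrite Rinv_1, Rmult_1_r in HX0, HY0.
destruct (H X Y HX0 HY0) as [l Hl].
apply Cmod_small_eq_0. fold J. intros e He.
(* The [+ 1] keeps [S0] positive for a degenerate rectangle. At generation [n] the sides add up to
   at most [S0 / 2 ^ n], which enters once through the distance to the limit point and once through
   the perimeter; the tolerance [e / (4 S0^2)] then leaves exactly [e] after multiplication by
   [4 ^ n]. *)
set (S0 := Lx + Ly + 1).
destruct (Hl (e / (4 * (S0 * S0)))) as [d [Hd Hdl]].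
{ apply Rdiv_lt_0_compat; [exact He|]. unfold S0; nra. }
destruct (pow_lt_1_zero (1 / 2) ltac:(rewrite Rabs_pos_eq; lra) (d / S0)) as [n Hn].
{ apply Rdiv_lt_0_compat; unfold S0; lra. }
specialize (Hn n (Nat.le_refl n)).
assert (Ph : 0 < (1 / 2) ^ n) by (apply pow_lt; lra).
rewrite Rabs_pos_eq in Hn by lra.
assert (E2 : (1 / 2) ^ n = / 2 ^ n).
{ rewrite <- pow_inv. f_equal. lra. }
assert (Esz : sx n + sy n <= S0 * (1 / 2) ^ n).
{ unfold sx, sy, Rdiv. rewrite <- Rmult_plus_distr_r, <- E2. unfold S0. nra. }
assert (Hlt : S0 * (1 / 2) ^ n < d).
{ apply Rmult_lt_compat_l with (r := S0) in Hn; [|unfold S0; lra].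
  replace (S0 * (d / S0)) with d in Hn by (field; unfold S0; lra). exact Hn. }
destruct (Hbad n) as [Hin HJ]. destruct (Sx n) as [Px _], (Sy n) as [Py _].
assert (B : Q n (cs n) <= 4 * (e / (4 * (S0 * S0)) * (S0 * (1 / 2) ^ n)) * (sx n + sy n)).
{ apply (rect_int_small g _ _ _ _ (X, Y) l); [exact Px|exact Py|now apply Hsub|].
  intros z Hx Hy. specialize (HX n). specialize (HY n). fold (sx n) in HX. fold (sy n) in HY.
  assert (Hz : Cmod (z - (X, Y)) <= S0 * (1 / 2) ^ n).
  { eapply Rle_trans; [apply Cmod_le_re_im|]. rewrite re_minus, im_minus. simpl (Re (X, Y)). simpl (Im (X, Y)).
    eapply Rle_trans; [|exact Esz].
    apply Rplus_le_compat; apply Rabs_le; lra. }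
  specialize (Hdl (z - (X, Y))%C ltac:(lra)).
  replace ((X, Y) + (z - (X, Y)))%C with z in Hdl by ring.
  eapply Rle_trans; [exact Hdl|]. apply Rmult_le_compat_l; [|exact Hz].
  left. apply Rdiv_lt_0_compat; [exact He|]. unfold S0; nra. }
apply Rle_trans with (4 ^ n * (4 * (e / (4 * (S0 * S0)) * (S0 * (1 / 2) ^ n)) * (S0 * (1 / 2) ^ n))).
{ eapply Rle_trans; [exact HJ|]. apply Rmult_le_compat_l; [left; apply pow_lt; lra|].
  eapply Rle_trans; [exact B|]. apply Rmult_le_compat_l; [|exact Esz].
  assert (0 < e / (4 * (S0 * S0))) by (apply Rdiv_lt_0_compat; [exact He|]; unfold S0; nra).
  assert (0 < S0 * (1 / 2) ^ n) by (apply Rmult_lt_0_compat; [unfold S0; lra|exact Ph]). nra. }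
replace (4 ^ n) with (2 ^ n * 2 ^ n) by (rewrite <- Rpow_mult_distr; f_equal; ring).
rewrite E2. right. field. split; [apply pow_nonzero; lra|unfold S0; lra].
Qed.

(** * Cauchy estimates *)

Lemma Cminus_0_r (z : C) : (z - RtoC 0)%C = z.
Proof. ring. Qed.

Definition holo_disc (f : C -> C) (a : C) (r : R) : Prop :=
  forall z, Cmod (z - a) < r -> exists l, cderiv f z l.

(* [zeta |-> (f (a + exp zeta) - f a) exp (- zeta)] is holomorphic and [2 i PI]-periodic on a
   left half-plane and tends to [f' a] as [Re zeta -> -oo]; by Goursat its mean over a vertical
   period does not depend on [Re zeta]. *)
Lemma Cauchy_estimate_center (f : C -> C) (a l : C) (r M : R) : 0 < r ->
  holo_disc f a r -> cderiv f a l ->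
  (forall z, Cmod (z - a) < r -> Cmod (f z - f a) <= M) -> Cmod l <= 4 * M / r.
Proof.
intros Hr H Hl HM.
set (g := fun zeta => ((f (a + Cexp zeta) - f a) * Cexp (- zeta))%C).
(* The line [Re zeta = x2] corresponds to the circle of radius [r / 2] about [a]. There
   [|g| <= 2 M / r], and the factor 2 of [CInt_near_const] gives [4 M / r]. *)
set (x2 := ln (r / 2)).
assert (Ex2 : exp x2 = r / 2) by (unfold x2; rewrite exp_ln; lra).
assert (HPI := PI_RGT_0).
assert (Hg : forall x y, x <= x2 -> exists m, cderiv g (x, y) m).
{ intros x y Hx. destruct (H (a + Cexp (x, y))%C) as [m Hm].
  - replace (a + Cexp (x, y) - a)%C with (Cexp (x, y)) by ring. rewrite Cmod_Cexp. simpl.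
    apply Rle_lt_trans with (exp x2); [|lra].
    destruct Hx as [Hx| ->]; [left; now apply exp_increasing|lra].
  - eexists. unfold g. apply cderiv_mult.
    + apply cderiv_minus; [|apply cderiv_const].
      apply (cderiv_comp f (fun t => a + Cexp t)%C); [exact Hm|].
      apply cderiv_plus; [apply cderiv_const|apply cderiv_Cexp].
    + apply (cderiv_comp Cexp (fun t => - t)%C); [apply cderiv_Cexp|].
      apply cderiv_opp, cderiv_id. }
assert (Hcont : forall x, x <= x2 -> ccont (fun y => g (x, y)) 0 (2 * PI)).
{ intros x Hx. apply (cderiv_ccont g (fun y => (x, y))).
  - intros; apply Cmod_vertical.
  - intros t _. now apply Hg. }
assert (Hmean : forall x1, x1 <= x2 -> CInt (fun y => g (x1, y)) 0 (2 * PI) = CInt (fun y => g (x2, y)) 0 (2 * PI)).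
{ intros x1 Hx1.
  assert (G := Goursat_rect g x1 0 (x2 - x1) (2 * PI) ltac:(lra) ltac:(lra)).
  replace (x1 + (x2 - x1)) with x2 in G by ring. rewrite Rplus_0_l in G.
  specialize (G ltac:(intros x y Hx Hy; apply Hg; lra)).
  unfold rect_int in G.
  assert (P : forall x, g (x, 2 * PI) = g (x, 0)).
  { intros x. unfold g. rewrite !Cexp_opp. unfold Cexp. simpl (Re _). simpl (Im _).
    now rewrite cos_2PI, sin_2PI, cos_0, sin_0. }
  assert (E : CInt (fun x => g (x, 2 * PI)) x1 x2 = CInt (fun x => g (x, 0)) x1 x2).
  { unfold CInt. f_equal; apply RInt_ext; intros; now rewrite P. }
  rewrite E in G. set (I1 := CInt (fun y => g (x1, y)) 0 (2 * PI)) in *.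
  set (I2 := CInt (fun y => g (x2, y)) 0 (2 * PI)) in *.
  set (I0 := CInt (fun x => g (x, 0)) x1 x2) in *.
  replace I1 with (I2 + Ci * (I0 - I0 + Ci * (I2 - I1)))%C.
  - rewrite G. ring.
  - replace (Ci * (I0 - I0 + Ci * (I2 - I1)))%C with ((Ci * Ci) * (I2 - I1))%C by ring.
    replace (Ci * Ci)%C with (- RtoC 1)%C by (apply C_ext; simpl; ring). ring. }
assert (B2 : Cmod (CInt (fun y => g (x2, y)) 0 (2 * PI)) <= 2 * PI * (4 * M / r)).
{ assert (N := CInt_near_const (fun y => g (x2, y)) 0 (2 * PI) (RtoC 0) (M * (2 / r))
    ltac:(lra) (Hcont x2 ltac:(lra))).
  rewrite Cmult_0_r, Cminus_0_r in N.
  replace (2 * PI * (4 * M / r)) with (2 * (M * (2 / r)) * (2 * PI - 0)) by (field; lra).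
  apply N. intros y _. rewrite Cminus_0_r.
  unfold g. rewrite Cmod_mult, (Cmod_Cexp (- _)), re_opp. simpl (Re _).
  rewrite exp_Ropp, Ex2.
  replace (/ (r / 2)) with (2 / r) by (field; lra).
  apply Rmult_le_compat_r; [left; apply Rdiv_lt_0_compat; lra|].
  apply HM. replace (a + Cexp (x2, y) - a)%C with (Cexp (x2, y)) by ring.
  rewrite Cmod_Cexp. simpl. lra. }
apply le_epsilon. intros e He.
destruct (Hl (e / 2) ltac:(lra)) as [d [Hd Hdl]].
(* Far enough to the left [exp x1 < d], so [g] is within [e / 2] of [l] on the whole period. *)
set (x1 := Rmin (ln d - 1) x2).
assert (Hx1 : x1 <= x2) by apply Rmin_r.
assert (Hxd : exp x1 < d).
{ rewrite <- (exp_ln d) by exact Hd. apply exp_increasing.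
  assert (x1 <= ln d - 1) by apply Rmin_l. lra. }
assert (N := CInt_near_const (fun y => g (x1, y)) 0 (2 * PI) l (e / 2) ltac:(lra) (Hcont x1 Hx1)).
rewrite (Hmean x1 Hx1) in N.
assert (N' : Cmod (CInt (fun y => g (x2, y)) 0 (2 * PI) - RtoC (2 * PI - 0) * l) <= 2 * (e / 2) * (2 * PI - 0)).
{ apply N. intros y _.
  assert (Hc : Cmod (Cexp (x1, y)) < d) by (rewrite Cmod_Cexp; exact Hxd).
  specialize (Hdl _ Hc). unfold g. rewrite Cexp_opp.
  replace ((f (a + Cexp (x1, y)) - f a) * / Cexp (x1, y) - l)%C with
    ((f (a + Cexp (x1, y)) - f a - l * Cexp (x1, y)) * / Cexp (x1, y))%C
    by (field; apply Cexp_neq_0).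
  rewrite Cmod_mult, Cmod_inv by apply Cexp_neq_0.
  assert (Hp : 0 < Cmod (Cexp (x1, y))) by (apply Cmod_gt_0, Cexp_neq_0).
  apply Rmult_le_reg_r with (Cmod (Cexp (x1, y))); [exact Hp|].
  rewrite Rmult_assoc, Rinv_l, Rmult_1_r by lra. exact Hdl. }
set (I2 := CInt (fun y => g (x2, y)) 0 (2 * PI)) in *.
assert (T := Cmod_triangle_rev (RtoC (2 * PI - 0) * l) I2).
rewrite Cmod_sub_sym, Cmod_mult, Cmod_R, Rabs_pos_eq in T by lra.
apply Rmult_le_reg_l with (2 * PI); [lra|]. lra.
Qed.

Lemma Cauchy_estimate (f : C -> C) (a l : C) (r M : R) : 0 < r ->
  holo_disc f a r -> cderiv f a l ->
  (forall z, Cmod (z - a) < r -> Cmod (f z) <= M) -> Cmod l <= 8 * M / r.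
Proof.
intros Hr H Hl HM. replace (8 * M / r) with (4 * (2 * M) / r) by (field; lra).
apply (Cauchy_estimate_center f a); try assumption.
intros z Hz. eapply Rle_trans; [apply Cmod_sub_triangle|].
assert (Ha : Cmod (a - a) < r) by (replace (a - a)%C with (RtoC 0) by ring; now rewrite Cmod_0).
assert (H1 := HM z Hz). assert (H2 := HM a Ha). lra.
Qed.

(** [cderiv] is a relation, while the mean value inequality takes the derivative as a function. *)
Definition deriv_at (f : C -> C) (z : C) : C := epsilon (inhabits (RtoC 0)) (cderiv f z).

Lemma deriv_at_spec (f : C -> C) (z : C) : (exists l, cderiv f z l) -> cderiv f z (deriv_at f z).
Proof. intros H. unfold deriv_at. now apply epsilon_spec. Qed.

Lemma holo_disc_sub (f : C -> C) (a b : C) (r s : R) :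
  Cmod (b - a) + s <= r -> holo_disc f a r -> holo_disc f b s.
Proof.
intros Hs H z Hz. apply H. replace (z - a)%C with ((z - b) + (b - a))%C by ring.
eapply Rle_lt_trans; [apply Cmod_triangle|]. lra.
Qed.

(** The segment stays within [3 r / 4] of [a], so the Cauchy estimate applies on discs of radius
    [r / 4] about its points: [8 M / (r / 4) = 32 M / r]. *)
Lemma disc_Lipschitz (f : C -> C) (a z h : C) (r M : R) : 0 < r ->
  holo_disc f a r -> (forall z, Cmod (z - a) < r -> Cmod (f z) <= M) ->
  Cmod (z - a) < r / 2 -> Cmod h <= r / 4 -> Cmod (f (z + h)%C - f z) <= 32 * M / r * Cmod h.
Proof.
intros Hr H HM Hz Hh.
apply (cderiv_mean_value f (deriv_at f)). intros t Ht.
assert (Hd : Cmod (z + RtoC t * h - a) < r / 2 + r / 4).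
{ replace (z + RtoC t * h - a)%C with ((z - a) + RtoC t * h)%C by ring.
  eapply Rle_lt_trans; [apply Cmod_triangle|]. rewrite Cmod_mult, Cmod_R, Rabs_pos_eq by lra.
  assert (Hp := Cmod_ge_0 h). nra. }
assert (Hs : cderiv f (z + RtoC t * h)%C (deriv_at f (z + RtoC t * h)%C)).
{ apply deriv_at_spec, H. lra. }
split; [exact Hs|].
replace (32 * M / r) with (8 * M / (r / 4)) by (field; lra).
apply (Cauchy_estimate f (z + RtoC t * h)%C); [lra| |exact Hs|].
- apply (holo_disc_sub f a _ r); [lra|exact H].
- intros y Hy. apply HM.
  replace (y - a)%C with ((y - (z + RtoC t * h)) + (z + RtoC t * h - a))%C by ring.
  eapply Rle_lt_trans; [apply Cmod_triangle|]. lra.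
Qed.

(** No second derivative is taken: the Cauchy estimate for [z |-> f (z + k) - f z], which is small
    by [disc_Lipschitz], bounds the increment of the derivative by a multiple of [|k|]. The constant
    depends on [f] only through [M], which lets the inequality pass to limits. *)
Lemma disc_quadratic (f : C -> C) (a l h : C) (r M : R) : 0 < r ->
  holo_disc f a r -> cderiv f a l -> (forall z, Cmod (z - a) < r -> Cmod (f z) <= M) ->
  Cmod h < r / 4 -> Cmod (f (a + h)%C - f a - l * h) <= 512 * M / (r * r) * (Cmod h * Cmod h).
Proof.
intros Hr H Hl HM Hh. assert (Hhp := Cmod_ge_0 h).
assert (Ha : Cmod (a - a) < r) by (replace (a - a)%C with (RtoC 0) by ring; now rewrite Cmod_0).
assert (HMp : 0 <= M) by (eapply Rle_trans; [apply Cmod_ge_0|apply (HM a Ha)]).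
assert (K : Cmod ((fun z => f z - l * z)%C (a + h)%C - (fun z => f z - l * z)%C a) <=
   512 * M / (r * r) * Cmod h * Cmod h).
{ apply (cderiv_mean_value (fun z => f z - l * z)%C (fun z => deriv_at f z - l)%C).
  intros t Ht.
  assert (Ht2 : Cmod (RtoC t * h) <= Cmod h).
  { rewrite Cmod_mult, Cmod_R, Rabs_pos_eq by lra. nra. }
  assert (Hs : cderiv f (a + RtoC t * h)%C (deriv_at f (a + RtoC t * h)%C)).
  { apply deriv_at_spec, H. replace (a + RtoC t * h - a)%C with (RtoC t * h)%C by ring. lra. }
  split.
  - apply cderiv_minus; [exact Hs|].
    eapply cderiv_eq; [|apply cderiv_scal, cderiv_id]. ring.
  - set (k := (RtoC t * h)%C) in *.
    assert (Hk := Cmod_ge_0 k).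
    apply Rle_trans with (512 * M / (r * r) * Cmod k).
    + replace (512 * M / (r * r) * Cmod k) with (8 * (32 * M / r * Cmod k) / (r / 2)) by (field; lra).
      apply (Cauchy_estimate (fun z => f (z + k) - f z)%C a); [lra| | |].
      * intros z Hz.
        assert (D1 : exists m, cderiv f (z + k)%C m).
        { apply H. replace (z + k - a)%C with ((z - a) + k)%C by ring.
          eapply Rle_lt_trans; [apply Cmod_triangle|]. lra. }
        assert (D2 : exists m, cderiv f z m) by (apply H; lra).
        destruct D1 as [m1 D1], D2 as [m2 D2]. eexists. apply cderiv_minus; [|exact D2].
        apply (cderiv_comp f (fun z => z + k)%C); [exact D1|].
        apply cderiv_plus; [apply cderiv_id|apply cderiv_const].
      * apply cderiv_minus; [|exact Hl].
        eapply cderiv_eq; [|apply (cderiv_comp f (fun z => z + k)%C); [exact Hs|]].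
        2: apply cderiv_plus; [apply cderiv_id|apply cderiv_const].
        ring.
      * intros z Hz. apply (disc_Lipschitz f a); try assumption. lra.
    + apply Rmult_le_compat_l; [|exact Ht2].
      apply Rmult_le_pos; [lra|]. left. apply Rinv_0_lt_compat. nra. }
simpl in K. rewrite <- Rmult_assoc.
replace (f (a + h) - f a - l * h)%C with (f (a + h)%C - l * (a + h) - (f a - l * a))%C by ring.
exact K.
Qed.

(** * Limits of sequences of holomorphic functions *)

Definition clim (u : nat -> C) (l : C) : Prop :=
  forall e, 0 < e -> exists n0, forall n, (n0 <= n)%nat -> Cmod (u n - l) < e.

Lemma clim_unique (u : nat -> C) (l m : C) : clim u l -> clim u m -> l = m.
Proof.
intros Hl Hm. apply Ceq_minus, Cmod_small_eq_0. intros e He.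
destruct (Hl (e / 2) ltac:(lra)) as [n1 H1]. destruct (Hm (e / 2) ltac:(lra)) as [n2 H2].
specialize (H1 (n1 + n2)%nat ltac:(lia)). specialize (H2 (n1 + n2)%nat ltac:(lia)).
replace (l - m)%C with ((u (n1 + n2)%nat - m) - (u (n1 + n2)%nat - l))%C by ring.
eapply Rle_trans; [apply Cmod_sub_triangle|]. lra.
Qed.

Lemma clim_le (u : nat -> C) (l : C) (B : R) : clim u l ->
  (exists n0, forall n, (n0 <= n)%nat -> Cmod (u n) <= B) -> Cmod l <= B.
Proof.
intros H [n0 HB]. apply le_epsilon. intros e He. destruct (H e He) as [n1 H1].
specialize (H1 (n0 + n1)%nat ltac:(lia)). specialize (HB (n0 + n1)%nat ltac:(lia)).
assert (T := Cmod_triangle_rev l (u (n0 + n1)%nat)). rewrite Cmod_sub_sym in T. lra.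
Qed.

Lemma clim_ext (u v : nat -> C) (l : C) :
  (exists n0, forall n, (n0 <= n)%nat -> u n = v n) -> clim u l -> clim v l.
Proof.
intros [n0 E] H e He. destruct (H e He) as [n1 H1]. exists (n0 + n1)%nat. intros n Hn.
rewrite <- E by lia. apply H1. lia.
Qed.

Lemma clim_const (c : C) : clim (fun _ => c) c.
Proof.
intros e He. exists O. intros n _. replace (c - c)%C with (RtoC 0) by ring. now rewrite Cmod_0.
Qed.

Lemma clim_plus (u v : nat -> C) (l m : C) : clim u l -> clim v m ->
  clim (fun n => u n + v n)%C (l + m)%C.
Proof.
intros Hl Hm e He.
destruct (Hl (e / 2) ltac:(lra)) as [n1 H1]. destruct (Hm (e / 2) ltac:(lra)) as [n2 H2].
exists (n1 + n2)%nat. intros n Hn. specialize (H1 n ltac:(lia)). specialize (H2 n ltac:(lia)).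
replace (u n + v n - (l + m))%C with ((u n - l) + (v n - m))%C by ring.
eapply Rle_lt_trans; [apply Cmod_triangle|]. lra.
Qed.

Lemma clim_scal (c : C) (u : nat -> C) (l : C) : clim u l -> clim (fun n => c * u n)%C (c * l)%C.
Proof.
intros H e He. assert (Hc := Cmod_ge_0 c).
destruct (H (e / (Cmod c + 1))) as [n0 H0]; [apply Rdiv_lt_0_compat; lra|].
exists n0. intros n Hn. specialize (H0 n Hn).
replace (c * u n - c * l)%C with (c * (u n - l))%C by ring. rewrite Cmod_mult.
apply Rmult_lt_compat_l with (r := Cmod c + 1) in H0; [|lra].
replace ((Cmod c + 1) * (e / (Cmod c + 1))) with e in H0 by (field; lra).
assert (Hp := Cmod_ge_0 (u n - l)). nra.
Qed.

Lemma clim_minus (u v : nat -> C) (l m : C) : clim u l -> clim v m ->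
  clim (fun n => u n - v n)%C (l - m)%C.
Proof.
intros Hl Hm. apply (clim_scal (- RtoC 1)) in Hm.
apply (clim_ext (fun n => u n + - RtoC 1 * v n)%C).
- exists O. intros; ring.
- replace (l - m)%C with (l + - RtoC 1 * m)%C by ring. now apply clim_plus.
Qed.

Lemma clim_filterlim (u : nat -> C) (l : C) :
  clim u l <-> filterlim u eventually (locally (T := C_UniformSpace) l).
Proof.
split.
- intros H P HP. apply (proj1 (C_locally_iff l P)) in HP. destruct HP as [d [Hd HP]].
  destruct (H d Hd) as [n0 H0]. exists n0. intros n Hn.
  replace (u n) with (l + (u n - l))%C by ring. now apply HP, H0.
- intros H e He.
  destruct (H (fun y => Cmod (y - l) < e)) as [n0 H0].
  + apply (proj2 (C_locally_iff l _)). exists e. split; [exact He|].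
    intros h Hh. now replace (l + h - l)%C with h by ring.
  + exists n0. exact H0.
Qed.

(** Comparison with a telescoping series: [1 / k^2 <= 2 / k - 2 / (k + 1)] for [k >= 1]. *)
Lemma telescoping_bound (u : nat -> C) (c : R) (n0 : nat) : 0 <= c -> (1 <= n0)%nat ->
  (forall k, (n0 <= k)%nat -> Cmod (u (S k) - u k) <= c / (INR k * INR k)) ->
  forall n m, (n0 <= n)%nat -> (n <= m)%nat -> Cmod (u m - u n) <= 2 * c / INR n.
Proof.
intros Hc Hn0 H n m Hn Hm.
assert (Pos : forall k, (n0 <= k)%nat -> 1 <= INR k).
{ intros k Hk. change 1 with (INR 1). apply le_INR. lia. }
assert (K : Cmod (u m - u n) <= 2 * c / INR n - 2 * c / INR m).
{ induction Hm as [|m Hm IH].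
  - replace (u n - u n)%C with (RtoC 0) by ring. rewrite Cmod_0. lra.
  - replace (u (S m) - u n)%C with ((u (S m) - u m) + (u m - u n))%C by ring.
    eapply Rle_trans; [apply Cmod_triangle|].
    assert (P := Pos m ltac:(lia)). specialize (H m ltac:(lia)).
    eapply Rle_trans; [apply Rplus_le_compat; [exact H|exact IH]|].
    rewrite S_INR. set (x := INR m) in *.
    assert (A : 2 * c / x - 2 * c / (x + 1) - c / (x * x) = c * (x - 1) / (x * x * (x + 1)))
      by (field; lra).
    assert (B : 0 <= c * (x - 1) / (x * x * (x + 1))).
    { apply Rmult_le_pos; [nra|]. left. apply Rinv_0_lt_compat. repeat apply Rmult_lt_0_compat; lra. }
    lra. }
assert (P := Pos m ltac:(lia)).
assert (0 <= 2 * c / INR m); [|lra].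
apply Rmult_le_pos; [lra|]. left. apply Rinv_0_lt_compat. lra.
Qed.

Lemma INR_large (c e : R) : 0 < e -> exists n0, (1 <= n0)%nat /\ forall n, (n0 <= n)%nat -> c / INR n < e.
Proof.
intros He. destruct (INR_unbounded (Rabs c / e)) as [n0 H0].
exists (S n0). split; [lia|]. intros n Hn.
assert (Hn' : INR (S n0) <= INR n) by now apply le_INR.
rewrite S_INR in Hn'.
assert (P : 0 <= Rabs c / e) by (apply Rmult_le_pos; [apply Rabs_pos|left; now apply Rinv_0_lt_compat]).
apply Rmult_lt_reg_r with (INR n); [lra|].
unfold Rdiv at 1. rewrite Rmult_assoc, Rinv_l, Rmult_1_r by lra.
eapply Rle_lt_trans; [apply Rle_abs|].
replace (Rabs c) with (e * (Rabs c / e)) by (field; lra).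
apply Rmult_lt_compat_l; lra.
Qed.

Lemma telescoping_cvg (u : nat -> C) (c : R) (n0 : nat) : 0 <= c -> (1 <= n0)%nat ->
  (forall k, (n0 <= k)%nat -> Cmod (u (S k) - u k) <= c / (INR k * INR k)) ->
  exists l, clim u l /\ forall n, (n0 <= n)%nat -> Cmod (u n - l) <= 2 * c / INR n.
Proof.
intros Hc Hn0 H. assert (T := telescoping_bound u c n0 Hc Hn0 H).
assert (Cau : forall p : C -> R, (forall a b, Rabs (p a - p b) <= Cmod (a - b)) ->
   exists l, is_lim_seq (fun n => p (u n)) (Finite l)).
{ intros p Hp. apply ex_lim_seq_cauchy_corr. intros [e He]. simpl.
  destruct (INR_large (4 * c) e He) as [n1 [_ H1]]. exists (n0 + n1)%nat. intros n m Hn Hm.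
  eapply Rle_lt_trans; [apply Hp|].
  replace (u n - u m)%C with ((u n - u (n0 + n1)%nat) - (u m - u (n0 + n1)%nat))%C by ring.
  eapply Rle_lt_trans; [apply Cmod_sub_triangle|].
  assert (A := T (n0 + n1)%nat n ltac:(lia) Hn). assert (B := T (n0 + n1)%nat m ltac:(lia) Hm).
  specialize (H1 (n0 + n1)%nat ltac:(lia)).
  replace (4 * c / INR (n0 + n1)) with (2 * c / INR (n0 + n1) + 2 * c / INR (n0 + n1)) in H1
    by (unfold Rdiv; ring). lra. }
destruct (Cau Re) as [x Hx].
{ intros a b. rewrite <- re_minus. apply re_le_Cmod. }
destruct (Cau Im) as [y Hy].
{ intros a b. rewrite <- im_minus. apply im_le_Cmod. }
assert (L : clim u (x, y)).
{ intros e He. apply is_lim_seq_spec in Hx. apply is_lim_seq_spec in Hy.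
  destruct (Hx (mkposreal (e / 2) ltac:(lra))) as [n1 H1].
  destruct (Hy (mkposreal (e / 2) ltac:(lra))) as [n2 H2].
  exists (n1 + n2)%nat. intros n Hn. specialize (H1 n ltac:(lia)). specialize (H2 n ltac:(lia)).
  simpl in H1, H2.
  eapply Rle_lt_trans; [apply Cmod_le_re_im|]. rewrite re_minus, im_minus. simpl. lra. }
exists (x, y). split; [exact L|]. intros n Hn. rewrite Cmod_sub_sym.
replace ((x, y) - u n)%C with (- (u n - (x, y)))%C by ring. rewrite Cmod_opp, Cmod_sub_sym.
apply (clim_le (fun m => u m - u n)%C).
- apply clim_minus; [exact L|apply clim_const].
- exists n. intros m Hm. now apply T.
Qed.

(** By the Cauchy estimate the derivatives also have increments of order [1 / n^2], so they
    converge. The quadratic remainder bound is uniform in [n] and passes to the limit, which shows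
    that the limit of the derivatives is the derivative of [V]. *)
Theorem Weierstrass (v : nat -> C -> C) (V : C -> C) (d : nat -> C) (a : C) (r c : R) (n0 : nat) :
  0 < r -> 0 <= c -> (1 <= n0)%nat ->
  (forall n, (n0 <= n)%nat -> holo_disc (v n) a r /\ cderiv (v n) a (d n)) ->
  (forall n z, (n0 <= n)%nat -> Cmod (z - a) < r ->
     Cmod (v (S n) z - v n z) <= c / (INR n * INR n)) ->
  (forall z, Cmod (z - a) < r -> clim (fun n => v n z) (V z)) ->
  exists l, cderiv V a l /\ clim d l /\ (forall n, (n0 <= n)%nat -> Cmod (d (S n) - d n) <= 8 * c / r / (INR n * INR n)).
Proof.
intros Hr Hc Hn0 Hol Hb HV.
assert (Hd : forall n, (n0 <= n)%nat -> Cmod (d (S n) - d n) <= 8 * c / r / (INR n * INR n)).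
{ intros n Hn.
  assert (P : 1 <= INR n) by (change 1 with (INR 1); apply le_INR; lia).
  replace (8 * c / r / (INR n * INR n)) with (8 * (c / (INR n * INR n)) / r) by (field; lra).
  destruct (Hol n Hn) as [A1 A2]. destruct (Hol (S n) ltac:(lia)) as [B1 B2].
  apply (Cauchy_estimate (fun z => v (S n) z - v n z)%C a); try assumption.
  - intros z Hz. destruct (A1 z Hz) as [l1 L1], (B1 z Hz) as [l2 L2].
    eexists. now apply cderiv_minus; [apply L2|apply L1].
  - now apply cderiv_minus.
  - intros z Hz. now apply Hb. }
destruct (telescoping_cvg d (8 * c / r) n0) as [l [Hl _]]; [|exact Hn0|exact Hd|].
{ apply Rmult_le_pos; [lra|]. left. now apply Rinv_0_lt_compat. }
exists l. split; [|split; [exact Hl|exact Hd]].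
(* The [v n] carry no uniform bound; their differences with [v n0] do, so [disc_quadratic] is
   applied to those and [v n0] is added back at the end. *)
assert (T : forall n z, (n0 <= n)%nat -> Cmod (z - a) < r -> Cmod (v n z - v n0 z) <= 2 * c).
{ intros n z Hn Hz.
  assert (P : 1 <= INR n0) by (change 1 with (INR 1); apply le_INR; lia).
  eapply Rle_trans; [apply (telescoping_bound (fun n => v n z) c n0 Hc Hn0)|]; try assumption.
  - intros k Hk. now apply Hb.
  - lia.
  - apply Rmult_le_reg_r with (INR n0); [lra|]. unfold Rdiv.
    rewrite Rmult_assoc, Rinv_l, Rmult_1_r by lra. nra. }
assert (Q : forall h, Cmod h < r / 4 ->
  Cmod ((V (a + h)%C - v n0 (a + h)%C) - (V a - v n0 a) - (l - d n0) * h)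
    <= 512 * (2 * c) / (r * r) * (Cmod h * Cmod h)).
{ intros h Hh.
  apply (clim_le (fun n => (v n (a + h) - v n0 (a + h)) - (v n a - v n0 a) - (d n - d n0) * h)%C).
  - assert (Ca : Cmod (a - a) < r) by (replace (a - a)%C with (RtoC 0) by ring; now rewrite Cmod_0).
    assert (Ch : Cmod (a + h - a) < r) by (replace (a + h - a)%C with h by ring; lra).
    apply clim_minus; [apply clim_minus; apply clim_minus|].
    + now apply HV.
    + apply clim_const.
    + now apply HV.
    + apply clim_const.
    + apply (clim_ext (fun n => h * (d n - d n0))%C); [exists O; intros; ring|].
      rewrite Cmult_comm. apply clim_scal, clim_minus; [exact Hl|apply clim_const].
  - exists n0. intros n Hn. destruct (Hol n Hn) as [A1 A2]. destruct (Hol n0 ltac:(lia)) as [B1 B2].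
    apply (disc_quadratic (fun z => v n z - v n0 z)%C); try assumption.
    + intros z Hz. destruct (A1 z Hz) as [l1 L1], (B1 z Hz) as [l2 L2].
      eexists. now apply cderiv_minus; [apply L1|apply L2].
    + now apply cderiv_minus.
    + intros z Hz. now apply T. }
set (K := 512 * (2 * c) / (r * r)) in Q.
assert (HK : 0 <= K).
{ apply Rmult_le_pos; [lra|]. left. apply Rinv_0_lt_compat. nra. }
apply (cderiv_ext (fun z => (V z - v n0 z) + v n0 z)%C); [intros; ring|].
eapply cderiv_eq; [|apply (cderiv_plus (fun z => V z - v n0 z)%C (v n0) a (l - d n0) (d n0))].
- ring.
- intros e He. exists (Rmin (r / 4) (e / (K + 1))). split.
  { apply Rmin_pos; [lra|]. apply Rdiv_lt_0_compat; lra. }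
  intros h Hh.
  assert (H1 := Rlt_le_trans _ _ _ Hh (Rmin_l _ _)).
  assert (H2 := Rlt_le_trans _ _ _ Hh (Rmin_r _ _)).
  eapply Rle_trans; [apply (Q h H1)|].
  rewrite <- Rmult_assoc. apply Rmult_le_compat_r; [apply Cmod_ge_0|].
  apply Rmult_lt_compat_l with (r := K + 1) in H2; [|lra].
  replace ((K + 1) * (e / (K + 1))) with e in H2 by (field; lra).
  assert (Hp := Cmod_ge_0 h). nra.
- apply Hol. lia.
Qed.

(** * The identity theorem *)

(* The functions [f z / (z - a) ^ k] are all holomorphic, as [f] vanishes near [a], and
   the Cauchy estimate bounds each of them in terms of the previous one. *)
Lemma disc_vanishing (f : C -> C) (a : C) (r M d : R) : 0 < r -> 0 < d ->
  holo_disc f a r -> (forall z, Cmod (z - a) < r -> Cmod (f z) <= M) ->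
  (forall z, Cmod (z - a) < d -> f z = RtoC 0) ->
  forall z, Cmod (z - a) < r / 16 -> f z = RtoC 0.
Proof.
intros Hr Hd H HM H0.
assert (Ca : forall s, 0 < s -> Cmod (a - a) < s)
  by (intros s Hs; replace (a - a)%C with (RtoC 0) by ring; now rewrite Cmod_0).
assert (HMp : 0 <= M) by (eapply Rle_trans; [apply Cmod_ge_0|apply (HM a), Ca, Hr]).
assert (G : forall k g N, 0 <= N -> holo_disc g a r -> (forall z, Cmod (z - a) < r -> Cmod (g z) <= N) ->
   (forall z, Cmod (z - a) < d -> g z = RtoC 0) ->
   forall z, Cmod (z - a) < r -> Cmod (g z) <= N * (16 * Cmod (z - a) / r) ^ k).
{ induction k as [|k IH]; intros g N HN Hg HgN Hg0 z Hz.
  - simpl. rewrite Rmult_1_r. now apply HgN.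
  (* At [a] the quotient is 0 because [g a] is, whatever the value given to the inverse of 0. *)
  - set (g1 := fun z => (g z * / (z - a))%C).
    assert (Hga : g a = RtoC 0) by (apply Hg0, Ca, Hd).
    assert (E : forall y, g y = (g1 y * (y - a))%C).
    { intros y. unfold g1. destruct (Ceq_dec y a) as [->|Hy].
      - rewrite Hga. ring.
      - field. now apply Cminus_eq_contra. }
    (* Each division by [z - a] costs a factor [16 / r]: within [r / 2] of [a] by the mean value
       inequality and the Cauchy estimate on radius [r / 2], farther out by the size of the divisor.
       Hence the ratio [16 |z - a| / r], below 1 exactly for [|z - a| < r / 16]. *)
    assert (B1 : forall y, Cmod (y - a) < r -> Cmod (g1 y) <= 16 * N / r).
    { intros y Hy. destruct (Ceq_dec y a) as [->|Hya].
      - unfold g1. rewrite Hga, Cmult_0_l, Cmod_0.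
        apply Rmult_le_pos; [lra|left; now apply Rinv_0_lt_compat].
      - assert (Hn := Cminus_eq_contra _ _ Hya).
        assert (Hp := proj1 (Cmod_gt_0 _) Hn).
        assert (Q : Cmod (g y) <= 16 * N / r * Cmod (y - a)).
        { destruct (Rlt_le_dec (Cmod (y - a)) (r / 2)) as [Hs|Hs].
          - replace (g y) with (g (a + (y - a))%C - g a)%C
              by (rewrite Hga, Cminus_0_r; f_equal; ring).
            apply (cderiv_mean_value g (deriv_at g)). intros t Ht.
            set (p := (a + RtoC t * (y - a))%C).
            assert (Hpd : Cmod (p - a) < r / 2).
            { unfold p. replace (a + RtoC t * (y - a) - a)%C with (RtoC t * (y - a))%C by ring.
              rewrite Cmod_mult, Cmod_R, Rabs_pos_eq by lra. nra. }
            assert (Hs' : cderiv g p (deriv_at g p)) by (apply deriv_at_spec, Hg; lra).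
            split; [exact Hs'|].
            replace (16 * N / r) with (8 * N / (r / 2)) by (field; lra).
            apply (Cauchy_estimate g p); [lra| |exact Hs'|].
            + apply (holo_disc_sub g a _ r); [lra|exact Hg].
            + intros x Hx. apply HgN. replace (x - a)%C with ((x - p) + (p - a))%C by ring.
              eapply Rle_lt_trans; [apply Cmod_triangle|]. lra.
          - eapply Rle_trans; [now apply HgN|].
            apply Rle_trans with (16 * N / r * (r / 2)); [replace (16 * N / r * (r / 2)) with (8 * N) by (field; lra); lra|].
            apply Rmult_le_compat_l; [|exact Hs].
            apply Rmult_le_pos; [lra|left; now apply Rinv_0_lt_compat]. }
        rewrite E, Cmod_mult in Q. now apply Rmult_le_reg_r in Q. }
    assert (Hol1 : holo_disc g1 a r).
    { intros y Hy. destruct (Ceq_dec y a) as [->|Hya].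
      - exists (RtoC 0). apply (cderiv_ext_loc (fun _ => RtoC 0)); [|apply cderiv_const].
        exists d. split; [exact Hd|]. intros h Hh. unfold g1. rewrite Hg0; [ring|].
        now replace (a + h - a)%C with h by ring.
      - destruct (Hg y Hy) as [m Hm]. eexists. apply cderiv_mult; [exact Hm|].
        apply (cderiv_comp Cinv (fun t => t - a)%C).
        + apply cderiv_inv. now apply Cminus_eq_contra.
        + apply cderiv_minus; [apply cderiv_id|apply cderiv_const]. }
    specialize (IH g1 (16 * N / r)). rewrite E, Cmod_mult. simpl.
    replace (N * (16 * Cmod (z - a) / r * (16 * Cmod (z - a) / r) ^ k)) with
      (16 * N / r * (16 * Cmod (z - a) / r) ^ k * Cmod (z - a)) by (field; lra).
    apply Rmult_le_compat_r; [apply Cmod_ge_0|]. apply IH; try assumption.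
    + apply Rmult_le_pos; [lra|left; now apply Rinv_0_lt_compat].
    + intros y Hy. unfold g1. rewrite Hg0 by exact Hy. ring. }
intros z Hz. apply Cmod_small_eq_0. intros e He.
set (q := 16 * Cmod (z - a) / r).
assert (Hq0 : 0 <= q).
{ unfold q, Rdiv. assert (P := Cmod_ge_0 (z - a)).
  apply Rmult_le_pos; [lra|]. left. now apply Rinv_0_lt_compat. }
assert (Hq1 : q < 1).
{ unfold q. apply Rmult_lt_reg_r with r; [exact Hr|]. unfold Rdiv.
  rewrite Rmult_assoc, Rinv_l by lra. lra. }
destruct (pow_lt_1_zero q ltac:(now rewrite Rabs_pos_eq) (e / (M + 1))) as [k Hk].
{ apply Rdiv_lt_0_compat; lra. }
specialize (Hk k (Nat.le_refl k)). rewrite Rabs_pos_eq in Hk by now apply pow_le.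
eapply Rle_trans; [apply (G k f M HMp H HM H0); lra|]. fold q.
apply Rmult_lt_compat_l with (r := M + 1) in Hk; [|lra].
replace ((M + 1) * (e / (M + 1))) with e in Hk by (field; lra).
assert (P := pow_le q k Hq0). nra.
Qed.

(** A compactness argument with a gauge: the radius at a point is taken at most [1 / (|f| + 1)], so
    a positive lower bound [d] for the radii needed to cover the rectangle is turned into the bound
    [1 / d] for [|f|]. *)
Lemma holo_rect_bounded (f : C -> C) (x1 x2 y1 y2 : R) : holo_rect f x1 x2 y1 y2 ->
  exists M, forall z, x1 <= Re z <= x2 -> y1 <= Im z <= y2 -> Cmod (f z) <= M.
Proof.
intros H.
assert (D : forall x y, exists d : posreal, x1 <= x <= x2 -> y1 <= y <= y2 ->
   d <= / (Cmod (f (x, y)) + 1) /\ forall h, Cmod h < 2 * d -> Cmod (f ((x, y) + h)%C) <= Cmod (f (x, y)) + 1).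
{ intros x y.
  destruct (classic (x1 <= x <= x2 /\ y1 <= y <= y2)) as [[Hx Hy]|Hn];
    [|exists (mkposreal 1 Rlt_0_1); intros; exfalso; tauto].
  destruct (H x y Hx Hy) as [l Hl]. destruct (cderiv_cont f _ _ Hl 1 Rlt_0_1) as [d [Hd Hc]].
  assert (Hp := Cmod_ge_0 (f (x, y))).
  assert (Hm : 0 < Rmin (d / 2) (/ (Cmod (f (x, y)) + 1))).
  { apply Rmin_pos; [lra|]. apply Rinv_0_lt_compat. lra. }
  exists (mkposreal _ Hm). intros _ _. simpl. split; [apply Rmin_r|].
  intros h Hh. assert (Hm1 := Rmin_l (d / 2) (/ (Cmod (f (x, y)) + 1))).
  specialize (Hc h ltac:(lra)).
  assert (T := Cmod_triangle_rev (f ((x, y) + h)%C) (f (x, y))). lra. }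
set (delta := fun x y => proj1_sig (constructive_indefinite_description _ (D x y))).
destruct (compactness_value_2d x1 x2 y1 y2 delta) as [d Hd].
exists (/ d). intros z Hx Hy. apply NNPP. intros Hn. apply (Hd (Re z) (Im z) Hx Hy).
intros [u [v [Hu [Hv [A [B Hdd]]]]]]. apply Hn.
unfold delta in A, B, Hdd.
destruct (constructive_indefinite_description _ (D u v)) as [d' Hd']. simpl in A, B, Hdd.
destruct (Hd' Hu Hv) as [D1 D2].
assert (P := Cmod_ge_0 (f (u, v))).
replace z with ((u, v) + (z - (u, v)))%C by ring.
eapply Rle_trans; [apply D2|].
- eapply Rle_lt_trans; [apply Cmod_le_re_im|]. rewrite re_minus, im_minus. simpl. lra.
- assert (Hdp := cond_pos d).
  rewrite <- (Rinv_inv (Cmod (f (u, v)) + 1)). apply Rinv_le_contravar; [exact Hdp|lra].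
Qed.

(* [D] is propagated to the left along horizontal lines [Im z = y <> 0], by steps
   proportional to the distance [|y|] to the exceptional point; real points follow by continuity. *)
Lemma vanishing_off_1 (D : C -> C) :
  (forall s, s <> RtoC 1 -> exists l, cderiv D s l) -> (forall s, 1 < Re s -> D s = RtoC 0) ->
  forall s, s <> RtoC 1 -> D s = RtoC 0.
Proof.
intros H H0.
assert (N1 : forall z, Im z <> 0 -> z <> RtoC 1) by (intros z Hz ->; apply Hz; reflexivity).
assert (P : forall n z, Im z <> 0 -> 1 - INR n * (Rabs (Im z) / 64) < Re z -> D z = RtoC 0).
{ induction n as [|n IH]; intros z Hi Hr.
  - apply H0. simpl in Hr. lra.
  - set (y := Rabs (Im z)) in *. assert (Hy : 0 < y) by now apply Rabs_pos_lt.
    (* [disc_vanishing] with radius [y / 2] reaches distance [y / 32] from [a], hence [z]. *)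
    set (a := (z + RtoC (y / 64))%C).
    assert (Ra : Re a = Re z + y / 64) by (unfold a; now rewrite re_plus, re_RtoC).
    assert (Ia : Im a = Im z) by (unfold a; rewrite im_plus, im_RtoC; ring).
    assert (Hd : forall p d, Cmod (p - a) < d ->
       Re a - d < Re p < Re a + d /\ y - d < Rabs (Im p) /\ Im a - d < Im p < Im a + d).
    { intros p d Hp. assert (A := re_le_Cmod (p - a)). assert (B := im_le_Cmod (p - a)).
      rewrite re_minus in A. rewrite im_minus in B.
      assert (A' := Rle_lt_trans _ _ _ A Hp). assert (B' := Rle_lt_trans _ _ _ B Hp).
      apply Rabs_lt_between in A'. apply Rabs_lt_between in B'.
      split; [lra|]. split; [|lra].
      assert (T := Rabs_triang_inv (Im a) (Im p)). rewrite (Rabs_minus_sym (Im a)) in T.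
      rewrite Ia in T at 1. fold y in T. assert (T2 := Rle_lt_trans _ _ _ B Hp). lra. }
    (* By [g] the point [a] lies to the right of the line already reached at its height. Nearby
       points have other heights, which shifts that line; the radius [g / (1 + n)] allows for it. *)
    set (g := Re a - (1 - INR n * (y / 64))).
    assert (Hg : 0 < g) by (unfold g; rewrite Ra; rewrite S_INR in Hr; lra).
    assert (Hn := pos_INR n).
    destruct (holo_rect_bounded D (Re a - y / 2) (Re a + y / 2) (Im a - y / 2) (Im a + y / 2)) as [M HM].
    { intros u v Hu Hv. apply H, N1. simpl. intros ->. rewrite Ia in Hv.
      assert (y <= y / 2); [|lra]. unfold y at 1. apply Rabs_le. lra. }
    apply (disc_vanishing D a (y / 2) M (Rmin (y / 2) (g / (1 + INR n)))).
    + lra.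
    + apply Rmin_pos; [lra|]. apply Rdiv_lt_0_compat; lra.
    + intros p Hp. apply H, N1. destruct (Hd p _ Hp) as [_ [Hp2 _]]. intros E. rewrite E, Rabs_R0 in Hp2. lra.
    + intros p Hp. destruct (Hd p _ Hp) as [Hp1 [_ Hp3]]. apply HM; lra.
    + intros p Hp. assert (Hp1 := Rlt_le_trans _ _ _ Hp (Rmin_l _ _)).
      assert (Hp2 := Rlt_le_trans _ _ _ Hp (Rmin_r _ _)).
      destruct (Hd p _ Hp1) as [_ [E1 _]]. destruct (Hd p _ Hp2) as [F1 [F2 _]].
      apply IH.
      * intros E. rewrite E, Rabs_R0 in E1. lra.
      * set (d := g / (1 + INR n)) in *.
        assert (Ed : d + INR n * d = g) by (unfold d; field; lra).
        assert (Hd0 : 0 < d) by (apply Rdiv_lt_0_compat; lra).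
        unfold g in Ed. nra.
    + replace (z - a)%C with (- RtoC (y / 64))%C by (unfold a; ring).
      rewrite Cmod_opp, Cmod_R, Rabs_pos_eq by lra. lra. }
assert (P' : forall z, Im z <> 0 -> D z = RtoC 0).
{ intros z Hz. assert (Hy : 0 < Rabs (Im z)) by now apply Rabs_pos_lt.
  destruct (INR_unbounded ((1 - Re z) / (Rabs (Im z) / 64))) as [n Hn].
  apply (P n z Hz). apply Rmult_gt_compat_r with (r := Rabs (Im z) / 64) in Hn; [|lra].
  replace ((1 - Re z) / (Rabs (Im z) / 64) * (Rabs (Im z) / 64)) with (1 - Re z) in Hn by (field; lra).
  lra. }
intros s Hs. destruct (Req_dec (Im s) 0) as [Ei|Ei]; [|now apply P'].
apply Cmod_small_eq_0. intros e He. destruct (H s Hs) as [l Hl].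
destruct (cderiv_cont D s l Hl e He) as [d [Hd Hc]].
assert (Hh : Cmod (RtoC (d / 2) * Ci) < d).
{ rewrite Cmod_mult, Cmod_R, Cmod_Ci, Rabs_pos_eq; lra. }
specialize (Hc _ Hh). rewrite P' in Hc.
- replace (RtoC 0 - D s)%C with (- D s)%C in Hc by ring. rewrite Cmod_opp in Hc. lra.
- rewrite im_plus, im_scal_l, Ei. simpl. lra.
Qed.

(** * Modified Bernoulli polynomials *)

(** The Taylor coefficients of [exp (- t)]. *)
Definition sign_fact (j : nat) : C := RtoC ((-1) ^ j / INR (fact j)).

(** Each $b_m$ depends on all previous ones, so the recursion builds a table: stage [n] holds the
    entries of index below [n]. *)
Fixpoint bern_table (w : C) (n : nat) : nat -> C :=
  match n with
  | O => fun _ => RtoC 0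
  | S m => fun k =>
      if Nat.eqb k m
      then (sign_fact (S m) * w ^ (S m) + sign_fact (S (S m))
            + csum (fun i => bern_table w m i * sign_fact (S m - i)) m)%C
      else bern_table w m k
  end.

Definition bern (w : C) (k : nat) : C := bern_table w (S k) k.

Lemma bern_table_bern (w : C) (n k : nat) : (k < n)%nat -> bern_table w n k = bern w k.
Proof.
induction n as [|n IH]; intros H; [lia|].
destruct (Nat.eq_dec k n) as [->|Hk]; [reflexivity|].
transitivity (bern_table w n k); [|apply IH; lia].
simpl. apply Nat.eqb_neq in Hk. now rewrite Hk.
Qed.

Lemma bern_step (w : C) (m : nat) :
  bern w m = (sign_fact (S m) * w ^ (S m) + sign_fact (S (S m))
            + csum (fun i => bern w i * sign_fact (S m - i)) m)%C.
Proof.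
unfold bern at 1. simpl bern_table. rewrite Nat.eqb_refl. f_equal.
apply csum_ext. intros k Hk. now rewrite bern_table_bern.
Qed.

Lemma sign_fact_0 : sign_fact 0 = RtoC 1.
Proof. unfold sign_fact. f_equal. simpl. field. Qed.

Lemma sign_fact_1 : sign_fact 1 = (- RtoC 1)%C.
Proof. unfold sign_fact. rewrite <- RtoC_opp. f_equal. simpl. field. Qed.

(** The coefficient of $t^m$ in $(1-e^{-t})\sum_k b_k t^k=e^{-wt}-(1-e^{-t})/t$. *)
Lemma bern_rec (w : C) (m : nat) :
  (sign_fact m * w ^ m + sign_fact (S m) + csum (fun k => bern w k * sign_fact (m - k)) m)%C = RtoC 0.
Proof.
destruct m as [|m].
- rewrite sign_fact_0, sign_fact_1. simpl. ring.
- change (csum (fun k => bern w k * sign_fact (S m - k))%C (S m)) with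
    (csum (fun k => bern w k * sign_fact (S m - k))%C m + bern w m * sign_fact (S m - m))%C.
  replace (S m - m)%nat with 1%nat by lia. rewrite sign_fact_1, (bern_step w m). ring.
Qed.

(** [bern_rec] completed by its diagonal term, in the shape of the inner sums produced by
    [csum_triangle]. *)
Lemma bern_conv (w : C) (m : nat) :
  csum (fun k => bern w k * sign_fact (m - k))%C (S m) =
  (bern w m - sign_fact m * w ^ m - sign_fact (S m))%C.
Proof.
simpl. rewrite Nat.sub_diag, sign_fact_0. assert (H := bern_rec w m).
set (s := csum _ m) in *.
replace s with ((sign_fact m * w ^ m + sign_fact (S m) + s) - sign_fact m * w ^ m - sign_fact (S m))%C by ring.
rewrite H. ring.
Qed.

Lemma Cmod_sign_fact_le (j : nat) : Cmod (sign_fact j) <= 1.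
Proof.
unfold sign_fact. rewrite Cmod_R. unfold Rdiv. rewrite Rabs_mult, pow_1_abs, Rmult_1_l.
assert (H : 1 <= INR (fact j)).
{ change 1 with (INR 1). apply le_INR. apply lt_O_fact. }
rewrite Rabs_inv, Rabs_pos_eq by lra. rewrite <- Rinv_1. apply Rinv_le_contravar; lra.
Qed.

Lemma csum_Cmod_geom (f : nat -> C) (A G : R) (n : nat) : 0 <= A -> 4 <= G ->
  (forall k, (k < n)%nat -> Cmod (f k) <= A * G ^ k) -> Cmod (csum f n) <= A * G ^ n / 3.
Proof.
intros HA HG. induction n as [|n IH]; intros H.
- simpl. rewrite Cmod_0. lra.
- simpl. eapply Rle_trans; [apply Cmod_triangle|].
  assert (H1 := H n ltac:(lia)).
  assert (H2 : Cmod (csum f n) <= A * G ^ n / 3) by (apply IH; intros; apply H; lia).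
  assert (P : 0 <= A * G ^ n) by (apply Rmult_le_pos; [exact HA|apply pow_le; lra]).
  replace (A * (G * G ^ n) / 3) with (G * (A * G ^ n) / 3) by field. nra.
Qed.

(** With ratio [G = B + 4 >= 4] the earlier terms add up to at most a third of [A G^k], and
    [A = 2 (G + 1)] leaves room for the two explicit terms, at most [G^(k+1) + 1]. The bound is
    uniform over [|w| <= B]. *)
Lemma bern_bound (w : C) (B : R) (k : nat) : Cmod w <= B ->
  Cmod (bern w k) <= 2 * (B + 5) * (B + 4) ^ k.
Proof.
intros Hw. assert (HB := Cmod_ge_0 w).
set (G := B + 4). set (A := 2 * (B + 5)).
induction k as [k IH] using (well_founded_induction lt_wf).
assert (HG : 1 <= G ^ k) by (apply pow_R1_Rle; unfold G; lra).
rewrite bern_step.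
assert (X1 : Cmod (sign_fact (S k) * w ^ S k) <= G * G ^ k).
{ rewrite Cmod_mult, Cmod_pow. rewrite <- (Rmult_1_l (G * G ^ k)).
  apply Rmult_le_compat; [apply Cmod_ge_0|apply pow_le, Cmod_ge_0|apply Cmod_sign_fact_le|].
  apply (pow_incr _ _ (S k)). unfold G. lra. }
assert (X2 : Cmod (sign_fact (S (S k))) <= 1) by apply Cmod_sign_fact_le.
assert (X3 : Cmod (csum (fun i => bern w i * sign_fact (S k - i))%C k) <= A * G ^ k / 3).
{ apply csum_Cmod_geom; [unfold A; lra|unfold G; lra|].
  intros i Hi. rewrite Cmod_mult, <- (Rmult_1_r (A * G ^ i)).
  apply Rmult_le_compat; [apply Cmod_ge_0|apply Cmod_ge_0|now apply IH|apply Cmod_sign_fact_le]. }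
eapply Rle_trans; [apply Cmod_triangle|].
apply Rle_trans with (G * G ^ k + 1 + A * G ^ k / 3).
- apply Rplus_le_compat; [|exact X3]. eapply Rle_trans; [apply Cmod_triangle|]. lra.
- unfold A, G in *. nra.
Qed.

Lemma ex_cderiv_csum (f : nat -> C -> C) (z : C) (n : nat) :
  (forall k, (k < n)%nat -> exists l, cderiv (f k) z l) ->
  exists l, cderiv (fun t => csum (fun k => f k t) n) z l.
Proof.
intros H. exists (csum (fun k => deriv_at (f k) z) n). apply cderiv_csum.
intros k Hk. now apply deriv_at_spec, H.
Qed.

Lemma ex_cderiv_bern (w : C) (k : nat) : exists l, cderiv (fun t => bern t k) w l.
Proof.
induction k as [k IH] using (well_founded_induction lt_wf).
destruct (ex_cderiv_csum (fun i t => bern t i * sign_fact (S k - i))%C w k) as [l Hl].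
{ intros i Hi. destruct (IH i Hi) as [m Hm]. eexists.
  apply cderiv_mult; [exact Hm|apply cderiv_const]. }
eexists. apply (cderiv_ext (fun t => (sign_fact (S k) * t ^ (S k) + sign_fact (S (S k)))
            + csum (fun i => bern t i * sign_fact (S k - i)) k)%C).
- intros t. symmetry. apply bern_step.
- apply cderiv_plus; [|exact Hl]. apply cderiv_plus; [|apply cderiv_const].
  apply cderiv_scal, cderiv_pow.
Qed.

Lemma clim_geom (u : nat -> C) (l : C) (K q : R) : 0 <= q < 1 ->
  (forall n, Cmod (u n - l) <= K * q ^ n) -> clim u l.
Proof.
intros Hq H e He.
assert (HK : 0 <= K).
{ specialize (H O). simpl in H. assert (P := Cmod_ge_0 (u O - l)). lra. }
destruct (pow_lt_1_zero q ltac:(rewrite Rabs_pos_eq; lra) (e / (K + 1))) as [n0 H0].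
{ apply Rdiv_lt_0_compat; lra. }
exists n0. intros n Hn. specialize (H0 n Hn). rewrite Rabs_pos_eq in H0 by (apply pow_le; lra).
apply Rmult_lt_compat_l with (r := K + 1) in H0; [|lra].
replace ((K + 1) * (e / (K + 1))) with e in H0 by (field; lra).
assert (P := pow_le q n (proj1 Hq)). specialize (H n). nra.
Qed.

Lemma sign_fact_S (j : nat) : (RtoC (INR (S j)) * sign_fact (S j))%C = (- sign_fact j)%C.
Proof.
unfold sign_fact. rewrite <- RtoC_mult, <- RtoC_opp. f_equal.
change (fact (S j)) with (S j * fact j)%nat. rewrite mult_INR.
assert (A := INR_fact_neq_0 j). assert (B : INR (S j) <> 0) by (apply not_0_INR; lia).
simpl pow. field. tauto.
Qed.

(** The derivative of the remainder of order [J + 1] is minus the remainder of order [J], so each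
    use of the mean value inequality gains a factor [|t|]. *)
Lemma Cexp_opp_Taylor (J : nat) (t : C) :
  Cmod (Cexp (- t) - csum (fun j => sign_fact j * t ^ j) J)%C <= exp (Cmod t) * Cmod t ^ J.
Proof.
revert t. induction J as [|J IH]; intros t.
- simpl. rewrite Cminus_0_r, Rmult_1_r, <- (Cmod_opp t). apply Cmod_Cexp_le.
- set (F := fun t => (Cexp (- t) - csum (fun j => sign_fact j * t ^ j) (S J))%C).
  set (F' := fun t => (- (Cexp (- t) - csum (fun j => sign_fact j * t ^ j) J))%C).
  assert (D : forall z, cderiv F z (F' z)).
  { intros z. unfold F.
    apply (cderiv_ext (fun t => Cexp (- t) - (sign_fact 0 * RtoC 1 + csum (fun j => sign_fact (S j) * t ^ S j) J))%C).
    - intros y. rewrite (csum_shift (fun j => sign_fact j * y ^ j)%C). reflexivity.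
    - eapply cderiv_eq; [|apply cderiv_minus].
      2:{ apply (cderiv_comp Cexp (fun t => - t)%C); [apply cderiv_Cexp|apply cderiv_opp, cderiv_id]. }
      2:{ apply cderiv_plus; [apply cderiv_const|].
          apply (cderiv_csum (fun j t => sign_fact (S j) * t ^ S j)%C).
          intros k _. apply cderiv_scal, cderiv_pow. }
      unfold F'. simpl Nat.pred.
      rewrite (csum_ext _ (fun k => - RtoC 1 * (sign_fact k * z ^ k))%C).
      + rewrite csum_scal. ring.
      + intros k _.
        transitivity ((RtoC (INR (S k)) * sign_fact (S k)) * z ^ k)%C; [ring|].
        rewrite sign_fact_S. ring. }
  assert (E0 : F (RtoC 0) = RtoC 0).
  { unfold F. rewrite csum_shift. rewrite sign_fact_0. replace (- RtoC 0)%C with (RtoC 0) by ring.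
    rewrite Cexp_0, csum_zero; [simpl; ring|]. intros k _. simpl. ring. }
  change (Cmod (F t) <= exp (Cmod t) * Cmod t ^ S J).
  replace (F t) with (F (RtoC 0 + t) - F (RtoC 0))%C by (rewrite E0, Cplus_0_l; ring).
  simpl pow. replace (exp (Cmod t) * (Cmod t * Cmod t ^ J)) with (exp (Cmod t) * Cmod t ^ J * Cmod t) by ring.
  apply (cderiv_mean_value F F'). intros x Hx. split; [apply D|].
  unfold F'. rewrite Cmod_opp. eapply Rle_trans; [apply IH|].
  assert (Hle : Cmod (RtoC 0 + RtoC x * t) <= Cmod t).
  { rewrite Cplus_0_l, Cmod_mult, Cmod_R, Rabs_pos_eq by lra. assert (P := Cmod_ge_0 t). nra. }
  apply Rmult_le_compat.
  + left; apply exp_pos.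
  + apply pow_le, Cmod_ge_0.
  + destruct Hle as [Hle| ->]; [left; now apply exp_increasing|lra].
  + apply pow_incr. split; [apply Cmod_ge_0|exact Hle].
Qed.

Lemma Cexp_opp_clim (t : C) : Cmod t < 1 ->
  clim (csum (fun j => sign_fact j * t ^ j)%C) (Cexp (- t)).
Proof.
intros H. apply (clim_geom _ _ (exp (Cmod t)) (Cmod t)).
- split; [apply Cmod_ge_0|exact H].
- intros n. rewrite Cmod_sub_sym. apply Cexp_opp_Taylor.
Qed.

Lemma clim_S (u : nat -> C) (l : C) : clim (fun n => u (S n)) l <-> clim u l.
Proof.
split; intros H e He; destruct (H e He) as [n0 H0].
- exists (S n0). intros [|n] Hn; [lia|]. apply H0. lia.
- exists n0. intros n Hn. apply H0. lia.
Qed.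

Lemma is_series_clim (f : nat -> C) (l : C) :
  is_series (V := C_NormedModule) f l <-> clim (csum f) l.
Proof.
rewrite <- clim_S, clim_filterlim. unfold is_series.
split; apply filterlim_ext; intros n; [apply csum_sum_n|symmetry; apply csum_sum_n].
Qed.

Lemma is_pseries_clim (b : nat -> C) (t l : C) :
  is_pseries (V := C_NormedModule) b t l <-> clim (csum (fun k => b k * t ^ k)%C) l.
Proof.
assert (E : forall k, scal (V := C_NormedModule) (pow_n (K := C_Ring) t k) (b k) = (b k * t ^ k)%C).
{ intros k. change (pow_n (K := C_Ring) t k * b k = b k * t ^ k)%C. apply Cmult_comm. }
unfold is_pseries. rewrite is_series_clim.
split; apply clim_ext; exists O; intros n _; apply csum_ext; intros k _; [|symmetry]; apply E.
Qed.

Lemma bern_generating (w : C) : is_modified_bernoulli w (bern w).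
Proof.
assert (HB := Cmod_ge_0 w). set (B := Cmod w) in *.
set (G := B + 4). set (A := 2 * (B + 5)).
(* This radius gives [G |t| < 1 / 4]; the remainder [X n] below is then at most
   [3 A n / 4^n <= 3 A / 2^n]. *)
exists (/ (4 * G)). split; [apply Rinv_0_lt_compat; unfold G; lra|].
intros t [Ht0 Ht]. apply is_pseries_clim.
set (x := Cmod t) in *.
assert (HGx : G * x < / 4).
{ apply Rmult_lt_compat_l with (r := G) in Ht; [|unfold G; lra].
  rewrite Rinv_mult, (Rmult_comm (/ 4)), <- Rmult_assoc, Rinv_r, Rmult_1_l in Ht by (unfold G; lra).
  exact Ht. }
assert (Hx1 : x < / 4) by (unfold G in HGx; nra).
assert (Hwx : B * x < 1) by (unfold G in HGx; nra).
assert (He3 : exp x <= 3).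
{ apply Rle_trans with (exp 1); [left; apply exp_increasing; lra|apply exp_le_3]. }
assert (Htn : t <> RtoC 0) by now apply Cmod_gt_0.
assert (Hden : (RtoC 1 - Cexp (- t))%C <> RtoC 0).
(* If [exp (- t)] were 1, the second-order bound would give [|t| <= 3 |t|^2], impossible for
   [0 < |t| < 1 / 4]. *)
{ intros E. assert (T := Cexp_opp_Taylor 2 t). fold x in T.
  simpl csum in T. rewrite sign_fact_0, sign_fact_1 in T.
  replace (Cexp (- t) - (0 + 1 * 1 + - (1) * (t * 1)))%C with (t - (RtoC 1 - Cexp (- t)))%C in T by ring.
  rewrite E, Cminus_0_r in T. fold x in T. simpl in T. nra. }
set (u := csum (fun k => bern w k * t ^ k)%C).
(* The error of replacing [exp (- t)], in its product with the [k]-th term, by its Taylor polynomial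
   with [n - k] terms. What remains is a sum over a triangle, where [bern_conv] applies on each
   diagonal and gives the exact identity [Hid]. *)
set (X := fun n => csum (fun k => bern w k * t ^ k * (Cexp (- t) - csum (fun j => sign_fact j * t ^ j) (n - k)))%C n).
assert (HX : clim X (RtoC 0)).
{ apply (clim_geom _ _ (3 * A) (/ 2)); [lra|]. intros n. rewrite Cminus_0_r. unfold X.
  apply Rle_trans with (INR n * (3 * A * (/ 4) ^ n)).
  - apply csum_Cmod_le. intros k Hk. rewrite !Cmod_mult, Cmod_pow. fold x.
    assert (E1 := bern_bound w B k (Rle_refl _)). fold G A in E1.
    assert (E2 := Cexp_opp_Taylor (n - k) t). fold x in E2.
    assert (E3 : (G * x) ^ n <= (/ 4) ^ n) by (apply pow_incr; unfold G in *; split; [nra|lra]).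
    assert (E4 : G ^ k <= G ^ n) by (apply Rle_pow; [unfold G; lra|lia]).
    assert (E5 : x ^ k * x ^ (n - k) = x ^ n) by (rewrite <- pow_add; f_equal; lia).
    assert (P1 := pow_lt x k Ht0). assert (P2 := pow_lt x (n - k) Ht0).
    assert (P3 : 0 < G ^ k) by (apply pow_lt; unfold G; lra).
    apply Rle_trans with ((A * G ^ k * x ^ k) * (3 * x ^ (n - k))).
    + apply Rmult_le_compat; [|apply Cmod_ge_0| |].
      * apply Rmult_le_pos; [apply Cmod_ge_0|lra].
      * apply Rmult_le_compat_r; [lra|exact E1].
      * eapply Rle_trans; [exact E2|]. apply Rmult_le_compat_r; lra.
    + replace (A * G ^ k * x ^ k * (3 * x ^ (n - k))) with (3 * A * (G ^ k * (x ^ k * x ^ (n - k)))) by ring.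
      rewrite E5. apply Rmult_le_compat_l; [unfold A; lra|].
      eapply Rle_trans; [|exact E3]. rewrite Rpow_mult_distr.
      apply Rmult_le_compat_r; [apply pow_le; lra|exact E4].
  - assert (E : INR n <= 2 ^ n).
    { rewrite <- pow_INR with (m := 2%nat). apply le_INR. apply Nat.lt_le_incl, Nat.pow_gt_lin_r. lia. }
    assert (E2 : (/ 4) ^ n * 2 ^ n = (/ 2) ^ n) by (rewrite <- Rpow_mult_distr; f_equal; lra).
    rewrite <- E2.
    replace (3 * A * ((/ 4) ^ n * 2 ^ n)) with (2 ^ n * (3 * A * (/ 4) ^ n)) by ring.
    apply Rmult_le_compat_r; [|exact E].
    apply Rmult_le_pos; [unfold A; lra|apply pow_le; lra]. }
assert (Hid : forall n, ((RtoC 1 - Cexp (- t)) * u n)%C =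
   (csum (fun j => sign_fact j * (w * t) ^ j) n
    + / t * (csum (fun j => sign_fact j * t ^ j) (S n) - RtoC 1) - X n)%C).
{ intros n.
  assert (E : (X n = Cexp (- t) * u n
      - csum (fun k => csum (fun j => bern w k * t ^ k * (sign_fact j * t ^ j)) (n - k)) n)%C).
  { unfold X, u. rewrite <- csum_scal, <- csum_minus. apply csum_ext. intros k _.
    rewrite csum_scal. ring. }
  rewrite (csum_triangle (fun k j => bern w k * t ^ k * (sign_fact j * t ^ j))%C) in E.
  rewrite (csum_ext _ (fun m => bern w m * t ^ m - (sign_fact m * (w * t) ^ m + sign_fact (S m) * t ^ m))%C) in E.
  - rewrite csum_minus, csum_plus in E. fold u in E.
    rewrite (csum_shift (fun j => sign_fact j * t ^ j)%C), sign_fact_0.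
    rewrite (csum_ext (fun k => sign_fact (S k) * t ^ S k)%C (fun k => t * (sign_fact (S k) * t ^ k))%C)
      by (intros; simpl; ring).
    rewrite csum_scal. rewrite E. simpl (t ^ 0)%C. field. exact Htn.
  - intros m _.
    rewrite (csum_ext _ (fun k => t ^ m * (bern w k * sign_fact (m - k)))%C).
    + rewrite csum_scal, bern_conv, Cpow_mult_l. ring.
    + intros k Hk. replace (t ^ m)%C with (t ^ k * t ^ (m - k))%C by (rewrite <- Cpow_add_r; f_equal; lia). ring. }
apply (clim_ext (fun n => / (RtoC 1 - Cexp (- t)) * ((RtoC 1 - Cexp (- t)) * u n))%C).
{ exists O. intros n _. field. exact Hden. }
replace (Cexp (- (w * t)) / (1 - Cexp (- t)) - 1 / t)%C with
  (/ (RtoC 1 - Cexp (- t)) * (Cexp (- (w * t)) + / t * (Cexp (- t) - RtoC 1) - RtoC 0))%C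
  by (field; tauto).
apply clim_scal.
apply (clim_ext (fun n => csum (fun j => sign_fact j * (w * t) ^ j) n
    + / t * (csum (fun j => sign_fact j * t ^ j) (S n) - RtoC 1) - X n)%C).
{ exists O. intros n _. symmetry. apply Hid. }
apply clim_minus; [|exact HX]. apply clim_plus.
- apply Cexp_opp_clim. rewrite Cmod_mult. exact Hwx.
- apply clim_scal, clim_minus; [|apply clim_const].
  apply clim_S. apply Cexp_opp_clim. fold x. lra.
Qed.

(** * Uniqueness of power series coefficients *)

Lemma clim_bounded (u : nat -> C) (l : C) : clim u l -> exists K, forall n, Cmod (u n) <= K.
Proof.
intros H. destruct (H 1 Rlt_0_1) as [n0 H0].
assert (F : forall m, exists K, forall n, (n < m)%nat -> Cmod (u n) <= K).
{ induction m as [|m [K HK]]; [exists 0; intros; lia|].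
  exists (Rmax K (Cmod (u m))). intros n Hn.
  destruct (Nat.eq_dec n m) as [->|Hne]; [apply Rmax_r|].
  eapply Rle_trans; [apply HK; lia|apply Rmax_l]. }
destruct (F n0) as [K HK]. exists (Rmax K (Cmod l + 1)). intros n.
destruct (Nat.lt_ge_cases n n0) as [Hn|Hn].
- eapply Rle_trans; [now apply HK|apply Rmax_l].
- eapply Rle_trans; [|apply Rmax_r]. specialize (H0 n Hn).
  assert (T := Cmod_triangle_rev (u n) l). lra.
Qed.

(** Strong induction on [k]: once the earlier coefficients vanish, [c k * t ^ k] is minus the tail
    of the series, which at [t = q x] is of order [q^(k+1)]; then [q] is made small. *)
Lemma power_series_zero (c : nat -> C) (r : R) : 0 < r ->
  (forall t, 0 < Cmod t < r -> clim (csum (fun k => c k * t ^ k)%C) (RtoC 0)) ->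
  forall k, c k = RtoC 0.
Proof.
intros Hr H.
assert (T0 : 0 < Cmod (RtoC (r / 2)) < r) by (rewrite Cmod_R, Rabs_pos_eq; lra).
destruct (clim_bounded _ _ (H _ T0)) as [K HK].
set (x := r / 2) in *. assert (Hx : 0 < x) by (unfold x; lra).
assert (HK0 : 0 <= K) by (eapply Rle_trans; [apply Cmod_ge_0|apply (HK O)]).
assert (Hc : forall k, Cmod (c k) <= 2 * K * (/ x) ^ k).
{ intros k. assert (A := HK (S k)). assert (B := HK k). simpl in A.
  set (s := csum _ k) in A, B.
  assert (T := Cmod_sub_triangle (s + c k * RtoC x ^ k) s).
  replace (s + c k * RtoC x ^ k - s)%C with (c k * RtoC x ^ k)%C in T by ring.
  rewrite Cmod_mult, Cmod_pow, Cmod_R, Rabs_pos_eq in T by lra.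
  rewrite pow_inv. apply Rmult_le_reg_r with (x ^ k); [now apply pow_lt|].
  rewrite Rmult_assoc, Rinv_l by (apply pow_nonzero; lra). lra. }
intros k. induction k as [k IH] using (well_founded_induction lt_wf).
apply Cmod_small_eq_0. intros e He.
(* The second bound makes [q * 4 K x^(-k)], the final estimate of [|c k|], at most [e]. *)
set (q := Rmin (/ 4) (e / (4 * K * (/ x) ^ k + 1))).
assert (P : 0 < 4 * K * (/ x) ^ k + 1).
{ assert (0 <= (/ x) ^ k) by (apply pow_le; left; now apply Rinv_0_lt_compat). nra. }
assert (Hq : 0 < q) by (apply Rmin_pos; [lra|now apply Rdiv_lt_0_compat]).
assert (Hq4 : q <= / 4) by apply Rmin_l.
assert (Hqe : q * (4 * K * (/ x) ^ k) <= e).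
{ assert (Q : q <= e / (4 * K * (/ x) ^ k + 1)) by apply Rmin_r.
  apply Rmult_le_compat_r with (r := 4 * K * (/ x) ^ k + 1) in Q; [|lra].
  replace (e / (4 * K * (/ x) ^ k + 1) * (4 * K * (/ x) ^ k + 1)) with e in Q by (field; lra). lra. }
set (t := RtoC (q * x)).
assert (Ct : Cmod t = q * x) by (unfold t; rewrite Cmod_R, Rabs_pos_eq; nra).
assert (Ht : 0 < Cmod t < r) by (rewrite Ct; unfold x in *; nra).
(* The factor [1 - q ^ n] makes the induction close: the next term, at most [2 K q^(k+1) q^n], fits
   into the gap because [q <= 1 / 4]. *)
assert (Tail : forall n, Cmod (csum (fun j => c j * t ^ j) (S k + n) - c k * t ^ k)%C <=
    4 * K * q ^ S k * (1 - q ^ n)).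
{ induction n as [|n IHn].
  - rewrite Nat.add_0_r. simpl csum. rewrite csum_zero.
    + replace (0 + c k * t ^ k - c k * t ^ k)%C with (RtoC 0) by ring. rewrite Cmod_0. simpl. lra.
    + intros j Hj. rewrite IH by exact Hj. ring.
  - rewrite Nat.add_succ_r.
    change (csum (fun j => c j * t ^ j)%C (S (S k + n))) with
      (csum (fun j => c j * t ^ j)%C (S k + n) + c (S (k + n)) * t ^ S (k + n))%C.
    set (s := csum _ _) in IHn |- *.
    replace (s + c (S (k + n)) * t ^ S (k + n) - c k * t ^ k)%C with
      ((s - c k * t ^ k) + c (S (k + n)) * t ^ S (k + n))%C by ring.
    eapply Rle_trans; [apply Cmod_triangle|].
    assert (E : Cmod (c (S (k + n)) * t ^ S (k + n)) <= 2 * K * (q ^ S k * q ^ n)).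
    { rewrite Cmod_mult, Cmod_pow, Ct, Rpow_mult_distr.
      assert (E := Hc (S (k + n))).
      apply Rmult_le_compat_r with (r := q ^ S (k + n) * x ^ S (k + n)) in E.
      2:{ apply Rmult_le_pos; apply pow_le; lra. }
      replace (q ^ S k * q ^ n) with (q ^ S (k + n)) by (rewrite <- pow_add; reflexivity).
      rewrite pow_inv in E.
      replace (2 * K * / x ^ S (k + n) * (q ^ S (k + n) * x ^ S (k + n))) with (2 * K * q ^ S (k + n)) in E
        by (field; apply pow_nonzero; lra). exact E. }
    eapply Rle_trans; [apply Rplus_le_compat; [exact IHn|exact E]|].
    assert (Q1 := pow_lt q (S k) Hq). assert (Q2 := pow_lt q n Hq).
    change (q ^ S n) with (q * q ^ n).
    assert (Q3 : 0 <= K * (q ^ S k * q ^ n)) by (apply Rmult_le_pos; [exact HK0|nra]). nra. }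
assert (L : Cmod (c k * t ^ k) <= 4 * K * q ^ S k).
{ apply (clim_le (fun n => - (csum (fun j => c j * t ^ j) n - c k * t ^ k))%C).
  - assert (Z : clim (fun n => - RtoC 1 * (csum (fun j => c j * t ^ j) n - c k * t ^ k))%C
      (- RtoC 1 * (RtoC 0 - c k * t ^ k))%C)
      by (apply clim_scal, clim_minus; [now apply H|apply clim_const]).
    replace (- RtoC 1 * (RtoC 0 - c k * t ^ k))%C with (c k * t ^ k)%C in Z by ring.
    revert Z. apply clim_ext. exists O. intros; ring.
  - exists (S k). intros n Hn. rewrite Cmod_opp.
    replace n with (S k + (n - S k))%nat by lia. eapply Rle_trans; [apply Tail|].
    assert (Q1 := pow_lt q (S k) Hq). assert (Q2 := pow_lt q (n - S k) Hq).
    rewrite <- (Rmult_1_r (4 * K * q ^ S k)) at 2.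
    apply Rmult_le_compat_l; [|lra]. apply Rmult_le_pos; lra. }
rewrite Cmod_mult, Cmod_pow, Ct, Rpow_mult_distr in L.
assert (Q1 := pow_lt q k Hq). assert (Q2 := pow_lt x k Hx).
apply Rmult_le_reg_r with (q ^ k * x ^ k); [nra|].
eapply Rle_trans; [exact L|].
apply Rle_trans with (q * (4 * K * (/ x) ^ k) * (q ^ k * x ^ k)).
- right. rewrite pow_inv. simpl. field. lra.
- apply Rmult_le_compat_r; [nra|exact Hqe].
Qed.

Lemma modified_bernoulli_bern (k : nat) (w : C) : modified_bernoulli k w = bern w k.
Proof.
assert (H : is_modified_bernoulli w (epsilon (inhabits (fun _ => RtoC 0)) (is_modified_bernoulli w)))
  by (apply epsilon_spec; exists (bern w); apply bern_generating).
destruct H as [r1 [Hr1 H1]]. destruct (bern_generating w) as [r2 [Hr2 H2]].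
apply Ceq_minus.
apply (power_series_zero (fun k => modified_bernoulli k w - bern w k)%C (Rmin r1 r2)).
{ now apply Rmin_pos. }
intros t Ht.
assert (A := H1 t (conj (proj1 Ht) (Rlt_le_trans _ _ _ (proj2 Ht) (Rmin_l _ _)))).
assert (B := H2 t (conj (proj1 Ht) (Rlt_le_trans _ _ _ (proj2 Ht) (Rmin_r _ _)))).
apply (proj1 (is_pseries_clim _ _ _)) in A. apply (proj1 (is_pseries_clim _ _ _)) in B.
set (L := (Cexp _ / _ - _)%C) in A, B.
replace (RtoC 0) with (L - L)%C by ring.
eapply clim_ext; [|apply clim_minus; [exact A|exact B]].
exists O. intros n _. simpl. rewrite <- csum_minus. apply csum_ext. intros j _.
unfold modified_bernoulli. ring.
Qed.

(** * Shifted partial sums of the Hurwitz zeta function *)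

Fixpoint poch (s : C) (k : nat) : C :=
  match k with O => RtoC 1 | S j => (poch s j * (s + RtoC (INR j)))%C end.

Lemma poch_S_l (s : C) (k : nat) : poch s (S k) = (s * poch (s + RtoC 1) k)%C.
Proof.
induction k as [|k IH].
- simpl. ring.
- change (poch s (S (S k))) with (poch s (S k) * (s + RtoC (INR (S k))))%C.
  rewrite IH, S_INR, RtoC_plus. simpl. ring.
Qed.

Lemma poch_add (s : C) (k j : nat) : poch s (k + j) = (poch s k * poch (s + RtoC (INR k)) j)%C.
Proof.
induction j as [|j IH].
- rewrite Nat.add_0_r. simpl. ring.
- rewrite Nat.add_succ_r. simpl. rewrite IH, plus_INR, RtoC_plus. ring.
Qed.

Lemma poch_bound (s : C) (B : R) (k : nat) : Cmod s <= B -> Cmod (poch s k) <= (B + INR k + 1) ^ k.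
Proof.
intros Hs. assert (HB := Cmod_ge_0 s). induction k as [|k IH].
- simpl. rewrite Cmod_1. lra.
- simpl poch. rewrite Cmod_mult, Rmult_comm, <- tech_pow_Rmult. assert (P := pos_INR k).
  apply Rmult_le_compat; [apply Cmod_ge_0|apply Cmod_ge_0| |].
  + eapply Rle_trans; [apply Cmod_triangle|]. rewrite Cmod_R, Rabs_pos_eq, S_INR by exact P. lra.
  + eapply Rle_trans; [exact IH|]. apply pow_incr. rewrite S_INR. lra.
Qed.

(** The terms of degree below [J] in the Taylor expansion of [(1 + v)^(-a)] at [v = 0]. *)
Definition binom_poly (a : C) (J : nat) (v : C) : C :=
  csum (fun j => sign_fact j * poch a j * v ^ j)%C J.

Lemma cderiv_binom_poly (a : C) (J : nat) (v : C) :
  cderiv (binom_poly a (S J)) v (- a * binom_poly (a + RtoC 1) J v)%C.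
Proof.
apply (cderiv_ext (fun t => sign_fact 0 * poch a 0 * RtoC 1
   + csum (fun j => sign_fact (S j) * poch a (S j) * t ^ S j) J)%C).
- intros t. unfold binom_poly. now rewrite (csum_shift (fun j => sign_fact j * poch a j * t ^ j)%C).
- eapply cderiv_eq; [|apply cderiv_plus; [apply cderiv_const|]].
  2:{ apply (cderiv_csum (fun j t => sign_fact (S j) * poch a (S j) * t ^ S j)%C).
      intros k _. apply cderiv_scal, cderiv_pow. }
  unfold binom_poly. rewrite <- csum_scal, Cplus_0_l. apply csum_ext. intros k _.
  rewrite poch_S_l. simpl Nat.pred.
  transitivity ((RtoC (INR (S k)) * sign_fact (S k)) * (a * poch (a + RtoC 1) k * v ^ k))%C; [ring|].
  rewrite sign_fact_S. ring.
Qed.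

Lemma Cpower_near_1_bound (a v : C) (B : R) : Cmod a <= B -> Cmod v <= / 2 ->
  Cmod (Cpower (RtoC 1 + v) (- a)) <= exp (B * (1 + PI)).
Proof.
intros Ha Hv. unfold Cpower.
assert (T1 := Cmod_triangle (RtoC 1) v). assert (T2 := Cmod_triangle_rev (RtoC 1) (- v)).
rewrite Cmod_opp in T2. replace (RtoC 1 - - v)%C with (RtoC 1 + v)%C in T2 by ring.
rewrite Cmod_1 in T1, T2. set (x := Cmod (RtoC 1 + v)) in *.
assert (L1 := exp_ineq1_le (ln x)). assert (L2 := exp_ineq1_le (- ln x)).
rewrite exp_Ropp, exp_ln in L2 by lra. rewrite exp_ln in L1 by lra.
assert (L3 : / x <= 2).
{ rewrite <- (Rinv_inv 2). apply Rinv_le_contravar; lra. }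
assert (L : Rabs (ln x) <= 1) by (apply Rabs_le; lra).
assert (C1 := Cmod_Clog_le (RtoC 1 + v)). fold x in C1.
eapply Rle_trans; [apply Cmod_Cexp_le|].
assert (M : Cmod (- a * Clog (RtoC 1 + v)) <= B * (1 + PI)).
{ rewrite Cmod_mult, Cmod_opp.
  apply Rmult_le_compat; [apply Cmod_ge_0|apply Cmod_ge_0|exact Ha|lra]. }
destruct M as [M| ->]; [left; now apply exp_increasing|lra].
Qed.

Lemma Re_near_1 (v : C) : Cmod v <= / 2 -> 0 < Re (RtoC 1 + v)%C.
Proof.
intros H. rewrite re_plus, re_RtoC. assert (A := re_le_Cmod v).
assert (A' := Rle_trans _ _ _ A H). apply Rabs_le_between in A'. lra.
Qed.

(** The derivative in [v] of the remainder of order [J + 1] for [a] is [- a] times the remainder of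
    order [J] for [a + 1]. Hence the induction over all [B], with [B + 1] in the hypothesis. *)
Lemma binomial_Taylor (J : nat) (B : R) : exists K, 0 <= K /\ forall a v,
  Cmod a <= B -> Cmod v <= / 2 ->
  Cmod (Cpower (RtoC 1 + v) (- a) - binom_poly a J v) <= K * Cmod v ^ J.
Proof.
revert B. induction J as [|J IH]; intros B.
- exists (exp (B * (1 + PI))). split; [left; apply exp_pos|]. intros a v Ha Hv.
  unfold binom_poly. simpl. rewrite Cminus_0_r, Rmult_1_r. now apply Cpower_near_1_bound.
- destruct (IH (B + 1)) as [K [HK H]]. exists (Rabs B * K).
  split; [apply Rmult_le_pos; [apply Rabs_pos|exact HK]|]. intros a v Ha Hv.
  set (F := fun t => (Cpower (RtoC 1 + t) (- a) - binom_poly a (S J) t)%C).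
  set (F' := fun t => (- a * (Cpower (RtoC 1 + t) (- (a + RtoC 1)) - binom_poly (a + RtoC 1) J t))%C).
  assert (D : forall t, Cmod t <= / 2 -> cderiv F t (F' t)).
  { intros t Ht. eapply cderiv_eq; [|apply cderiv_minus; [|apply cderiv_binom_poly]].
    2:{ apply (cderiv_comp (fun z => Cpower z (- a)) (fun t => RtoC 1 + t)%C).
        - apply cderiv_Cpower_base. now apply Re_near_1.
        - apply cderiv_plus; [apply cderiv_const|apply cderiv_id]. }
    unfold F'. replace (- (a + RtoC 1))%C with (- a - RtoC 1)%C by ring. ring. }
  assert (E0 : F (RtoC 0) = RtoC 0).
  { unfold F, binom_poly. rewrite Cplus_0_r, csum_shift, sign_fact_0, csum_zero.
    - unfold Cpower. rewrite Clog_R, ln_1, Cmult_0_r, Cexp_0 by lra. simpl. ring.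
    - intros k _. simpl. ring. }
  change (Cmod (F v) <= Rabs B * K * Cmod v ^ S J).
  replace (F v) with (F (RtoC 0 + v) - F (RtoC 0))%C by (rewrite E0, Cplus_0_l; ring).
  simpl pow. replace (Rabs B * K * (Cmod v * Cmod v ^ J)) with (Rabs B * (K * Cmod v ^ J) * Cmod v) by ring.
  apply (cderiv_mean_value F F'). intros x Hx.
  assert (Hle : Cmod (RtoC 0 + RtoC x * v) <= Cmod v).
  { rewrite Cplus_0_l, Cmod_mult, Cmod_R, Rabs_pos_eq by lra. assert (P := Cmod_ge_0 v). nra. }
  split; [apply D; lra|].
  unfold F'. rewrite Cmod_mult, Cmod_opp.
  apply Rmult_le_compat; [apply Cmod_ge_0|apply Cmod_ge_0| |].
  + eapply Rle_trans; [exact Ha|apply Rle_abs].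
  + eapply Rle_trans; [apply H|].
    * eapply Rle_trans; [apply Cmod_triangle|]. rewrite Cmod_1. lra.
    * lra.
    * apply Rmult_le_compat_l; [exact HK|]. apply pow_incr. split; [apply Cmod_ge_0|exact Hle].
Qed.

(** One constant for all orders up to [L]: in [em_step] the [k]-th Bernoulli term is expanded to
    order [L - k]. *)
Lemma binomial_Taylor_uniform (L : nat) (B : R) : exists K, 0 <= K /\ forall J a v, (J <= L)%nat ->
  Cmod a <= B -> Cmod v <= / 2 ->
  Cmod (Cpower (RtoC 1 + v) (- a) - binom_poly a J v) <= K * Cmod v ^ J.
Proof.
induction L as [|L [K [HK H]]].
- destruct (binomial_Taylor 0 B) as [K [HK H]]. exists K. split; [exact HK|].
  intros J a v HJ. replace J with O by lia. apply H.
- destruct (binomial_Taylor (S L) B) as [K' [HK' H']]. exists (K + K'). split; [lra|].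
  intros J a v HJ Ha Hv. assert (P := pow_le _ J (Cmod_ge_0 v)).
  destruct (Nat.eq_dec J (S L)) as [->|Hn].
  + specialize (H' a v Ha Hv). nra.
  + specialize (H J a v ltac:(lia) Ha Hv). nra.
Qed.

Lemma Cpower_opp_nat (x : C) (k : nat) : x <> RtoC 0 -> Cpower x (- RtoC (INR k)) = ((/ x) ^ k)%C.
Proof.
intros Hx. unfold Cpower.
replace (- RtoC (INR k) * Clog x)%C with (- (RtoC (INR k) * Clog x))%C by ring.
rewrite Cexp_opp. fold (Cpower x (RtoC (INR k))). now rewrite Cpower_nat, Cpow_inv.
Qed.

(* Euler-Maclaurin correction terms: [s - 1] times the formal sum over [k >= N] of
   [(k + w) ^ (- s)], truncated after [L] Bernoulli terms. *)
Definition em_tail (L : nat) (s w : C) (N : nat) : C :=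
  (Cpower (RtoC (INR N)) (- (s - RtoC 1))
   + (s - RtoC 1) * csum (fun k => bern w k * poch s k * Cpower (RtoC (INR N)) (- (s + RtoC (INR k)))) L)%C.

Definition em_sum (L : nat) (s w : C) (N : nat) : C :=
  ((s - RtoC 1) * csum (fun k => Cpower (RtoC (INR k) + w) (- s)) N + em_tail L s w N)%C.

(** The algebraic core of Euler-Maclaurin: with every power of [1 + w / x] and [1 + 1 / x] replaced
    by its Taylor polynomial, the increment of [em_sum], divided by [x^(-s)], vanishes. Collecting
    [poch s m * (1 / x)^m] over diagonals leaves the Bernoulli recurrence. *)
Lemma em_identity (L : nat) (s w x : C) : x <> RtoC 0 ->
  ((s - RtoC 1) * binom_poly s L (w * / x) + x * (binom_poly (s - RtoC 1) (S L) (/ x) - RtoC 1)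
   + (s - RtoC 1) * csum (fun k => bern w k * poch s k * (/ x) ^ k *
        (binom_poly (s + RtoC (INR k)) (L - k) (/ x) - RtoC 1)) L)%C = RtoC 0.
Proof.
intros Hx. set (u := (/ x)%C).
assert (A : (x * (binom_poly (s - RtoC 1) (S L) u - RtoC 1)
   = (s - RtoC 1) * csum (fun m => sign_fact (S m) * poch s m * u ^ m) L)%C).
{ unfold binom_poly. rewrite csum_shift, sign_fact_0.
  rewrite (csum_ext _ (fun k => u * ((s - RtoC 1) * (sign_fact (S k) * poch s k * u ^ k)))%C).
  - rewrite !csum_scal. simpl (poch _ 0). simpl (u ^ 0)%C. unfold u. field. exact Hx.
  - intros k _. rewrite poch_S_l. replace (s - RtoC 1 + RtoC 1)%C with s by ring. simpl. ring. }
assert (B : csum (fun k => bern w k * poch s k * u ^ k *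
        (binom_poly (s + RtoC (INR k)) (L - k) u - RtoC 1))%C L =
   csum (fun m => - (sign_fact m * poch s m * (w * u) ^ m) - sign_fact (S m) * poch s m * u ^ m)%C L).
{ rewrite (csum_ext _ (fun k => csum (fun j => bern w k * poch s k * u ^ k *
       (sign_fact j * poch (s + RtoC (INR k)) j * u ^ j)) (L - k) - bern w k * poch s k * u ^ k)%C).
  - rewrite csum_minus.
    rewrite (csum_triangle (fun k j => bern w k * poch s k * u ^ k *
       (sign_fact j * poch (s + RtoC (INR k)) j * u ^ j))%C), <- csum_minus.
    apply csum_ext. intros m _.
    rewrite (csum_ext _ (fun k => poch s m * u ^ m * (bern w k * sign_fact (m - k)))%C).
    + rewrite csum_scal, bern_conv, Cpow_mult_l. ring.
    + intros k Hk.
      replace (u ^ m)%C with (u ^ k * u ^ (m - k))%C by (rewrite <- Cpow_add_r; f_equal; lia).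
      replace (poch s m) with (poch s k * poch (s + RtoC (INR k)) (m - k))%C
        by (rewrite <- poch_add; f_equal; lia). ring.
  - intros k _. rewrite csum_scal. unfold binom_poly. ring. }
rewrite A, B. unfold binom_poly at 1. rewrite <- Cmult_plus_distr_l, <- csum_plus, <- Cmult_plus_distr_l, <- csum_plus.
rewrite csum_zero; [ring|]. intros k _. ring.
Qed.

Lemma em_step (L : nat) (B : R) : 0 <= B -> exists K n0, 0 <= K /\ (1 <= n0)%nat /\
  forall N s w, (n0 <= N)%nat -> Cmod s <= B -> Cmod w <= B ->
    Cmod (em_sum L s w (S N) - em_sum L s w N) <= K * (exp (- Re s * ln (INR N)) * (/ INR N) ^ L).
Proof.
intros HB.
destruct (binomial_Taylor_uniform (S L) (B + INR L + 1)) as [K [HK HT]].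
set (b := 2 * (B + 5) * (B + 4) ^ L). set (p := (B + INR L + 1) ^ L).
assert (HL := pos_INR L).
assert (Hb : 0 <= b) by (apply Rmult_le_pos; [lra|apply pow_le; lra]).
assert (Hp : 0 <= p) by (apply pow_le; lra).
assert (HBL : 0 <= B ^ L) by now apply pow_le.
(* Beyond this index both [1 / N] and [|w| / N] are at most 1/2, as the binomial expansions
   require. *)
destruct (INR_unbounded (2 * (B + 1))) as [m Hm].
(* The three summands come from the new term of the partial sum, the boundary term and the Bernoulli
   terms. The boundary term has an extra factor [N], so it is expanded one order further. *)
exists ((B + 1) * (K * B ^ L) + K + (B + 1) * (INR L * (b * p * K))), (S m).
split.
{ assert (H1 : 0 <= (B + 1) * (K * B ^ L)) by (apply Rmult_le_pos; [lra|now apply Rmult_le_pos]).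
  assert (H2 : 0 <= b * p * K) by (apply Rmult_le_pos; [now apply Rmult_le_pos|exact HK]).
  assert (H3 : 0 <= (B + 1) * (INR L * (b * p * K)))
    by (apply Rmult_le_pos; [lra|now apply Rmult_le_pos]). lra. }
split; [lia|]. intros N s w HN Hs Hw.
assert (HNm : INR m <= INR N) by (apply le_INR; lia).
set (y := INR N) in *. assert (Hy : 2 < y) by lra.
set (x := RtoC y). assert (Hx : x <> RtoC 0) by (intros E; apply RtoC_inj in E; lra).
set (u := (/ x)%C).
assert (Hu : Cmod u = / y) by (unfold u, x; rewrite Cmod_inv, Cmod_R, Rabs_pos_eq by (try exact Hx; lra); reflexivity).
assert (Hyi : 0 < / y) by (apply Rinv_0_lt_compat; lra).
assert (Hu2 : Cmod u <= / 2) by (rewrite Hu; apply Rinv_le_contravar; lra).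
assert (Hwu : Cmod (w * u) <= B * / y).
{ rewrite Cmod_mult, Hu. apply Rmult_le_compat_r; lra. }
assert (HBy : B * / y <= / 2).
{ apply Rmult_le_reg_r with y; [lra|]. rewrite Rmult_assoc, Rinv_l by lra. lra. }
assert (N1u : (RtoC 1 + u)%C <> RtoC 0) by (apply Re_pos_neq_0, Re_near_1; exact Hu2).
assert (N1wu : (RtoC 1 + w * u)%C <> RtoC 0) by (apply Re_pos_neq_0, Re_near_1; lra).
set (P := Cpower x (- s)).
assert (HP : Cmod P = exp (- Re s * ln y)).
{ unfold P, x. rewrite Cmod_Cpower_R, re_opp by lra. reflexivity. }
assert (EN : RtoC (INR (S N)) = (x * (RtoC 1 + u))%C).
{ rewrite S_INR, RtoC_plus. fold y x. unfold u. field. exact Hx. }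
assert (Ew : (x + w = x * (RtoC 1 + w * u))%C) by (unfold u; field; exact Hx).
assert (E1 : Cpower x (- (s - RtoC 1)) = (P * x)%C).
{ replace (- (s - RtoC 1))%C with (- s + RtoC (INR 1))%C by (simpl; ring).
  rewrite Cpower_plus, Cpower_nat by exact Hx. simpl. unfold P. ring. }
assert (Ek : forall k, Cpower x (- (s + RtoC (INR k))) = (P * u ^ k)%C).
{ intros k. replace (- (s + RtoC (INR k)))%C with (- s + - RtoC (INR k))%C by ring.
  now rewrite Cpower_plus, Cpower_opp_nat by exact Hx. }
assert (Sc : forall z a, z <> RtoC 0 -> Cpower (x * z) a = (Cpower x a * Cpower z a)%C)
  by (intros z a Hz; apply Cpower_scal; [lra|exact Hz]).
(* After [N^(-s)] is factored out, subtracting [em_identity] leaves Taylor remainders only. *)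
assert (E : (em_sum L s w (S N) - em_sum L s w N)%C =
  (P * ((s - RtoC 1) * (Cpower (RtoC 1 + w * u) (- s) - binom_poly s L (w * u))
   + x * (Cpower (RtoC 1 + u) (- (s - RtoC 1)) - binom_poly (s - RtoC 1) (S L) u)
   + (s - RtoC 1) * csum (fun k => bern w k * poch s k * u ^ k *
        (Cpower (RtoC 1 + u) (- (s + RtoC (INR k))) - binom_poly (s + RtoC (INR k)) (L - k) u)) L))%C).
{ unfold em_sum, em_tail. rewrite EN. simpl (csum _ (S N)). fold y x. rewrite Ew.
  rewrite !Sc by assumption. fold P. rewrite E1.
  assert (I := em_identity L s w x Hx). fold u in I.
  rewrite (csum_ext (fun k => bern w k * poch s k * Cpower x (- (s + RtoC (INR k))))%C
     (fun k => P * (bern w k * poch s k * u ^ k))%C) by (intros k _; rewrite Ek; ring).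
  rewrite (csum_ext (fun k => bern w k * poch s k * Cpower (x * (RtoC 1 + u)) (- (s + RtoC (INR k))))%C
     (fun k => P * (bern w k * poch s k * u ^ k * Cpower (RtoC 1 + u) (- (s + RtoC (INR k)))))%C)
    by (intros k _; rewrite Sc by assumption; rewrite Ek; ring).
  rewrite !csum_scal.
  rewrite (csum_ext (fun k => bern w k * poch s k * u ^ k *
        (Cpower (RtoC 1 + u) (- (s + RtoC (INR k))) - binom_poly (s + RtoC (INR k)) (L - k) u))%C
     (fun k => bern w k * poch s k * u ^ k * Cpower (RtoC 1 + u) (- (s + RtoC (INR k)))
        - bern w k * poch s k * u ^ k
        - bern w k * poch s k * u ^ k * (binom_poly (s + RtoC (INR k)) (L - k) u - RtoC 1))%C)
    by (intros k _; ring).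
  rewrite !csum_minus.
  set (c1 := csum _ _) in I |- *. set (c2 := csum (fun k => bern w k * poch s k * u ^ k)%C L).
  set (c3 := csum (fun k => bern w k * poch s k * u ^ k * Cpower (RtoC 1 + u) (- (s + RtoC (INR k))))%C L).
  set (T0 := binom_poly s L (w * u)) in *. set (T1 := binom_poly (s - RtoC 1) (S L) u) in *.
  set (H1 := csum _ N).
  transitivity (P * ((s - RtoC 1) * Cpower (RtoC 1 + w * u) (- s) + x * (Cpower (RtoC 1 + u) (- (s - RtoC 1)) - RtoC 1)
    + (s - RtoC 1) * (c3 - c2) - ((s - RtoC 1) * T0 + x * (T1 - RtoC 1) + (s - RtoC 1) * c1)))%C.
  - rewrite I. ring.
  - ring. }
rewrite E, Cmod_mult, HP.
assert (Hs1 : Cmod (s - RtoC 1) <= B + 1).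
{ eapply Rle_trans; [apply Cmod_sub_triangle|]. rewrite Cmod_1. lra. }
replace (((B + 1) * (K * B ^ L) + K + (B + 1) * (INR L * (b * p * K))) *
   (exp (- Re s * ln y) * (/ y) ^ L)) with
  (exp (- Re s * ln y) * ((B + 1) * (K * (B * / y) ^ L) + y * (K * (/ y) ^ S L)
     + (B + 1) * (INR L * (b * p * K * (/ y) ^ L)))).
2:{ rewrite Rpow_mult_distr. simpl. field. lra. }
apply Rmult_le_compat_l; [left; apply exp_pos|].
eapply Rle_trans; [apply Cmod_triangle|]. apply Rplus_le_compat.
- eapply Rle_trans; [apply Cmod_triangle|]. apply Rplus_le_compat; rewrite Cmod_mult.
  + apply Rmult_le_compat; [apply Cmod_ge_0|apply Cmod_ge_0|exact Hs1|].
    eapply Rle_trans; [apply HT; [lia|lra|lra]|].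
    apply Rmult_le_compat_l; [exact HK|]. apply pow_incr. split; [apply Cmod_ge_0|exact Hwu].
  + unfold x at 1. rewrite Cmod_R, Rabs_pos_eq by lra.
    apply Rmult_le_compat_l; [lra|]. rewrite <- Hu. apply HT; [lia|lra|exact Hu2].
- rewrite Cmod_mult. apply Rmult_le_compat; [apply Cmod_ge_0|apply Cmod_ge_0|exact Hs1|].
  apply csum_Cmod_le. intros k Hk. rewrite !Cmod_mult, Cmod_pow, Hu.
  assert (HkL : INR k <= INR L) by (apply le_INR; lia). assert (Hk0 := pos_INR k).
  assert (B1 : Cmod (bern w k) <= b).
  { eapply Rle_trans; [apply (bern_bound w B k Hw)|]. unfold b. apply Rmult_le_compat_l; [lra|].
    apply Rle_pow; [lra|lia]. }
  assert (B2 : Cmod (poch s k) <= p).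
  { eapply Rle_trans; [apply (poch_bound s B k Hs)|]. unfold p.
    apply Rle_trans with ((B + INR L + 1) ^ k); [apply pow_incr; lra|apply Rle_pow; [lra|lia]]. }
  assert (B3 : Cmod (Cpower (RtoC 1 + u) (- (s + RtoC (INR k))) - binom_poly (s + RtoC (INR k)) (L - k) u)
     <= K * (/ y) ^ (L - k)).
  { rewrite <- Hu. apply HT; [lia| |exact Hu2].
    eapply Rle_trans; [apply Cmod_triangle|]. rewrite Cmod_R, Rabs_pos_eq by lra. lra. }
  replace (b * p * K * (/ y) ^ L) with ((b * p * (/ y) ^ k) * (K * (/ y) ^ (L - k))).
  2:{ replace L with (k + (L - k))%nat at 2 by lia. rewrite pow_add. ring. }
  assert (Q := pow_lt _ k Hyi).
  apply Rmult_le_compat; [|apply Cmod_ge_0| |exact B3].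
  + repeat apply Rmult_le_pos; try apply Cmod_ge_0. lra.
  + apply Rmult_le_compat_r; [lra|]. apply Rmult_le_compat; try apply Cmod_ge_0; assumption.
Qed.

(** Two of the [P + 2] powers of [1 / N] make the increments summable; the other [P] give the rate
    of convergence. *)
Lemma em_step_sharp (L P : nat) (B : R) : 0 <= B -> exists K n0, 0 <= K /\ (1 <= n0)%nat /\
  forall N s w, (n0 <= N)%nat -> Cmod s <= B -> Cmod w <= B -> INR P + 2 - INR L <= Re s ->
    Cmod (em_sum L s w (S N) - em_sum L s w N) <= K * (/ INR N) ^ P / (INR N * INR N).
Proof.
intros HB. destruct (em_step L B HB) as [K [n0 [HK [Hn0 H]]]].
exists K, n0. split; [exact HK|]. split; [exact Hn0|]. intros N s w HN Hs Hw Hre.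
eapply Rle_trans; [now apply H|]. unfold Rdiv. rewrite Rmult_assoc.
apply Rmult_le_compat_l; [exact HK|].
assert (Hy : 1 <= INR N) by (change 1 with (INR 1); apply le_INR; lia).
set (y := INR N) in *.
assert (Hl : 0 <= ln y) by (rewrite <- ln_1; apply ln_le; lra).
assert (E : forall k, exp (INR k * ln y) = y ^ k).
{ intros k. rewrite <- Rpower_pow by lra. reflexivity. }
assert (Q := pow_lt y L ltac:(lra)). assert (Q' := pow_lt y P ltac:(lra)).
apply Rle_trans with (exp ((INR L - (INR P + 2)) * ln y) * (/ y) ^ L).
- apply Rmult_le_compat_r; [apply pow_le; left; apply Rinv_0_lt_compat; lra|].
  assert (M : - Re s * ln y <= (INR L - (INR P + 2)) * ln y) by (apply Rmult_le_compat_r; lra).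
  destruct M as [M|M]; [left; now apply exp_increasing|rewrite M; lra].
- right. replace ((INR L - (INR P + 2)) * ln y) with (INR L * ln y + - (INR (P + 2) * ln y))
    by (rewrite plus_INR; simpl (INR 2); ring).
  rewrite exp_plus, exp_Ropp, !E, !pow_inv, pow_add. simpl. field. lra.
Qed.

Lemma Cpower_null (a : C) : 0 < Re a -> clim (fun N => Cpower (RtoC (INR N)) (- a)) (RtoC 0).
Proof.
intros Ha e He. destruct (INR_unbounded (exp (- ln e / Re a))) as [n0 H0].
exists (S n0). intros n Hn. rewrite Cminus_0_r.
assert (Hn1 : INR n0 <= INR n) by (apply le_INR; lia).
assert (P := exp_pos (- ln e / Re a)).
rewrite Cmod_Cpower_R, re_opp by lra. rewrite <- (exp_ln e) by exact He.
apply exp_increasing.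
assert (L : - ln e / Re a < ln (INR n)).
{ rewrite <- (ln_exp (- ln e / Re a)). apply ln_increasing; lra. }
apply Rmult_lt_compat_l with (r := Re a) in L; [|exact Ha].
replace (Re a * (- ln e / Re a)) with (- ln e) in L by (field; lra). lra.
Qed.

Lemma em_sum_S_L (L : nat) (s w : C) (N : nat) : em_sum (S L) s w N =
  (em_sum L s w N + (s - RtoC 1) * (bern w L * poch s L) * Cpower (RtoC (INR N)) (- (s + RtoC (INR L))))%C.
Proof. unfold em_sum, em_tail. simpl csum. ring. Qed.

Lemma ex_cderiv_poch (s : C) (k : nat) : exists l, cderiv (fun t => poch t k) s l.
Proof.
induction k as [|k [l IH]].
- eexists. exact (cderiv_const (RtoC 1) s).
- eexists. apply (cderiv_mult (fun t => poch t k) (fun t => t + RtoC (INR k))%C); [exact IH|].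
  apply cderiv_plus; [apply cderiv_id|apply cderiv_const].
Qed.

Lemma cderiv_Cpower_shift (z c s : C) :
  cderiv (fun t => Cpower z (- (t + c))) s (- Clog z * Cpower z (- (s + c)))%C.
Proof.
eapply cderiv_eq; [|apply (cderiv_comp (fun t => Cpower z (- t)) (fun t => t + c)%C)].
2: apply cderiv_Cpower_exponent.
2: apply cderiv_plus; [apply cderiv_id|apply cderiv_const].
simpl. ring.
Qed.

Lemma ex_cderiv_em_sum (L : nat) (w : C) (N : nat) (s : C) :
  exists l, cderiv (fun t => em_sum L t w N) s l.
Proof.
unfold em_sum, em_tail.
destruct (ex_cderiv_csum (fun k t => Cpower (RtoC (INR k) + w) (- t)) s N) as [l1 H1].
{ intros k _. eexists. apply cderiv_Cpower_exponent. }
destruct (ex_cderiv_csum (fun k t => bern w k * poch t k * Cpower (RtoC (INR N)) (- (t + RtoC (INR k))))%C s L)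
  as [l2 H2].
{ intros k _. destruct (ex_cderiv_poch s k) as [l Hl]. eexists.
  apply cderiv_mult; [|apply cderiv_Cpower_shift]. apply cderiv_scal, Hl. }
assert (D : cderiv (fun t => t - RtoC 1)%C s (RtoC 1 - RtoC 0)%C)
  by (apply cderiv_minus; [apply cderiv_id|apply cderiv_const]).
eexists. apply cderiv_plus.
- apply cderiv_mult; [exact D|exact H1].
- apply cderiv_plus.
  + apply (cderiv_Cpower_shift (RtoC (INR N)) (- RtoC 1)).
  + apply cderiv_mult; [exact D|exact H2].
Qed.

(** * Continuation of the Hurwitz zeta function *)

(** This is [(s - 1) zeta_H(s, w)]. No single [L] serves the whole plane, so the limit is taken for
    some [L] valid at [s]; [zeta_entire_lim] shows that every valid [L] gives the same value. *)
Definition zeta_entire (w s : C) : C :=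
  epsilon (inhabits (RtoC 0))
    (fun l => exists L, 2 - INR L <= Re s /\ clim (em_sum L s w) l).

Lemma em_sum_cvg (L : nat) (s w : C) : 2 - INR L <= Re s -> exists l, clim (em_sum L s w) l.
Proof.
intros H. set (B := Cmod s + Cmod w).
assert (Hs := Cmod_ge_0 s). assert (Hw := Cmod_ge_0 w).
destruct (em_step_sharp L 0 B) as [K [n0 [HK [Hn0 Hstep]]]]; [unfold B; lra|].
destruct (telescoping_cvg (em_sum L s w) K n0 HK Hn0) as [l [Hl _]].
- intros k Hk. eapply Rle_trans; [apply Hstep; try assumption; unfold B; simpl; lra|].
  simpl. rewrite Rmult_1_r. lra.
- now exists l.
Qed.

Lemma em_sum_clim_S (L : nat) (s w l : C) : 2 - INR L <= Re s ->
  clim (em_sum L s w) l -> clim (em_sum (S L) s w) l.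
Proof.
intros H Hl. rewrite <- (Cplus_0_r l).
apply (clim_ext (fun N => em_sum L s w N + (s - RtoC 1) * (bern w L * poch s L) * Cpower (RtoC (INR N)) (- (s + RtoC (INR L))))%C).
{ exists O. intros. symmetry. apply em_sum_S_L. }
apply clim_plus; [exact Hl|].
rewrite <- (Cmult_0_r ((s - RtoC 1) * (bern w L * poch s L))).
apply clim_scal, Cpower_null. rewrite re_plus, re_RtoC. lra.
Qed.

Lemma zeta_entire_lim (L : nat) (s w : C) : 2 - INR L <= Re s ->
  clim (em_sum L s w) (zeta_entire w s).
Proof.
intros H.
assert (Q : exists L, 2 - INR L <= Re s /\ clim (em_sum L s w) (zeta_entire w s)).
{ unfold zeta_entire. apply epsilon_spec. destruct (em_sum_cvg L s w H) as [l Hl]. now exists l, L. }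
destruct Q as [L' [H' Hl']]. destruct (em_sum_cvg L s w H) as [l Hl].
assert (M : forall M L l, 2 - INR L <= Re s -> clim (em_sum L s w) l -> clim (em_sum (M + L) s w) l).
{ clear. induction M as [|M IH]; intros L l H Hl; [exact Hl|]. simpl. apply em_sum_clim_S.
  - rewrite plus_INR. assert (P := pos_INR M). lra.
  - now apply IH. }
replace (zeta_entire w s) with l; [exact Hl|].
apply (clim_unique (em_sum (L + L') s w)).
- rewrite Nat.add_comm. now apply M.
- now apply M.
Qed.

Lemma ex_cderiv_zeta_entire (w s : C) : exists l, cderiv (zeta_entire w) s l.
Proof.
(* With this [L] the whole disc of radius 1 about [s] lies in the half-plane of convergence. *)
destruct (INR_unbounded (3 - Re s)) as [L HL].
assert (Hs := Cmod_ge_0 s). assert (Hw := Cmod_ge_0 w).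
destruct (em_step_sharp L 0 (Cmod s + 1 + Cmod w)) as [K [n0 [HK [Hn0 Hstep]]]]; [lra|].
assert (Hre : forall z, Cmod (z - s) < 1 -> 2 - INR L <= Re z /\ Cmod z <= Cmod s + 1 + Cmod w).
{ intros z Hz. assert (A := re_le_Cmod (z - s)). rewrite re_minus in A.
  assert (A' := Rle_lt_trans _ _ _ A Hz). apply Rabs_lt_between in A'. split; [lra|].
  assert (T := Cmod_triangle_rev z s). lra. }
destruct (Weierstrass (fun N z => em_sum L z w N) (zeta_entire w)
  (fun N => deriv_at (fun z => em_sum L z w N) s) s 1 K n0) as [l [Hl _]]; try assumption; try lra.
- intros n _. split.
  + intros z _. apply ex_cderiv_em_sum.
  + apply deriv_at_spec, ex_cderiv_em_sum.
- intros n z Hn Hz. destruct (Hre z Hz) as [H1 H2].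
  eapply Rle_trans; [apply Hstep; try assumption; simpl; lra|]. simpl. rewrite Rmult_1_r. lra.
- intros z Hz. apply (zeta_entire_lim L). apply Hre, Hz.
- now exists l.
Qed.

Definition zeta_cont (w s : C) : C := (zeta_entire w s * / (s - RtoC 1))%C.

Lemma zeta_cont_continuation (w : C) (u : C -> nat -> C) :
  (forall s k, u s k = Cpower (RtoC (INR k) + w) (- s)) ->
  is_zeta_continuation u (zeta_cont w).
Proof.
intros Hu. split; [|split].
- intros s Hs. apply ex_derive_cderiv. destruct (ex_cderiv_zeta_entire w s) as [l Hl].
  eexists. apply cderiv_mult; [exact Hl|].
  apply (cderiv_comp Cinv (fun t => t - RtoC 1)%C).
  + apply cderiv_inv. now apply Cminus_eq_contra.
  + apply cderiv_minus; [apply cderiv_id|apply cderiv_const].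
- exists 1%nat, (zeta_entire w (RtoC 1)). intros P HP.
  apply (proj1 (C_locally_iff _ P)) in HP. destruct HP as [d [Hd HP]].
  destruct (ex_cderiv_zeta_entire w (RtoC 1)) as [l Hl].
  destruct (cderiv_cont _ _ _ Hl d Hd) as [d' [Hd' Hc]].
  apply (proj2 (C_locally_iff (RtoC 1) _)). exists d'. split; [exact Hd'|].
  intros h Hh Hne. unfold zeta_cont.
  assert (Hn : h <> RtoC 0) by (intros ->; apply Hne, Cplus_0_r).
  replace ((RtoC 1 + h - RtoC 1) ^ 1 * (zeta_entire w (RtoC 1 + h) * / (RtoC 1 + h - RtoC 1)))%C
    with (zeta_entire w (RtoC 1) + (zeta_entire w (RtoC 1 + h) - zeta_entire w (RtoC 1)))%C.
  + apply HP, Hc, Hh.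
  + replace (RtoC 1 + h - RtoC 1)%C with h by ring. simpl (h ^ 1)%C. field. exact Hn.
- intros s Hs. apply is_series_clim.
  assert (Hs1 : (s - RtoC 1)%C <> RtoC 0).
  { apply Cminus_eq_contra. intros ->. simpl in Hs. lra. }
  (* For [Re s > 1] the choice [L = 1] is valid and [em_tail] tends to 0, so the plain partial sums
     have the same limit. *)
  apply (clim_ext (fun N => / (s - RtoC 1) * (em_sum 1 s w N - em_tail 1 s w N))%C).
  { exists O. intros N _. unfold em_sum.
    rewrite (csum_ext (u s) (fun k => Cpower (RtoC (INR k) + w) (- s))) by (intros; apply Hu).
    field. exact Hs1. }
  unfold zeta_cont.
  replace (zeta_entire w s * / (s - RtoC 1))%C with (/ (s - RtoC 1) * (zeta_entire w s - (RtoC 0 + (s - RtoC 1) * (bern w 0 * poch s 0) * RtoC 0)))%C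
    by (rewrite Cmult_0_r, Cplus_0_l, Cminus_0_r; apply Cmult_comm).
  apply clim_scal, clim_minus; [apply zeta_entire_lim; simpl; lra|].
  apply (clim_ext (fun N => Cpower (RtoC (INR N)) (- (s - RtoC 1)) +
    (s - RtoC 1) * (bern w 0 * poch s 0) * Cpower (RtoC (INR N)) (- (s + RtoC (INR 0))))%C).
  { exists O. intros N _. unfold em_tail. cbn [csum poch INR]. ring. }
  apply clim_plus; [|apply clim_scal]; apply Cpower_null.
  + rewrite re_minus, re_RtoC. lra.
  + rewrite re_plus, re_RtoC. simpl. lra.
Qed.

Lemma zeta_continuation_unique (u : C -> nat -> C) (Z1 Z2 : C -> C) :
  is_zeta_continuation u Z1 -> is_zeta_continuation u Z2 ->
  forall s, s <> RtoC 1 -> Z1 s = Z2 s.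
Proof.
intros [H1 [_ S1]] [H2 [_ S2]] s Hs. apply Ceq_minus.
apply (vanishing_off_1 (fun s => Z1 s - Z2 s)%C); [| |exact Hs].
- intros t Ht. destruct (proj1 (ex_derive_cderiv _ _) (H1 t Ht)) as [l Hl].
  destruct (proj1 (ex_derive_cderiv _ _) (H2 t Ht)) as [m Hm].
  exists (l - m)%C. now apply cderiv_minus.
- intros t Ht. apply (proj1 (Ceq_minus (Z1 t) (Z2 t))).
  apply (clim_unique (csum (u t))); apply is_series_clim; [now apply S1|now apply S2].
Qed.

Lemma zeta_continuation_eq (w : C) (u : C -> nat -> C) (s : C) :
  (forall s k, u s k = Cpower (RtoC (INR k) + w) (- s)) -> s <> RtoC 1 ->
  zeta_continuation u s = zeta_cont w s.
Proof.
intros Hu Hs. apply (zeta_continuation_unique u); [|now apply zeta_cont_continuation|exact Hs].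
unfold zeta_continuation. apply epsilon_spec. exists (zeta_cont w). now apply zeta_cont_continuation.
Qed.

Lemma hurwitz_zeta_cont (s w : C) : s <> RtoC 1 -> hurwitz_zeta s w = zeta_cont w s.
Proof. intros Hs. unfold hurwitz_zeta. now apply zeta_continuation_eq. Qed.

Lemma riemann_zeta_cont (s : C) : s <> RtoC 1 -> riemann_zeta s = zeta_cont (RtoC 1) s.
Proof.
intros Hs. apply zeta_continuation_eq; [|exact Hs].
intros t k. now rewrite S_INR, RtoC_plus.
Qed.

(** The value of a continuation at 1 is unspecified, but a point other than 1 has a neighbourhood
    avoiding it. *)
Lemma C_derive_off_1 (f g : C -> C) (s l : C) :
  (forall z, z <> RtoC 1 -> f z = g z) -> s <> RtoC 1 -> cderiv g s l -> C_derive f s = l.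
Proof.
intros E Hs H. apply is_C_derive_unique, cderiv_is_derive. revert H. apply cderiv_ext_loc.
exists (Cmod (s - RtoC 1)). split; [now apply Cmod_gt_0, Cminus_eq_contra|].
intros h Hh. symmetry. apply E. intros E1.
assert (s - RtoC 1 = - h)%C by (rewrite <- E1; ring).
rewrite H, Cmod_opp in Hh. lra.
Qed.

(** * The derivative of the Hurwitz zeta function at [- n] *)

Lemma Cpower_IZR (x : R) (z : Z) : 0 < x -> Cpower (RtoC x) (RtoC (IZR z)) = RtoC (powerRZ x z).
Proof.
intros Hx. unfold Cpower. rewrite Clog_R, <- RtoC_mult, Cexp_R by exact Hx.
f_equal. rewrite powerRZ_Rpower by exact Hx. reflexivity.
Qed.

Fixpoint dpoch (s : C) (k : nat) : C :=
  match k with O => RtoC 0 | S j => (dpoch s j * (s + RtoC (INR j)) + poch s j)%C end.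

Lemma cderiv_poch (s : C) (k : nat) : cderiv (fun t => poch t k) s (dpoch s k).
Proof.
induction k as [|k IH].
- exact (cderiv_const (RtoC 1) s).
- eapply cderiv_eq; [|apply (cderiv_mult (fun t => poch t k) (fun t => t + RtoC (INR k))%C); [exact IH|]].
  2: apply cderiv_plus; [apply cderiv_id|apply cderiv_const].
  simpl. ring.
Qed.

(** The derivative at [s = - n] of [N^(1-s) / (s - 1)] plus the Bernoulli terms. The first two
    summands come from the former, where [s - 1 = - (n + 1)]. *)
Definition em_asym (L n : nat) (w : C) (N : nat) : C :=
  (RtoC (INR N ^ S n * ln (INR N) / INR (S n)) - RtoC (INR N ^ S n / (INR (S n) * INR (S n)))
   + csum (fun k => bern w k * (dpoch (- RtoC (INR n)) k - poch (- RtoC (INR n)) k * RtoC (ln (INR N)))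
       * RtoC (powerRZ (INR N) (Z.of_nat n - Z.of_nat k))) L)%C.

Definition em_deriv (L n : nat) (w : C) (N : nat) : C :=
  (em_asym L n w N
   - csum (fun k => (RtoC (INR k) + w) ^ n * Clog (RtoC (INR k) + w)) N)%C.

Lemma Re_shift_pos (k : nat) (w : C) : 0 < Re w -> 0 < Re (RtoC (INR k) + w)%C.
Proof. intros H. rewrite re_plus, re_RtoC. assert (P := pos_INR k). lra. Qed.

Lemma near_opp_nat (n : nat) (s : C) : Cmod (s - - RtoC (INR n)) < 1 / 2 ->
  / 2 <= Cmod (s - RtoC 1) /\ Cmod s <= INR n + 1 /\ - INR n - 1 <= Re s.
Proof.
intros H. assert (Hn := pos_INR n).
assert (A := re_le_Cmod (s - - RtoC (INR n))). rewrite re_minus, re_opp, re_RtoC in A.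
assert (A' := Rle_lt_trans _ _ _ A H). apply Rabs_lt_between in A'.
assert (T := Cmod_triangle_rev s (- RtoC (INR n))).
rewrite (Cmod_opp (RtoC _)), Cmod_R, Rabs_pos_eq in T by exact Hn.
assert (T2 := re_le_Cmod (s - RtoC 1)). rewrite re_minus, re_RtoC in T2.
rewrite Rabs_left in T2 by lra. lra.
Qed.

Lemma cderiv_em_sum (L n : nat) (w : C) (N : nat) : 0 < Re w -> (1 <= N)%nat ->
  cderiv (fun s => em_sum L s w N * / (s - RtoC 1))%C (- RtoC (INR n)) (em_deriv L n w N).
Proof.
intros Hw HN. set (s0 := (- RtoC (INR n))%C).
assert (Hx : 0 < INR N) by (apply lt_0_INR; lia).
set (x := INR N) in *.
assert (Hn := pos_INR n).
assert (Ne : forall h, Cmod h < 1 / 2 -> (s0 + h - RtoC 1)%C <> RtoC 0).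
{ intros h Hh. apply Cmod_gt_0. destruct (near_opp_nat n (s0 + h)) as [H _]; [|lra].
  fold s0. now replace (s0 + h - s0)%C with h by ring. }
assert (Ne0 : (s0 - RtoC 1)%C <> RtoC 0).
{ replace (s0 - RtoC 1)%C with (s0 + RtoC 0 - RtoC 1)%C by ring. apply Ne. rewrite Cmod_0. lra. }
apply (cderiv_ext_loc (fun s => csum (fun k => Cpower (RtoC (INR k) + w) (- s)) N
  + (Cpower (RtoC x) (- (s - RtoC 1)) * / (s - RtoC 1)
  + csum (fun k => bern w k * poch s k * Cpower (RtoC x) (- (s + RtoC (INR k)))) L))%C).
{ exists (1 / 2). split; [lra|]. intros h Hh. unfold em_sum, em_tail. fold x.
  field. now apply Ne. }
eapply cderiv_eq; [|apply cderiv_plus; [|apply cderiv_plus]].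
2:{ apply (cderiv_csum (fun k s => Cpower (RtoC (INR k) + w) (- s))).
    intros k _. apply cderiv_Cpower_exponent. }
2:{ apply cderiv_mult; [apply (cderiv_Cpower_shift (RtoC x) (- RtoC 1))|].
    apply (cderiv_comp Cinv (fun t => t - RtoC 1)%C).
    - apply cderiv_inv, Ne0.
    - apply cderiv_minus; [apply cderiv_id|apply cderiv_const]. }
2:{ apply (cderiv_csum (fun k s => bern w k * poch s k * Cpower (RtoC x) (- (s + RtoC (INR k))))%C).
    intros k _. apply cderiv_mult; [apply cderiv_scal, cderiv_poch|apply cderiv_Cpower_shift]. }
unfold em_deriv, em_asym. fold x s0.
assert (Ek : forall k, Cpower (RtoC x) (- (s0 + RtoC (INR k))) = RtoC (powerRZ x (Z.of_nat n - Z.of_nat k))).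
{ intros k. rewrite <- Cpower_IZR by exact Hx. f_equal. unfold s0.
  rewrite minus_IZR, <- !INR_IZR_INZ, RtoC_minus. ring. }
assert (E1 : Cpower (RtoC x) (- (s0 + - RtoC 1)) = RtoC (x ^ S n)).
{ unfold s0. replace (- (- RtoC (INR n) + - RtoC 1))%C with (RtoC (INR (S n)))
    by (rewrite S_INR, RtoC_plus; ring).
  rewrite Cpower_nat, RtoC_pow; [reflexivity|]. intros E. apply RtoC_inj in E. lra. }
assert (E1' : Cpower (RtoC x) (- (s0 - RtoC 1)) = RtoC (x ^ S n)) by exact E1.
rewrite Clog_R by exact Hx. rewrite E1, E1'.
rewrite (csum_ext _ (fun k => - RtoC 1 * ((RtoC (INR k) + w) ^ n * Clog (RtoC (INR k) + w)))%C).
2:{ intros k _. unfold s0. replace (- - RtoC (INR n))%C with (RtoC (INR n)) by ring.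
    rewrite Cpower_nat; [ring|]. apply Re_pos_neq_0, Re_shift_pos, Hw. }
rewrite csum_scal.
rewrite (csum_ext (fun k => bern w k * dpoch s0 k * Cpower (RtoC x) (- (s0 + RtoC (INR k)))
     + bern w k * poch s0 k * (- RtoC (ln x) * Cpower (RtoC x) (- (s0 + RtoC (INR k)))))%C
   (fun k => bern w k * (dpoch s0 k - poch s0 k * RtoC (ln x))
       * RtoC (powerRZ x (Z.of_nat n - Z.of_nat k)))%C L)
  by (intros k _; rewrite Ek; ring).
assert (Hm : 0 < INR (S n)) by (apply lt_0_INR; lia).
assert (Hm' : RtoC (INR (S n)) <> RtoC 0) by (intros E; apply RtoC_inj in E; lra).
assert (E2 : (s0 - RtoC 1)%C = (- RtoC (INR (S n)))%C)
  by (unfold s0; rewrite S_INR, RtoC_plus; ring).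
rewrite E2, !RtoC_div, !RtoC_mult by nra. field. exact Hm'.
Qed.

(** On the disc of radius 1/2 about [- n] one has [Re s >= - n - 1], which is [P + 2 - L] for
    [L = n + P + 3]. There [1 / |s - 1| <= 2], and the Cauchy estimate gives
    [32 = 8 * 2 / (1 / 2)]. *)
Lemma em_deriv_step (n P : nat) (B : R) : 0 <= B -> exists K n0, 0 <= K /\ (1 <= n0)%nat /\
  forall N w, (n0 <= N)%nat -> 0 < Re w -> Cmod w <= B ->
    Cmod (em_deriv (n + P + 3) n w (S N) - em_deriv (n + P + 3) n w N)
      <= K * (/ INR N) ^ P / (INR N * INR N).
Proof.
intros HB. set (L := (n + P + 3)%nat). assert (Hn := pos_INR n).
destruct (em_step_sharp L P (B + INR n + 1)) as [K [n0 [HK [Hn0 H]]]]; [lra|].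
exists (32 * K), n0. split; [lra|]. split; [exact Hn0|]. intros N w HN Hw HwB.
assert (Hy : 0 < INR N) by (apply lt_0_INR; lia).
replace (32 * K * (/ INR N) ^ P / (INR N * INR N)) with
  (8 * (2 * (K * (/ INR N) ^ P / (INR N * INR N))) / (1 / 2)) by (field; lra).
apply (Cauchy_estimate (fun s => em_sum L s w (S N) * / (s - RtoC 1) - em_sum L s w N * / (s - RtoC 1))%C
  (- RtoC (INR n))); [lra| | |].
- intros s Hs. destruct (near_opp_nat n s Hs) as [H1 _].
  assert (D : cderiv (fun t => / (t - RtoC 1))%C s (- / ((s - RtoC 1) * (s - RtoC 1)) * (RtoC 1 - RtoC 0))%C).
  { apply (cderiv_comp Cinv (fun t => t - RtoC 1)%C).
    - apply cderiv_inv, Cmod_gt_0. lra.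
    - apply cderiv_minus; [apply cderiv_id|apply cderiv_const]. }
  destruct (ex_cderiv_em_sum L w (S N) s) as [l1 D1]. destruct (ex_cderiv_em_sum L w N s) as [l2 D2].
  eexists. apply cderiv_minus; (apply cderiv_mult; [eassumption|exact D]).
- apply cderiv_minus; apply cderiv_em_sum; try assumption; lia.
- intros s Hs. destruct (near_opp_nat n s Hs) as [H1 [H2 H3]].
  replace (em_sum L s w (S N) * / (s - RtoC 1) - em_sum L s w N * / (s - RtoC 1))%C with
    (/ (s - RtoC 1) * (em_sum L s w (S N) - em_sum L s w N))%C by ring.
  rewrite Cmod_mult, Cmod_inv by (apply Cmod_gt_0; lra).
  apply Rmult_le_compat; [left; apply Rinv_0_lt_compat; lra|apply Cmod_ge_0| |].
  + rewrite <- (Rinv_inv 2). apply Rinv_le_contravar; lra.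
  + apply H; [exact HN|lra|lra|]. unfold L. rewrite !plus_INR. simpl (INR 3). lra.
Qed.

Lemma zeta_cont_deriv (n P : nat) (w : C) : 0 < Re w ->
  exists l, cderiv (zeta_cont w) (- RtoC (INR n)) l /\ clim (em_deriv (n + P + 3) n w) l.
Proof.
intros Hw. set (L := (n + P + 3)%nat). assert (Hn := pos_INR n). assert (HwB := Cmod_ge_0 w).
destruct (em_step_sharp L 0 (Cmod w + INR n + 1)) as [K [n0 [HK [Hn0 H]]]]; [lra|].
assert (HL : INR L = INR n + INR P + 3) by (unfold L; rewrite !plus_INR; simpl (INR 3); ring).
assert (HP := pos_INR P).
destruct (Weierstrass (fun N s => em_sum L s w N * / (s - RtoC 1))%C (zeta_cont w)
   (em_deriv L n w) (- RtoC (INR n)) (1 / 2) (2 * K) n0) as [l [Hl [Hc _]]]; try assumption; try lra.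
- intros N HN. split; [|apply cderiv_em_sum; [exact Hw|lia]].
  intros s Hs. destruct (near_opp_nat n s Hs) as [H1 _].
  destruct (ex_cderiv_em_sum L w N s) as [l1 D1]. eexists.
  apply cderiv_mult; [exact D1|]. apply (cderiv_comp Cinv (fun t => t - RtoC 1)%C).
  + apply cderiv_inv, Cmod_gt_0. lra.
  + apply cderiv_minus; [apply cderiv_id|apply cderiv_const].
- intros N s HN Hs. destruct (near_opp_nat n s Hs) as [H1 [H2 H3]].
  replace (em_sum L s w (S N) * / (s - RtoC 1) - em_sum L s w N * / (s - RtoC 1))%C with
    (/ (s - RtoC 1) * (em_sum L s w (S N) - em_sum L s w N))%C by ring.
  rewrite Cmod_mult, Cmod_inv by (apply Cmod_gt_0; lra).
  replace (2 * K / (INR N * INR N)) with (2 * (K * (/ INR N) ^ 0 / (INR N * INR N)))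
    by (simpl; unfold Rdiv; ring).
  apply Rmult_le_compat; [left; apply Rinv_0_lt_compat; lra|apply Cmod_ge_0| |].
  + rewrite <- (Rinv_inv 2). apply Rinv_le_contravar; lra.
  + apply H; [exact HN|lra|lra|]. simpl (INR 0). lra.
- intros s Hs. destruct (near_opp_nat n s Hs) as [_ [_ H3]].
  unfold zeta_cont. rewrite Cmult_comm.
  apply (clim_ext (fun N => / (s - RtoC 1) * em_sum L s w N)%C).
  + exists O. intros; apply Cmult_comm.
  + apply clim_scal, zeta_entire_lim. lra.
- now exists l.
Qed.

Definition zeta_cont' (n : nat) (w : C) : C := deriv_at (zeta_cont w) (- RtoC (INR n)).

(** The derivative is independent of [P], so a single value is approached at every order of
    truncation. *)
Lemma zeta_cont'_spec (n P : nat) (w : C) : 0 < Re w ->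
  cderiv (zeta_cont w) (- RtoC (INR n)) (zeta_cont' n w) /\
  clim (em_deriv (n + P + 3) n w) (zeta_cont' n w).
Proof.
intros Hw. destruct (zeta_cont_deriv n P w Hw) as [l [Hl Hc]].
assert (D : cderiv (zeta_cont w) (- RtoC (INR n)) (zeta_cont' n w))
  by (apply deriv_at_spec; now exists l).
split; [exact D|]. now rewrite (cderiv_unique _ _ _ _ D Hl).
Qed.

Lemma zeta_cont'_rate (n P : nat) (w : C) : 0 < Re w -> exists K n0, (1 <= n0)%nat /\
  forall N, (n0 <= N)%nat ->
    Cmod (em_deriv (n + P + 3) n w N - zeta_cont' n w) <= K * (/ INR N) ^ P / INR N.
Proof.
intros Hw. destruct (em_deriv_step n P (Cmod w) (Cmod_ge_0 w)) as [K [n0 [HK [Hn0 H]]]].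
exists (2 * K), n0. split; [exact Hn0|]. intros N HN.
destruct (zeta_cont'_spec n P w Hw) as [_ Hc].
assert (Hy : 0 < INR N) by (apply lt_0_INR; lia).
assert (HyP : 0 <= (/ INR N) ^ P) by (apply pow_le; left; now apply Rinv_0_lt_compat).
rewrite Cmod_sub_sym.
apply (clim_le (fun m => em_deriv (n + P + 3) n w m - em_deriv (n + P + 3) n w N)%C).
- apply clim_minus; [exact Hc|apply clim_const].
- exists N. intros m Hm.
  replace (2 * K * (/ INR N) ^ P / INR N) with (2 * (K * (/ INR N) ^ P) / INR N) by (unfold Rdiv; ring).
  (* From [N] on, [(1 / k)^P <= (1 / N)^P], so the rate can be frozen into the constant of the
     telescoping bound. *)
  apply (telescoping_bound (em_deriv (n + P + 3) n w) (K * (/ INR N) ^ P) N); try lia.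
  + now apply Rmult_le_pos.
  + intros k Hk. eapply Rle_trans; [apply H; [lia|exact Hw|lra]|].
    assert (Hk1 : INR N <= INR k) by now apply le_INR.
    apply Rmult_le_compat_r; [left; apply Rinv_0_lt_compat; nra|].
    apply Rmult_le_compat_l; [exact HK|]. apply pow_incr. split.
    * left. apply Rinv_0_lt_compat. lra.
    * apply Rinv_le_contravar; lra.
Qed.

Lemma ex_cderiv_em_deriv (L n N : nat) (w : C) : 0 < Re w ->
  exists l, cderiv (fun w => em_deriv L n w N) w l.
Proof.
intros Hw. unfold em_deriv, em_asym.
destruct (ex_cderiv_csum (fun k w => bern w k * (dpoch (- RtoC (INR n)) k - poch (- RtoC (INR n)) k * RtoC (ln (INR N)))
       * RtoC (powerRZ (INR N) (Z.of_nat n - Z.of_nat k)))%C w L) as [l1 H1].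
{ intros k _. destruct (ex_cderiv_bern w k) as [l Hl]. eexists.
  apply cderiv_mult; [apply cderiv_mult; [exact Hl|apply cderiv_const]|apply cderiv_const]. }
destruct (ex_cderiv_csum (fun k w => (RtoC (INR k) + w) ^ n * Clog (RtoC (INR k) + w))%C w N) as [l2 H2].
{ intros k _. assert (D : cderiv (fun t => RtoC (INR k) + t)%C w (RtoC 0 + RtoC 1)%C)
    by (apply cderiv_plus; [apply cderiv_const|apply cderiv_id]).
  eexists. apply cderiv_mult.
  - apply (cderiv_comp (fun t => t ^ n)%C (fun t => RtoC (INR k) + t)%C); [apply cderiv_pow|exact D].
  - apply (cderiv_comp Clog (fun t => RtoC (INR k) + t)%C); [apply cderiv_Clog, Re_shift_pos, Hw|exact D]. }
eexists. apply cderiv_minus; [|exact H2]. apply cderiv_plus; [apply cderiv_const|exact H1].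
Qed.

(** The Weierstrass theorem in the variable [w], on the disc of radius [Re w], which stays in the
    half-plane; the estimate of [em_deriv_step] is uniform there. *)
Lemma ex_cderiv_zeta_cont' (n : nat) (w : C) : 0 < Re w -> exists l, cderiv (zeta_cont' n) w l.
Proof.
intros Hw. assert (HwB := Cmod_ge_0 w).
destruct (em_deriv_step n 0 (Cmod w + Re w)) as [K [n0 [HK [Hn0 H]]]]; [lra|].
assert (Hd : forall z, Cmod (z - w) < Re w -> 0 < Re z /\ Cmod z <= Cmod w + Re w).
{ intros z Hz. assert (A := re_le_Cmod (z - w)). rewrite re_minus in A.
  assert (A' := Rle_lt_trans _ _ _ A Hz). apply Rabs_lt_between in A'.
  assert (T := Cmod_triangle_rev z w). lra. }
destruct (Weierstrass (fun N w => em_deriv (n + 0 + 3) n w N) (zeta_cont' n)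
   (fun N => deriv_at (fun w => em_deriv (n + 0 + 3) n w N) w) w (Re w) K n0)
  as [l [Hl _]]; try assumption; try lra.
- intros N HN. split.
  + intros z Hz. now apply ex_cderiv_em_deriv, Hd.
  + now apply deriv_at_spec, ex_cderiv_em_deriv.
- intros N z HN Hz. destruct (Hd z Hz) as [H1 H2].
  eapply Rle_trans; [now apply H|]. simpl. rewrite Rmult_1_r. lra.
- intros z Hz. now apply zeta_cont'_spec, Hd.
- now exists l.
Qed.

Lemma opp_nat_neq_1 (n : nat) : (- RtoC (INR n))%C <> RtoC 1.
Proof.
intros E. apply (f_equal Re) in E. rewrite re_opp, !re_RtoC in E.
assert (P := pos_INR n). lra.
Qed.

Lemma hurwitz_zeta'_cont (n : nat) (w : C) : 0 < Re w ->
  hurwitz_zeta' (- RtoC (INR n)) w = zeta_cont' n w.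
Proof.
intros Hw. apply (C_derive_off_1 _ (zeta_cont w)).
- intros z Hz. now apply hurwitz_zeta_cont.
- apply opp_nat_neq_1.
- now apply (zeta_cont'_spec n 0).
Qed.

Lemma riemann_zeta'_cont (n : nat) : riemann_zeta' (- RtoC (INR n)) = zeta_cont' n (RtoC 1).
Proof.
apply (C_derive_off_1 _ (zeta_cont (RtoC 1))).
- intros z Hz. now apply riemann_zeta_cont.
- apply opp_nat_neq_1.
- apply (zeta_cont'_spec n 0). simpl. lra.
Qed.

(** * The logarithm of the Bendersky Gamma functions *)

Lemma Cexp_eq_1 (z : C) : Cexp z = RtoC 1 -> Cmod z < 1 -> z = RtoC 0.
Proof.
intros E H.
assert (R0 : Re z = 0).
{ assert (M := Cmod_Cexp z). rewrite E, Cmod_1 in M. rewrite <- ln_1, M, ln_exp. reflexivity. }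
assert (I := f_equal Im E). unfold Cexp in I. simpl in I. rewrite R0, exp_0, Rmult_1_l in I.
assert (B := im_le_Cmod z). assert (B' := Rle_lt_trans _ _ _ B H). apply Rabs_lt_between in B'.
apply C_ext; [exact R0|]. simpl. assert (HPI := PI2_1).
destruct (Rtotal_order (Im z) 0) as [Hi|[Hi|Hi]]; [|exact Hi|].
- assert (S := sin_gt_0 (- Im z)). rewrite sin_neg in S. lra.
- assert (S := sin_gt_0 (Im z)). lra.
Qed.

(* Two logarithms differ by a continuous function with values in [2 i PI Z]. *)
Lemma log_unique (F1 F2 : C -> C) :
  holomorphic_on right_half_plane F1 -> holomorphic_on right_half_plane F2 ->
  (forall w, right_half_plane w -> Cexp (F1 w) = Cexp (F2 w)) ->
  F1 (RtoC 1) = F2 (RtoC 1) -> forall w, right_half_plane w -> F1 w = F2 w.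
Proof.
intros H1 H2 HE H0 w Hw.
set (p := fun t => (RtoC 1 + RtoC t * (w - RtoC 1))%C).
assert (Hp : forall t, 0 <= t <= 1 -> right_half_plane (p t)).
{ intros t Ht. unfold right_half_plane, p in *. rewrite re_plus, re_scal_l, re_minus, !re_RtoC. nra. }
set (D := fun z => (F1 z - F2 z)%C).
assert (Hc : forall t, 0 <= t <= 1 -> exists d, 0 < d /\ forall s, Rabs (s - t) < d -> Cmod (D (p s) - D (p t)) < 1).
{ intros t Ht.
  destruct (proj1 (ex_derive_cderiv _ _) (H1 (p t) (Hp t Ht))) as [l1 L1].
  destruct (proj1 (ex_derive_cderiv _ _) (H2 (p t) (Hp t Ht))) as [l2 L2].
  destruct (cderiv_cont _ _ _ (cderiv_minus _ _ _ _ _ L1 L2) 1 Rlt_0_1) as [d [Hd Hdd]].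
  assert (Hq := Cmod_ge_0 (w - RtoC 1)).
  exists (d / (Cmod (w - RtoC 1) + 1)). split; [apply Rdiv_lt_0_compat; lra|].
  intros s Hs. specialize (Hdd (RtoC (s - t) * (w - RtoC 1))%C).
  replace (p t + RtoC (s - t) * (w - RtoC 1))%C with (p s) in Hdd
    by (unfold p; rewrite RtoC_minus; ring).
  apply Hdd. rewrite Cmod_mult, Cmod_R.
  apply Rmult_lt_compat_r with (r := Cmod (w - RtoC 1) + 1) in Hs; [|lra].
  replace (d / (Cmod (w - RtoC 1) + 1) * (Cmod (w - RtoC 1) + 1)) with d in Hs by (field; lra).
  assert (Hr := Rabs_pos (s - t)). nra. }
(* Where [Cexp] takes equal values, two values of [D] at distance below 1 coincide, because 1 is
   less than [2 PI]. *)
assert (Hjump : forall s t, 0 <= s <= 1 -> 0 <= t <= 1 -> Cmod (D (p s) - D (p t)) < 1 -> D (p s) = D (p t)).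
{ intros s t Hs Ht Hst. apply Ceq_minus, Cexp_eq_1; [|exact Hst].
  unfold D. replace (F1 (p s) - F2 (p s) - (F1 (p t) - F2 (p t)))%C with
    (F1 (p s) + - F2 (p s) + (F2 (p t) + - F1 (p t)))%C by ring.
  rewrite !Cexp_plus, !Cexp_opp, !HE by now apply Hp. field. split; apply Cexp_neq_0. }
apply Ceq_minus. change (D w = RtoC 0).
(* A connectedness argument on the segment from 1 to [w]: the supremum of the parameters up to which
   [D] vanishes is attained, and cannot be less than 1. *)
set (E := fun t => 0 <= t <= 1 /\ forall s, 0 <= s <= t -> D (p s) = RtoC 0).
assert (E0 : E 0).
{ split; [lra|]. intros s Hs. replace s with 0 by lra. unfold D, p.
  replace (RtoC 1 + RtoC 0 * (w - RtoC 1))%C with (RtoC 1) by ring. rewrite H0. ring. }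
destruct (completeness E) as [m [Hub Hlub]].
{ exists 1. intros t [Ht _]. lra. }
{ now exists 0. }
assert (Hm : 0 <= m <= 1).
{ split; [now apply Hub|]. apply Hlub. intros t [Ht _]. lra. }
destruct (Hc m Hm) as [d [Hd Hdm]].
assert (Dm : D (p m) = RtoC 0).
{ destruct (classic (exists t, E t /\ m - d < t)) as [[t [Et Ht]]|Hn].
  - assert (t <= m) by now apply Hub. destruct Et as [Ht1 Et].
    rewrite <- (Et t) by lra. symmetry. apply Hjump; [exact Ht1|exact Hm|].
    apply Hdm. apply Rabs_lt_between. lra.
  - exfalso. assert (m <= m - d); [|lra]. apply Hlub. intros t Et.
    apply Rnot_lt_le. intros Ht. apply Hn. now exists t. }
assert (Em : forall s, 0 <= s <= 1 -> s < m + d -> D (p s) = RtoC 0).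
{ intros s Hs Hsm. destruct (Rlt_le_dec (m - d) s) as [Hl|Hl].
  - rewrite <- Dm. apply Hjump; [exact Hs|exact Hm|]. apply Hdm, Rabs_lt_between. lra.
  - apply NNPP. intros Hn. assert (m <= s); [|lra]. apply Hlub. intros t [Ht Et].
    apply Rnot_lt_le. intros Hst. apply Hn, Et. lra. }
assert (m = 1).
{ destruct (Rlt_le_dec m 1) as [Hl|Hl]; [|lra]. exfalso.
  set (t := Rmin 1 (m + d / 2)).
  assert (t <= m); [|unfold t, Rmin in *; destruct (Rle_dec 1 (m + d / 2)); lra].
  apply Hub. assert (0 <= t <= 1 /\ t < m + d).
  { unfold t, Rmin. destruct (Rle_dec 1 (m + d / 2)); lra. }
  split; [lra|]. intros s Hs. apply Em; lra. }
replace w with (p 1) by (unfold p; ring). apply Em; lra.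
Qed.

(** The right-hand side is itself a holomorphic logarithm vanishing at 1, hence a witness for the
    [epsilon]; [log_unique] identifies the chosen function with it. *)
Lemma log_bendersky_gamma_eq (n : nat) (w : C) : 0 < Re w ->
  log_bendersky_gamma n w = (zeta_cont' n w - zeta_cont' n (RtoC 1))%C.
Proof.
intros Hw. set (F := fun w => (zeta_cont' n w - zeta_cont' n (RtoC 1))%C).
assert (HF : is_log_bendersky_gamma n F).
{ split; [|split].
  - intros z Hz. apply ex_derive_cderiv. destruct (ex_cderiv_zeta_cont' n z Hz) as [l Hl].
    eexists. apply cderiv_minus; [exact Hl|apply cderiv_const].
  - intros z Hz. unfold bendersky_gamma. now rewrite hurwitz_zeta'_cont, riemann_zeta'_cont.
  - unfold F. ring. }
assert (HL : is_log_bendersky_gamma n (log_bendersky_gamma n))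
  by (apply (epsilon_spec (inhabits (fun _ => RtoC 0)) (is_log_bendersky_gamma n)); now exists F).
destruct HF as [F1 [F2 F3]], HL as [L1 [L2 L3]].
apply (log_unique (log_bendersky_gamma n) F); try assumption.
- intros z Hz. now rewrite L2, F2.
- now rewrite L3, F3.
Qed.

(** * Uniqueness of the constant term of an asymptotic expansion *)

Lemma clim_csum_null (u : nat -> nat -> C) (n : nat) :
  (forall m, (m < n)%nat -> clim (u m) (RtoC 0)) ->
  clim (fun s => csum (fun m => u m s) n) (RtoC 0).
Proof.
induction n as [|n IH]; intros H; simpl.
- apply clim_const.
- rewrite <- (Cplus_0_r (RtoC 0)). apply clim_plus; [apply IH; intros; apply H; lia|apply H; lia].
Qed.

Lemma clim_null_le (u : nat -> C) (v : nat -> R) : is_lim_seq v 0 ->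
  (exists n0, forall n, (n0 <= n)%nat -> Cmod (u n) <= v n) -> clim u (RtoC 0).
Proof.
intros Hv [n0 H] e He. apply is_lim_seq_spec in Hv.
destruct (Hv (mkposreal e He)) as [n1 H1]. exists (n0 + n1)%nat. intros n Hn.
rewrite Cminus_0_r. specialize (H1 n ltac:(lia)). simpl in H1. rewrite Rminus_0_r in H1.
eapply Rle_lt_trans; [apply H; lia|]. eapply Rle_lt_trans; [apply Rle_abs|exact H1].
Qed.

Lemma clim_Cmod (u : nat -> C) : is_lim_seq (fun n => Cmod (u n)) 0 -> clim u (RtoC 0).
Proof. intros H. apply (clim_null_le u _ H). exists O. intros; lra. Qed.

Lemma is_lim_seq_ln_div : is_lim_seq (fun n => ln (INR n) / INR n) 0.
Proof.
apply (is_lim_comp_seq (fun y => ln y / y) INR p_infty 0).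
- apply is_lim_div_ln_p.
- exists O. intros; discriminate.
- apply is_lim_seq_INR.
Qed.

Lemma is_lim_seq_inv_INR : is_lim_seq (fun n => / INR n) 0.
Proof.
apply (is_lim_seq_inv _ p_infty); [apply is_lim_seq_INR|discriminate].
Qed.

(** Substituting [s * s] for [s] doubles the logarithm, so twice the sequence at [s] minus its value
    at [s * s] is the constant [q], and it tends to 0. *)
Lemma log_affine_null (p q : C) :
  clim (fun s => p * RtoC (ln (INR s)) + q)%C (RtoC 0) -> p = RtoC 0 /\ q = RtoC 0.
Proof.
intros H.
assert (Hq : q = RtoC 0).
{ apply (clim_unique (fun s => RtoC 2 * (p * RtoC (ln (INR s)) + q)
     - (p * RtoC (ln (INR (s * s))) + q))%C).
  - apply (clim_ext (fun _ => q)); [|apply clim_const].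
    exists 1%nat. intros s Hs. assert (0 < INR s) by (apply lt_0_INR; lia).
    rewrite mult_INR, ln_mult by assumption. rewrite RtoC_plus. ring.
  - replace (RtoC 0) with (RtoC 2 * RtoC 0 - RtoC 0)%C by ring.
    apply clim_minus; [now apply clim_scal|].
    intros e He. destruct (H e He) as [n0 H0]. exists (S n0). intros n Hn. apply H0. nia. }
split; [|exact Hq]. subst q. apply Cmod_small_eq_0. intros e He.
destruct (H e He) as [n0 H0]. specialize (H0 (n0 + 3)%nat ltac:(lia)).
rewrite Cplus_0_r, Cminus_0_r, Cmod_mult, Cmod_R in H0.
assert (L : 1 <= ln (INR (n0 + 3))).
{ rewrite <- (ln_exp 1). apply ln_le; [apply exp_pos|]. rewrite plus_INR. simpl (INR 3).
  assert (A := exp_le_3). assert (B := pos_INR n0). lra. }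
rewrite Rabs_pos_eq in H0 by lra. assert (P := Cmod_ge_0 p). nra.
Qed.

(** After division by the top power [s^D] the lower terms are bounded by multiples of [ln s / s] and
    [1 / s], so [log_affine_null] kills the top coefficients; then the degree goes down. *)
Lemma log_polynomial_null (p q : nat -> C) (D : nat) :
  clim (fun s => csum (fun m => (p m * RtoC (ln (INR s)) + q m) * RtoC (INR s ^ m)) D)%C (RtoC 0) ->
  forall m, (m < D)%nat -> q m = RtoC 0.
Proof.
induction D as [|D IH]; intros H m Hm; [lia|].
set (t := fun m s => ((p m * RtoC (ln (INR s)) + q m) * RtoC (INR s ^ m))%C).
assert (Z : p D = RtoC 0 /\ q D = RtoC 0).
{ apply log_affine_null.
  apply (clim_ext (fun s => RtoC ((/ INR s) ^ D) * csum (fun m => t m s) (S D)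
       - csum (fun m => RtoC ((/ INR s) ^ D) * t m s) D)%C).
  - exists 1%nat. intros s Hs. assert (Hy : 0 < INR s) by (apply lt_0_INR; lia).
    rewrite csum_scal. simpl csum. unfold t at 2.
    transitivity ((p D * RtoC (ln (INR s)) + q D) * RtoC ((/ INR s) ^ D * INR s ^ D))%C.
    + rewrite RtoC_mult. ring.
    + rewrite <- Rpow_mult_distr, Rinv_l, pow1 by lra. ring.
  - rewrite <- (Cminus_0_r (RtoC 0)). apply clim_minus.
    + intros e He. destruct (H e He) as [n0 H0]. exists (S n0). intros s Hs.
      specialize (H0 s ltac:(lia)). rewrite Cminus_0_r in H0 |- *. rewrite Cmod_mult, Cmod_R.
      assert (Hy : 1 <= INR s) by (change 1 with (INR 1); apply le_INR; lia).
      assert (Hi : 0 < / INR s) by (apply Rinv_0_lt_compat; lra).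
      assert (Hi1 : / INR s <= 1) by (rewrite <- Rinv_1; apply Rinv_le_contravar; lra).
      rewrite Rabs_pos_eq by (apply pow_le; lra).
      assert (Hp : (/ INR s) ^ D <= 1) by (rewrite <- (pow1 D); apply pow_incr; lra).
      assert (Hp0 : 0 <= (/ INR s) ^ D) by (apply pow_le; lra).
      eapply Rle_lt_trans; [|exact H0]. fold t. set (c := Cmod _).
      assert (Hc : 0 <= c) by apply Cmod_ge_0. change (Cmod _) with c. nra.
    + apply (clim_csum_null (fun m s => RtoC ((/ INR s) ^ D) * t m s)%C). intros k Hk.
      apply (clim_null_le _ (fun s => Cmod (p k) * (ln (INR s) / INR s) + Cmod (q k) * / INR s)).
      * replace (Finite 0) with (Finite (Cmod (p k) * 0 + Cmod (q k) * 0)) by (f_equal; ring).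
        apply is_lim_seq_plus'; apply is_lim_seq_mult'; try apply is_lim_seq_const.
        -- apply is_lim_seq_ln_div.
        -- apply is_lim_seq_inv_INR.
      * exists 1%nat. intros s Hs.
        assert (Hy : 1 <= INR s) by (change 1 with (INR 1); apply le_INR; lia).
        assert (Hi : 0 < / INR s) by (apply Rinv_0_lt_compat; lra).
        assert (Hi1 : / INR s <= 1) by (rewrite <- Rinv_1; apply Rinv_le_contravar; lra).
        assert (Hl : 0 <= ln (INR s)) by (rewrite <- ln_1; apply ln_le; lra).
        unfold t. replace (RtoC ((/ INR s) ^ D) * ((p k * RtoC (ln (INR s)) + q k) * RtoC (INR s ^ k)))%C
          with ((p k * RtoC (ln (INR s)) + q k) * RtoC ((/ INR s) ^ D * INR s ^ k))%C
          by (rewrite RtoC_mult; ring).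
        replace ((/ INR s) ^ D * INR s ^ k) with ((/ INR s) ^ (D - k)).
        2:{ replace ((/ INR s) ^ D) with ((/ INR s) ^ (D - k) * (/ INR s) ^ k)
              by (rewrite <- pow_add; f_equal; lia).
            rewrite Rmult_assoc, <- Rpow_mult_distr, Rinv_l, pow1 by lra. ring. }
        rewrite Cmod_mult, Cmod_R.
        assert (Hq : 0 <= (/ INR s) ^ (D - k) <= / INR s).
        { split; [apply pow_le; lra|]. replace (D - k)%nat with (S (D - k - 1)) by lia.
          simpl. rewrite <- (Rmult_1_r (/ INR s)) at 3. apply Rmult_le_compat_l; [lra|].
          rewrite <- (pow1 (D - k - 1)). apply pow_incr. lra. }
        rewrite Rabs_pos_eq by lra.
        assert (T : Cmod (p k * RtoC (ln (INR s)) + q k) <= Cmod (p k) * ln (INR s) + Cmod (q k)).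
        { eapply Rle_trans; [apply Cmod_triangle|]. rewrite Cmod_mult, Cmod_R, Rabs_pos_eq by exact Hl. lra. }
        replace (Cmod (p k) * (ln (INR s) / INR s) + Cmod (q k) * / INR s) with
          ((Cmod (p k) * ln (INR s) + Cmod (q k)) * / INR s) by (unfold Rdiv; ring).
        apply Rmult_le_compat; [apply Cmod_ge_0|lra|exact T|lra]. }
destruct Z as [Zp Zq]. destruct (Nat.eq_dec m D) as [->|Hn]; [exact Zq|].
apply IH; [|lia]. revert H. apply clim_ext. exists O. intros s _. simpl csum.
rewrite Zp, Zq. ring.
Qed.

Lemma csum_extend (f : nat -> C) (a b : nat) :
  (forall k, (a <= k)%nat -> f k = RtoC 0) -> csum f (a + b) = csum f a.
Proof.
intros H. induction b as [|b IH]; [now rewrite Nat.add_0_r|].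
rewrite Nat.add_succ_r. simpl. rewrite IH, H by lia. ring.
Qed.

(** The padding [K] brings two expansions with different degree bounds [M] to sums of the same
    length. *)
Lemma expansion_upto_0 (p : nat -> C) (q : Z -> C) (M K s : nat) :
  (forall m, (M < m)%nat -> p m = RtoC 0) -> (forall m, (Z.of_nat M < m)%Z -> q m = RtoC 0) ->
  expansion_upto p q M 0 s =
  csum (fun m => (p m * RtoC (ln (INR s)) + q (Z.of_nat m)) * RtoC (INR s ^ m))%C (S M + K).
Proof.
intros Hp Hq. rewrite csum_extend.
- unfold expansion_upto. rewrite !csum_sum_n, Nat.add_0_r.
  change (csum (fun m => p m * RtoC (INR s ^ m * ln (INR s)))%C (S M)
    + csum (fun j => q (Z.of_nat j - Z.of_nat 0)%Z * RtoC (powerRZ (INR s) (Z.of_nat j - Z.of_nat 0)))%C (S M)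
    = csum (fun m => (p m * RtoC (ln (INR s)) + q (Z.of_nat m)) * RtoC (INR s ^ m))%C (S M))%C.
  rewrite <- csum_plus. apply csum_ext. intros k _.
  rewrite Z.sub_0_r, <- pow_powerRZ, RtoC_mult. ring.
- intros k Hk. rewrite Hp, Hq by lia. ring.
Qed.

Lemma constant_coefficient_unique (f : nat -> C) (p p' : nat -> C) (q q' : Z -> C) :
  is_asymptotic_expansion f p q -> is_asymptotic_expansion f p' q' -> q 0%Z = q' 0%Z.
Proof.
intros [M [Hp [Hq H]]] [M' [Hp' [Hq' H']]].
assert (A : clim (fun s => f s - expansion_upto p q M 0 s)%C (RtoC 0)).
{ apply clim_Cmod. apply (is_lim_seq_ext (fun s => INR s ^ 0 * Cmod (f s - expansion_upto p q M 0 s))).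
  - intros s. simpl. ring.
  - apply H. }
assert (A' : clim (fun s => f s - expansion_upto p' q' M' 0 s)%C (RtoC 0)).
{ apply clim_Cmod. apply (is_lim_seq_ext (fun s => INR s ^ 0 * Cmod (f s - expansion_upto p' q' M' 0 s))).
  - intros s. simpl. ring.
  - apply H'. }
apply Ceq_minus.
refine (log_polynomial_null (fun m => p m - p' m)%C (fun m => q (Z.of_nat m) - q' (Z.of_nat m))%C
  (S M + M') _ O _); [|lia].
rewrite <- (Cminus_0_r (RtoC 0)).
eapply clim_ext; [|exact (clim_minus _ _ _ _ A' A)].
exists O. intros s _. cbv beta.
rewrite (expansion_upto_0 p q M M'), (expansion_upto_0 p' q' M' M) by assumption.
replace (S M' + M)%nat with (S M + M')%nat by lia.
transitivity (csum (fun m => (p m * RtoC (ln (INR s)) + q (Z.of_nat m)) * RtoC (INR s ^ m))%C (S M + M')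
  - csum (fun m => (p' m * RtoC (ln (INR s)) + q' (Z.of_nat m)) * RtoC (INR s ^ m))%C (S M + M'))%C.
- ring.
- rewrite <- csum_minus. apply csum_ext. intros k _. ring.
Qed.

(** * The expansion of the partial sums *)

Lemma csum_rev (f : nat -> C) (n : nat) : csum f (S n) = csum (fun k => f (n - k)%nat) (S n).
Proof.
induction n as [|n IH]; [reflexivity|].
rewrite (csum_shift (fun k => f (S n - k)%nat)). rewrite Nat.sub_0_r.
change (csum f (S (S n))) with (csum f (S n) + f (S n))%C. rewrite IH, Cplus_comm. f_equal.
Qed.

(** The factor of index [n] is 0. This removes the logarithms from the negative powers of [N] in
    [em_asym]. *)
Lemma poch_opp_nat_zero (n k : nat) : (n < k)%nat -> poch (- RtoC (INR n)) k = RtoC 0.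
Proof.
intros H. replace k with (S n + (k - S n))%nat by lia. rewrite poch_add. simpl poch. ring.
Qed.

Lemma poch_opp_nat (n : nat) : poch (- RtoC (INR n)) n = RtoC ((-1) ^ n * INR (fact n)).
Proof.
induction n as [|n IH].
- simpl. f_equal. ring.
- rewrite poch_S_l.
  replace (- RtoC (INR (S n)) + RtoC 1)%C with (- RtoC (INR n))%C by (rewrite S_INR, RtoC_plus; ring).
  rewrite IH. change (fact (S n)) with (S n * fact n)%nat. rewrite mult_INR.
  rewrite <- RtoC_opp, <- RtoC_mult. f_equal. simpl pow. ring.
Qed.

(** Logarithmic differentiation: for [k <= n] no factor [- n + j] with [j < k] vanishes, and its
    reciprocal is [- 1 / (n - j)]. At [k = n] the sum is the harmonic number. *)
Lemma dpoch_opp_nat (n k : nat) : (k <= n)%nat ->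
  dpoch (- RtoC (INR n)) k =
  (- poch (- RtoC (INR n)) k * csum (fun j => / RtoC (INR (n - j))) k)%C.
Proof.
induction k as [|k IH]; intros Hk; [simpl; ring|].
simpl. rewrite IH by lia.
replace (- RtoC (INR n) + RtoC (INR k))%C with (- RtoC (INR (n - k)))%C
  by (rewrite minus_INR, RtoC_minus by lia; ring).
field. intros E. apply RtoC_inj in E. assert (P : 0 < INR (n - k)) by (apply lt_0_INR; lia). lra.
Qed.

Lemma harmonic_csum (n : nat) : RtoC (harmonic n) = csum (fun j => / RtoC (INR (n - j)))%C n.
Proof.
assert (E : RtoC (harmonic n) = csum (fun j => / RtoC (INR (S j)))%C n).
{ induction n as [|n IH].
  - reflexivity.
  - unfold harmonic in *. rewrite sum_n_Sm by lia.
    change (RtoC (sum_n_m (fun k => / INR k) 1 n + / INR (S n)) = csum (fun j => / RtoC (INR (S j)))%C (S n)).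
    rewrite RtoC_plus, IH, RtoC_inv by (apply not_0_INR; lia). reflexivity. }
rewrite E. destruct n as [|n]; [reflexivity|].
rewrite csum_rev. apply csum_ext. intros j Hj. now replace (S (n - j)) with (S n - j)%nat by lia.
Qed.

Lemma dpoch_opp_nat_harmonic (n : nat) :
  dpoch (- RtoC (INR n)) n = (RtoC ((-1) ^ (n + 1) * INR (fact n)) * RtoC (harmonic n))%C.
Proof.
rewrite dpoch_opp_nat, poch_opp_nat, harmonic_csum by lia. f_equal.
rewrite <- RtoC_opp. f_equal. rewrite pow_add. simpl. ring.
Qed.

Definition log_coef (n : nat) (w : C) (m : nat) : C :=
  if Nat.eqb m (S n) then RtoC (/ INR (S n))
  else if Nat.leb m n then (- (bern w (n - m) * poch (- RtoC (INR n)) (n - m)))%C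
  else RtoC 0.

(** Read off from [em_asym] with [m = n - k]. The partial sum is [em_asym - em_deriv], and
    [em_deriv] tends to [zeta_cont' n w]; this accounts for the extra constant at [m = 0]. *)
Definition pow_coef (n : nat) (w : C) (m : Z) : C :=
  if Z.eqb m (Z.of_nat (S n)) then RtoC (- / (INR (S n) * INR (S n)))
  else if Z.leb m (Z.of_nat n) then
    (bern w (Z.to_nat (Z.of_nat n - m)) * dpoch (- RtoC (INR n)) (Z.to_nat (Z.of_nat n - m))
     + if Z.eqb m 0 then - zeta_cont' n w else RtoC 0)%C
  else RtoC 0.

Lemma csum_single (c : nat -> C) (n N : nat) : (n < N)%nat ->
  csum (fun k => if Nat.eqb k n then c k else RtoC 0) N = c n.
Proof.
induction N as [|N IH]; intros H; [lia|]. simpl. destruct (Nat.eq_dec n N) as [->|Hn].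
- rewrite Nat.eqb_refl, csum_zero; [ring|]. intros k Hk.
  destruct (Nat.eqb_spec k N); [lia|reflexivity].
- rewrite IH by lia. destruct (Nat.eqb_spec N n); [lia|ring].
Qed.

(** With [n + 1 + P] Bernoulli terms the powers [N^(n-k)] go down exactly to [N^(-P)], where
    [expansion_upto] stops. *)
Lemma expansion_upto_em_asym (n P s : nat) (w : C) : (1 <= s)%nat ->
  expansion_upto (log_coef n w) (pow_coef n w) (S n) P s
    = (em_asym (S n + P) n w s - zeta_cont' n w)%C.
Proof.
intros Hs. unfold expansion_upto. rewrite !csum_sum_n.
assert (Hx : 0 < INR s) by (apply lt_0_INR; lia). set (x := INR s) in *.
assert (Hm : 0 < INR (S n)) by (apply lt_0_INR; lia).
set (N := (S n + P)%nat).
assert (A : csum (fun m => log_coef n w m * RtoC (x ^ m * ln x))%C (S (S n)) =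
   (RtoC (x ^ S n * ln x / INR (S n)) -
    csum (fun k => bern w k * poch (- RtoC (INR n)) k * RtoC (ln x)
       * RtoC (powerRZ x (Z.of_nat n - Z.of_nat k))) N)%C).
{ change (csum (fun m => log_coef n w m * RtoC (x ^ m * ln x))%C (S (S n))) with
    (csum (fun m => log_coef n w m * RtoC (x ^ m * ln x))%C (S n)
     + log_coef n w (S n) * RtoC (x ^ S n * ln x))%C.
  unfold N. rewrite csum_extend.
  2:{ intros k Hk. rewrite poch_opp_nat_zero by lia. ring. }
  rewrite csum_rev. rewrite Cplus_comm. unfold Cminus. f_equal.
  - unfold log_coef. rewrite Nat.eqb_refl, <- RtoC_mult. f_equal. unfold Rdiv. ring.
  - rewrite <- (Cmult_1_l (csum (fun k => bern w k * poch _ k * _ * _)%C (S n))).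
    transitivity (- RtoC 1 * csum (fun k => bern w k * poch (- RtoC (INR n)) k * RtoC (ln x)
       * RtoC (powerRZ x (Z.of_nat n - Z.of_nat k))) (S n))%C; [|ring].
    rewrite <- csum_scal. apply csum_ext. intros k Hk. unfold log_coef.
    destruct (Nat.eqb_spec (n - k) (S n)); [lia|]. destruct (Nat.leb_spec (n - k) n); [|lia].
    replace (n - (n - k))%nat with k by lia.
    rewrite <- Nat2Z.inj_sub, <- pow_powerRZ, RtoC_mult by lia. ring. }
assert (B : csum (fun j => pow_coef n w (Z.of_nat j - Z.of_nat P)
      * RtoC (powerRZ x (Z.of_nat j - Z.of_nat P)))%C (S N) =
   (- RtoC (x ^ S n / (INR (S n) * INR (S n))) +
    (csum (fun k => bern w k * dpoch (- RtoC (INR n)) k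
       * RtoC (powerRZ x (Z.of_nat n - Z.of_nat k))) N - zeta_cont' n w))%C).
{ change (csum (fun j => pow_coef n w (Z.of_nat j - Z.of_nat P)
      * RtoC (powerRZ x (Z.of_nat j - Z.of_nat P)))%C (S N)) with
   (csum (fun j => pow_coef n w (Z.of_nat j - Z.of_nat P)
      * RtoC (powerRZ x (Z.of_nat j - Z.of_nat P)))%C N
    + pow_coef n w (Z.of_nat N - Z.of_nat P) * RtoC (powerRZ x (Z.of_nat N - Z.of_nat P)))%C.
  rewrite Cplus_comm. f_equal.
  - replace (Z.of_nat N - Z.of_nat P)%Z with (Z.of_nat (S n)) by (unfold N; lia).
    unfold pow_coef. rewrite Z.eqb_refl, <- pow_powerRZ, <- RtoC_mult, <- RtoC_opp. f_equal.
    unfold Rdiv. ring.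
  - unfold N. simpl (S n + P)%nat. rewrite csum_rev.
    (* The constant becomes a sum whose only nonzero term is at [k = n], the index of the power 0,
       so that both sides match term by term. *)
    rewrite <- (csum_single (fun _ => zeta_cont' n w) n (S (n + P))) by lia.
    rewrite <- csum_minus. apply csum_ext. intros k Hk.
    replace (Z.of_nat (n + P - k) - Z.of_nat P)%Z with (Z.of_nat n - Z.of_nat k)%Z by lia.
    unfold pow_coef.
    destruct (Z.eqb_spec (Z.of_nat n - Z.of_nat k) (Z.of_nat (S n))); [lia|].
    destruct (Z.leb_spec (Z.of_nat n - Z.of_nat k) (Z.of_nat n)); [|lia].
    replace (Z.to_nat (Z.of_nat n - (Z.of_nat n - Z.of_nat k))) with k by lia.
    destruct (Nat.eqb_spec k n) as [->|Hn].
    + rewrite Z.sub_diag. simpl (powerRZ x 0). change (Z.eqb 0 0) with true. cbv iota. ring.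
    + destruct (Z.eqb_spec (Z.of_nat n - Z.of_nat k) 0); [lia|]. ring. }
transitivity (csum (fun m => log_coef n w m * RtoC (x ^ m * ln x))%C (S (S n)) +
  csum (fun j => pow_coef n w (Z.of_nat j - Z.of_nat P)
      * RtoC (powerRZ x (Z.of_nat j - Z.of_nat P)))%C (S N))%C; [reflexivity|].
rewrite A, B. unfold em_asym. fold x N.
rewrite (csum_ext (fun k => bern w k * (dpoch (- RtoC (INR n)) k - poch (- RtoC (INR n)) k * RtoC (ln x))
       * RtoC (powerRZ x (Z.of_nat n - Z.of_nat k)))%C
   (fun k => bern w k * dpoch (- RtoC (INR n)) k * RtoC (powerRZ x (Z.of_nat n - Z.of_nat k))
     - bern w k * poch (- RtoC (INR n)) k * RtoC (ln x) * RtoC (powerRZ x (Z.of_nat n - Z.of_nat k)))%C)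
  by (intros; ring).
rewrite csum_minus. ring.
Qed.

Lemma powerRZ_opp_nat_le (x : R) (k n : nat) : 1 <= x -> (n < k)%nat ->
  forall P, (P < k - n)%nat -> x ^ P * powerRZ x (Z.of_nat n - Z.of_nat k) <= / x.
Proof.
intros Hx Hk P HP.
replace (Z.of_nat n - Z.of_nat k)%Z with (- Z.of_nat (k - n))%Z by lia.
rewrite powerRZ_neg', <- pow_powerRZ.
replace (k - n)%nat with (P + S (k - n - P - 1))%nat by lia. rewrite pow_add.
assert (H1 := pow_lt x P ltac:(lra)). assert (H2 := pow_R1_Rle x (k - n - P - 1) Hx).
simpl. rewrite Rinv_mult, <- Rmult_assoc, Rinv_r, Rmult_1_l by lra.
apply Rinv_le_contravar; nra.
Qed.

Lemma em_asym_S (L n : nat) (w : C) (N : nat) : (n < L)%nat ->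
  em_asym (S L) n w N = (em_asym L n w N + bern w L * dpoch (- RtoC (INR n)) L
    * RtoC (powerRZ (INR N) (Z.of_nat n - Z.of_nat L)))%C.
Proof.
intros H. unfold em_asym. simpl csum. rewrite (poch_opp_nat_zero n L H). ring.
Qed.

(** The rate requires [n + P + 3] Bernoulli terms, two more than the expansion retains; these two
    are of order [N^(-P-1)] and [N^(-P-2)]. *)
Lemma em_asym_tail (n P s : nat) (w : C) : (1 <= s)%nat ->
  INR s ^ P * Cmod (em_asym (n + P + 3) n w s - em_asym (S n + P) n w s)
   <= (Cmod (bern w (S n + P) * dpoch (- RtoC (INR n)) (S n + P))
       + Cmod (bern w (S (S n + P)) * dpoch (- RtoC (INR n)) (S (S n + P)))) / INR s.
Proof.
intros Hs. assert (Hx : 1 <= INR s) by (change 1 with (INR 1); apply le_INR; lia).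
replace (n + P + 3)%nat with (S (S (S n + P))) by lia.
set (k := (S n + P)%nat). rewrite !em_asym_S by (unfold k; lia).
set (c1 := (bern w k * _)%C). set (c2 := (bern w (S k) * _)%C).
assert (Pos : forall z, 0 <= powerRZ (INR s) z) by (intros z; left; apply powerRZ_lt; lra).
assert (B1 := powerRZ_opp_nat_le (INR s) k n Hx ltac:(unfold k; lia) P ltac:(unfold k; lia)).
assert (B2 := powerRZ_opp_nat_le (INR s) (S k) n Hx ltac:(unfold k; lia) P ltac:(unfold k; lia)).
set (z1 := (Z.of_nat n - Z.of_nat k)%Z) in *. set (z2 := (Z.of_nat n - Z.of_nat (S k))%Z) in *.
replace (em_asym k n w s + c1 * RtoC (powerRZ (INR s) z1) + c2 * RtoC (powerRZ (INR s) z2)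
   - em_asym k n w s)%C with (c1 * RtoC (powerRZ (INR s) z1) + c2 * RtoC (powerRZ (INR s) z2))%C by ring.
assert (HP : 0 <= INR s ^ P) by (apply pow_le; lra).
assert (T := Cmod_triangle (c1 * RtoC (powerRZ (INR s) z1)) (c2 * RtoC (powerRZ (INR s) z2))).
rewrite !Cmod_mult, !Cmod_R, !Rabs_pos_eq in T by apply Pos.
apply Rle_trans with (INR s ^ P * (Cmod c1 * powerRZ (INR s) z1 + Cmod c2 * powerRZ (INR s) z2)).
- now apply Rmult_le_compat_l.
- assert (N1 := Cmod_ge_0 c1). assert (N2 := Cmod_ge_0 c2).
  apply Rmult_le_compat_l with (r := Cmod c1) in B1; [|exact N1].
  apply Rmult_le_compat_l with (r := Cmod c2) in B2; [|exact N2]. unfold Rdiv. lra.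
Qed.

Lemma log_partial_sum_expansion (n : nat) (w : C) : 0 < Re w ->
  is_asymptotic_expansion (log_partial_sum n w) (log_coef n w) (pow_coef n w).
Proof.
intros Hw. exists (S n). split; [|split].
- intros m Hm. unfold log_coef. destruct (Nat.eqb_spec m (S n)); [lia|].
  destruct (Nat.leb_spec m n); [lia|reflexivity].
- intros m Hm. unfold pow_coef. destruct (Z.eqb_spec m (Z.of_nat (S n))); [lia|].
  destruct (Z.leb_spec m (Z.of_nat n)); [lia|reflexivity].
- intros P. destruct (zeta_cont'_rate n P w Hw) as [K [n0 [Hn0 HK]]].
  set (c := Cmod (bern w (S n + P) * dpoch (- RtoC (INR n)) (S n + P))
       + Cmod (bern w (S (S n + P)) * dpoch (- RtoC (INR n)) (S (S n + P)))).
  apply is_lim_seq_spec. intros [e He]. simpl.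
  destruct (INR_large (K + c) e He) as [n1 [_ H1]]. exists (n0 + n1)%nat. intros s Hs.
  specialize (HK s ltac:(lia)). specialize (H1 s ltac:(lia)).
  assert (T := em_asym_tail n P s w ltac:(lia)). fold c in T.
  assert (Hx : 0 < INR s) by (apply lt_0_INR; lia).
  rewrite expansion_upto_em_asym by lia.
  (* Since [s >= 1], the sum up to [pred s] has exactly [s] terms. *)
  assert (E : log_partial_sum n w s = (em_asym (n + P + 3) n w s - em_deriv (n + P + 3) n w s)%C).
  { unfold em_deriv, log_partial_sum. rewrite csum_sum_n. replace (S (Nat.pred s)) with s by lia. ring. }
  rewrite E.
  replace (em_asym (n + P + 3) n w s - em_deriv (n + P + 3) n w s - (em_asym (S n + P) n w s - zeta_cont' n w))%C
    with ((em_asym (n + P + 3) n w s - em_asym (S n + P) n w s)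
      - (em_deriv (n + P + 3) n w s - zeta_cont' n w))%C by ring.
  set (a := (em_asym _ n w s - _)%C) in T |- *. set (b := (em_deriv _ n w s - _)%C) in HK |- *.
  assert (HP : 0 < INR s ^ P) by now apply pow_lt.
  rewrite Rminus_0_r, Rabs_pos_eq by (apply Rmult_le_pos; [lra|apply Cmod_ge_0]).
  eapply Rle_lt_trans; [|exact H1].
  apply Rle_trans with (INR s ^ P * (Cmod a + Cmod b)).
  + apply Rmult_le_compat_l; [lra|apply Cmod_sub_triangle].
  + assert (T2 : INR s ^ P * Cmod b <= K / INR s).
    { apply Rmult_le_compat_l with (r := INR s ^ P) in HK; [|lra].
      replace (INR s ^ P * (K * (/ INR s) ^ P / INR s)) with (K / INR s) in HK; [exact HK|].
      rewrite pow_inv. field. lra. }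
    replace ((K + c) / INR s) with (c / INR s + K / INR s) by (unfold Rdiv; ring). lra.
Qed.

Lemma S_const_eq (n : nat) (w : C) : 0 < Re w -> S_const n w = pow_coef n w 0%Z.
Proof.
intros Hw. unfold S_const, constant_term.
assert (H : exists c, exists p q, is_asymptotic_expansion (log_partial_sum n w) p q /\ c = q 0%Z).
{ exists (pow_coef n w 0%Z), (log_coef n w), (pow_coef n w). split; [|reflexivity].
  now apply log_partial_sum_expansion. }
apply (epsilon_spec (inhabits (RtoC 0))) in H. destruct H as [p [q [H E]]].
rewrite E. apply (constant_coefficient_unique _ _ _ _ _ H (log_partial_sum_expansion n w Hw)).
Qed.

Theorem theorem1p10 (n : nat) (w : C) (hw : 0 < Re w) :
  S_const n w =
    (- log_bendersky_gamma n w - riemann_zeta' (- RtoC (INR n))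
     + RtoC ((-1) ^ (n + 1) * INR (fact n)) * modified_bernoulli n w
       * RtoC (harmonic n))%C.
Proof.
(* [- zeta_cont' n w] in the constant coefficient equals $-\log\hat\Gamma_n(w)-\zeta'(-n)$; the
   other part, at index [n - 0 = n], is the Bernoulli term. *)
rewrite S_const_eq, log_bendersky_gamma_eq, riemann_zeta'_cont, modified_bernoulli_bern by exact hw.
unfold pow_coef. destruct (Z.eqb_spec 0 (Z.of_nat (S n))); [lia|].
destruct (Z.leb_spec 0 (Z.of_nat n)); [|lia].
rewrite Z.sub_0_r, Nat2Z.id, dpoch_opp_nat_harmonic. change (Z.eqb 0 0) with true. cbv iota. ring.
Qed.
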